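(* Consider the infinite Poisson model with parameters $\lambda>0$, $K>0$, $\beta>2$ and shadowing variable $S>0$ with $\mathbf{E}[S^{2/\beta}]<\infty$, with path-loss factor $L$ and interference factor $f$. Let $N\ge 0$ be a constant (the noise power), and let $Y=NL+f$ (so that the signal-to-interference-and-noise ratio is $\mathrm{SINR}=1/Y$). Put $a=\lambda\pi\,\mathbf{E}[S^{2/\beta}]/K^2$. Then the cumulative distribution function of $Y$ is $$\mathbf{P}(Y<x)=\int_0^\infty F_s(x-Ns)\,\mathbf{P}_L(ds),$$ where $\mathbf{P}_L(ds)=\frac{2a}{\beta}s^{\frac{2}{\beta}-1}e^{-as^{2/\beta}}\,ds$ is the distribution of $L$ and $F_s(y)=\mathbf{P}(f<y\mid L=s)$. Here $F_s(y)=0$ for $y\le 0$, and for $y>0$ $$F_s(y)=1-\frac{2e^{\gamma y}}{\pi}\int_0^\infty \mathcal{R}\left(\overline{\mathcal{L}}_{F_s}(\gamma+iu)\right)\cos(uy)\,du,$$ where $\gamma>0$ is an arbitrary constant, $\mathcal{R}$ denotes the real part, and $$\overline{\mathcal{L}}_{F_s}(z)=\frac1z-\frac1z\,e^{-a\left[\varphi_\beta(z)-1\right]s^{2/\beta}},\qquad \varphi_\beta(z)=e^{-z}+z^{2/\beta}\int_0^z t^{-2/\beta}e^{-t}\,dt .$$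
   Context: Infinite Poisson model: $\Phi=\{X_i\}_{i\in\mathbb{N}}$ is a homogeneous Poisson point process of intensity $\lambda$ on $\mathbb{R}^2$; $(S_i)_{i\in\mathbb{N}}$ are i.i.d. positive random variables, independent of $\Phi$, with the same distribution as $S$. The propagation losses are $L_{X_i}=\frac{(K|X_i|)^\beta}{S_i}$. The path-loss factor is $L=\inf_{i\in\mathbb{N}}L_{X_i}$, the interference factor is $f=L\sum_{i\in\mathbb{N}}\frac{1}{L_{X_i}}-1$, and $\mathrm{SINR}=\frac{1/L}{N+\sum_{i}1/L_{X_i}-1/L}=\frac{1}{NL+f}$. For complex $z$ with positive real part, powers are principal branches and the integral in $\varphi_\beta$ (the lower incomplete gamma function $\gamma(1-2/\beta,z)$) is along the segment from $0$ to $z$. The integral over $u\in(0,\infty)$ is understood as an improper (limit) integral, and conditional probabilities given $L=s$ are regular conditional probabilities (defined for almost every $s>0$). *)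

(* Defs.v *)
From HB Require Import structures.
From mathcomp Require Import all_boot all_order all_algebra.
From mathcomp Require Import all_classical all_reals all_analysis.
From mathcomp Require Import measurable_realfun.
From mathcomp.real_closed Require Export complex.

Set Implicit Arguments.
Unset Strict Implicit.
Unset Printing Implicit Defensive.

Import Order.TTheory GRing.Theory Num.Theory.
Import numFieldNormedType.Exports.

Local Open Scope classical_set_scope.
Local Open Scope ring_scope.

Section independence.
Local Open Scope ereal_scope.
Context {d d1 d2 : measure_display} {T : measurableType d}
  {T1 : measurableType d1} {T2 : measurableType d2} {R : realType}.
Variable P : probability T R.

Definition identically_distributed (X Y : {mfun T >-> T1}) : Prop :=
  forall B, measurable B -> distribution P X B = distribution P Y B.

Definition mutually_independent (X : nat -> {mfun T >-> T1}) : Prop :=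
  forall (J : seq nat) (B : nat -> set T1), uniq J ->
    (forall i, measurable (B i)) ->
    P (\bigcap_(i in [set` J]) (X i @^-1` B i)) =
    \prod_(i <- J) P (X i @^-1` B i).

Definition sigma_of (X : nat -> {mfun T >-> T1}) : set_system T :=
  <<s \bigcup_i preimage_set_system setT (X i) measurable >>.

End independence.

(* The sequences themselves, and not only the point process underlying X, are
   independent: the enumeration of the points must not depend on Y. *)
Definition independent_sequences {d d1 d2 : measure_display}
    {T : measurableType d} {T1 : measurableType d1} {T2 : measurableType d2}
    {R : realType} (P : probability T R)
    (X : nat -> {mfun T >-> T1}) (Y : nat -> {mfun T >-> T2}) : Prop :=
  forall A B, sigma_of X A -> sigma_of Y B -> P (A `&` B) = (P A * P B)%E.

Section poisson_point_process.
Context {d : measure_display} {T : measurableType d} {R : realType}.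
Variable P : probability T R.

Definition lebesgue2 : set (R * R) -> \bar R :=
  (@lebesgue_measure R \x @lebesgue_measure R)%E.

Definition point_count (X : nat -> {mfun T >-> (R * R)%type})
    (A : set (R * R)) (w : T) : \bar R :=
  (\sum_(0 <= i <oo) \d_(X i w) A)%E.

(* [poisson_pmf] is not used because it equals 1 at rate 0, whereas a set
   of measure 0 must contain no point almost surely. *)
Definition poisson_weight (m : R) (k : nat) : R :=
  expR (- m) * m ^+ k / k`!%:R.

Definition homogeneous_PPP (lambda : R)
    (X : nat -> {mfun T >-> (R * R)%type}) : Prop :=
  forall (n : nat) (A : 'I_n -> set (R * R)) (k : 'I_n -> nat),
    (forall j, measurable (A j)) ->
    (forall j, (lebesgue2 (A j) < +oo)%E) ->
    trivIset setT A ->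
    P [set w | forall j, point_count X (A j) w = (k j)%:R%:E] =
    (\prod_(j < n) poisson_weight (lambda * fine (lebesgue2 (A j))) (k j))%:E.

End poisson_point_process.

Section infinite_poisson_model.
Context {d : measure_display} {T : measurableType d} {R : realType}.
Variables (K beta : R).
Variables (X : nat -> {mfun T >-> (R * R)%type}) (S : nat -> {mfun T >-> R}).

(* The norm of the library on [R * R] is the maximum norm. *)
Definition euclidean_norm (x : R * R) : R := Num.sqrt (x.1 ^+ 2 + x.2 ^+ 2).

Definition propagation_loss (i : nat) (w : T) : R :=
  (K * euclidean_norm (X i w)) `^ beta / S i w.

Definition path_loss_factor (w : T) : R :=
  inf (range (fun i => propagation_loss i w)).

(* The inverse is that of the extended reals: 1 / 0 = +oo.  A point at the
   origin has zero loss; this happens with probability 0. *)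
Definition total_power (w : T) : \bar R :=
  (\sum_(0 <= i <oo) ((propagation_loss i w)%:E)^-1)%E.

Definition interference_factor (w : T) : \bar R :=
  ((path_loss_factor w)%:E * total_power w - 1)%E.

Definition SINR (N : R) (w : T) : \bar R :=
  let S0 := (((path_loss_factor w)%:E)^-1)%E in
  (S0 / (N%:E + total_power w - S0))%E.

Lemma measurable_propagation_loss i :
  measurable_fun setT (propagation_loss i).
Proof.
have mV (g : T -> R) : measurable_fun setT g ->
    measurable_fun setT (fun w => (g w)^-1).
  move=> mg; rewrite (_ : (fun w => _) = fun w => g w * (g w ^+ 2) `^ (- 1)).
    apply: measurable_funM => //.
    apply: (measurableT_comp (measurable_powR _)).
    exact: measurable_funX.
  apply/funext => w; rewrite powR_inv1 ?sqr_ge0//.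
  have [->|g0] := eqVneq (g w) 0; first by rewrite invr0 mul0r.
  by rewrite expr2 invfM mulrA divff// mul1r.
apply: measurable_funM; last exact: mV.
apply: (measurableT_comp (measurable_powR _)).
apply: measurable_funM => //.
rewrite (_ : (fun w => _) = fun w =>
  ((X i w).1 ^+ 2 + (X i w).2 ^+ 2) `^ 2^-1).
  apply: (measurableT_comp (measurable_powR _)).
  apply: measurable_funD; apply: measurable_funX.
    exact: (measurableT_comp measurable_fst).
  exact: (measurableT_comp measurable_snd).
by apply/funext => w; rewrite powR12_sqrt// addr_ge0// sqr_ge0.
Qed.

Lemma measurable_path_loss_factor : measurable_fun setT path_loss_factor.
Proof.
have -> : path_loss_factor =
    fine \o (fun w => einfs (fun i => (propagation_loss i w)%:E) 0%N).
  apply/funext => w; rewrite /path_loss_factor /= /einfs /sdrop /=.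
  set A := [set propagation_loss i w | i in [set: nat]].
  have -> : [set (propagation_loss k w)%:E | k in [set k | (0 <= k)%N]] =
      EFin @` A by rewrite image_comp; congr image; apply/seteqP; split.
  have A0 : A !=set0 by exists (propagation_loss 0%N w), 0%N.
  have [lA|nlA] := pselect (has_lbound A); first by rewrite ereal_inf_EFin.
  rewrite inf_out => [|[]//].
  suff -> : ereal_inf (EFin @` A) = -oo%E by [].
  apply/eqP; rewrite eq_le leNye andbT leNgt; apply/negP => lt.
  apply: nlA; have := @ereal_inf_lbound _ (EFin @` A).
  case: (ereal_inf _) lt => [r| |]// _ lb.
    by exists r => a Aa; rewrite -lee_fin; apply: lb; exists a.
  have [a Aa] := A0.
  by have := lb _ (ex_intro2 _ _ a Aa erefl); rewrite leye_eq.
apply: measurableT_comp => //.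
apply: (@measurable_fun_einfs _ _ _ setT
  (fun i w => (propagation_loss i w)%:E)) => i.
exact/measurable_EFinP/measurable_propagation_loss.
Qed.

HB.instance Definition _ :=
  isMeasurableFun.Build _ _ _ _ path_loss_factor measurable_path_loss_factor.

End infinite_poisson_model.

(* [kappa s] is a regular version of the conditional law of [f] given
   [L = s]. *)
Definition regular_conditional_distribution {d d' : measure_display}
    {T : measurableType d} {T' : measurableType d'} {R : realType}
    (P : probability T R) (f : T -> T') (L : {mfun T >-> R})
    (kappa : R.-pker R ~> T') : Prop :=
  forall (A : set T') (B : set R), measurable A -> measurable B ->
    P (f @^-1` A `&` L @^-1` B) = (\int[distribution P L]_(s in B) kappa s A)%E.

Section complex_analysis.
Context {R : realType}.
Local Open Scope complex_scope.
Implicit Types z : R[i].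

Definition cexp z : R[i] :=
  (expR (complex.Re z))%:C * (cos (complex.Im z) +i* sin (complex.Im z)).

(* principal argument, in ]-pi, pi] for z != 0 *)
Definition carg z : R :=
  let t := acos (complex.Re z / Normc.normc z) in
  if 0 <= complex.Im z then t else - t.

Definition clog z : R[i] := ln (Normc.normc z) +i* carg z.

(* principal branch; meaningless at z = 0, which [segment_integral] only meets
   at the endpoint r = 0 *)
Definition cpow z (p : R) : R[i] := cexp (p%:C * clog z).

(* integral of g along the segment from 0 to z, parametrized by r |-> r z *)
Definition segment_integral (g : R[i] -> R[i]) z : R[i] :=
  z * ((\int[lebesgue_measure]_(r in `[0, 1]) complex.Re (g (r%:C * z)))%R +i*
       (\int[lebesgue_measure]_(r in `[0, 1]) complex.Im (g (r%:C * z)))%R).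

Definition phi (beta : R) z : R[i] :=
  cexp (- z) + cpow z (2 / beta) *
    segment_integral (fun t => cpow t (- (2 / beta)) * cexp (- t)) z.

Definition Lbar (a beta s : R) z : R[i] :=
  1 / z - 1 / z * cexp (- (a%:C * (phi beta z - 1) * (s `^ (2 / beta))%:C)).

End complex_analysis.

(* limit integral: the integral over [0, M] tends to I as M tends to +oo *)
Definition improper_integral {R : realType} (g : R -> R) (I : R) : Prop :=
  (\int[lebesgue_measure]_(u in `[0, M]) g u)%R @[M --> +oo] --> I.

Definition path_loss_density {R : realType} (a beta s : R) : R :=
  2 * a / beta * s `^ (2 / beta - 1) * expR (- a * s `^ (2 / beta)).

(* Main.v *)
Require Import Defs.
From HB Require Import structures.
From mathcomp Require Import all_boot all_order all_algebra.
From mathcomp Require Import all_classical all_reals all_analysis.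
From mathcomp Require Import measurable_realfun.
From mathcomp.real_closed Require Import complex.
From mathcomp Require Import ring lra.
Set Implicit Arguments.
Unset Strict Implicit.
Unset Printing Implicit Defensive.
Import Order.TTheory GRing.Theory Num.Theory.
Import numFieldNormedType.Exports.
Local Open Scope classical_set_scope.
Local Open Scope ring_scope.

(** The losses are the image of a Poisson process, so [E exp (- sum_i h (loss_i))]
    is explicit for every [h >= 0].  With [h] infinite below [s] this gives the
    Laplace transform of the total power [sum_i 1 / loss_i] on the event [L >= s];
    differentiating in [s] yields the law of [L] and shows that, given [L = s], the
    interference factor is distributed as [W = sum_(loss_i >= s) s / loss_i], with
    [E exp (- t W) = exp (- a s^(2/beta) (phi_beta t - 1))] for [t > 0].

    Laplace transforms at the integers determine laws because [exp (- W)] takes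
    values in [[0, 1]] (Hausdorff moment problem).  To reach complex arguments,
    the derivative of the transform at integer points gives the Palm identity
    [E (W k(W)) = c \int x E k (W + x) m(dx)], hence a linear differential system in
    [u] for [E exp (- (g + iu) W)], and also the absence of atoms above 0.
    The inversion formula then reduces, by Fubini and integration by parts, to the
    boundedness and the limit [pi / 2] of the Dirichlet integral. *)

(** * Parameter integrals *)

(** The event [L = s] is null, so nothing is conditioned directly. What is explicit is the transform
    of the total power on [L >= b]; by the fundamental theorem of calculus it is the integral over
    [s >= b] of the density of [L] times the transform of [(1 + W) / s], where [1 / s] is the power
    of the strongest point. Letting [b] vary gives the joint law of [L] and the total power, and [f]
    is a function of this pair. The theorem speaks of every version of the conditional law, so the
    formulas are proved for one explicit kernel and carried over by almost sure uniqueness, through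
    rational thresholds. The transform of [W] is known on the positive half-line, while the
    inversion formula needs it on a vertical line; the differential system stands in for analytic
    continuation. For a fixed value of [W] the integrand in [u] decays only like [1 / u], so
    exchanging the limit in the cut-off [M] with the expectation requires a bound uniform in [M].
    The pointwise limit is a step function that takes half of the jump at [W = y], which is why
    atoms must be excluded. *)

Section real_integrals.
Context {R : realType}.
Notation mu := (@lebesgue_measure R).

Lemma is_derive_Rintegral {d} {Y : measurableType d}
    (m : {measure set Y -> \bar R}) (D : set Y) (f df : R -> Y -> R) (G : Y -> R)
    (a u v : R) : measurable D -> u < a < v ->
  (forall x, u < x < v -> m.-integrable D (EFin \o f x)) ->
  (forall x y, u < x < v -> D y -> is_derive x 1 (f ^~ y) (df x y)) ->
  (forall y, 0 <= G y) -> m.-integrable D (EFin \o G) ->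
  (forall x y, u < x < v -> D y -> `|df x y| <= G y) ->
  is_derive a 1 (fun x => \int[m]_(y in D) f x y) (\int[m]_(y in D) df a y).
Proof.
move=> mD auv intf dfE G0 intG dfG.
have Iuv x : (`]u, v[%classic : set R) x -> u < x < v by rewrite /= in_itv.
have E x y : u < x < v -> D y -> partial1of2 f x y = df x y.
  by move=> xuv Dy; rewrite partial1of2E; have [_ ->] := dfE _ _ xuv Dy.
have h1 x y : (`]u, v[%classic : set R) x -> D y -> derivable (f ^~ y) x 1.
  by move=> /Iuv xuv Dy; have [] := dfE _ _ xuv Dy.
have h2 x y : (`]u, v[%classic : set R) x -> D y -> `|partial1of2 f x y| <= G y.
  by move=> /Iuv xuv Dy; rewrite E//; exact: dfG.
have Ia : (`]u, v[%classic : set R) a by rewrite /= in_itv.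
have h3 x : (`]u, v[%classic : set R) x -> m.-integrable D (EFin \o f x).
  by move=> /Iuv; exact: intf.
apply: DeriveDef; first exact: (derivable_under_integral mD Ia h3 h1 G0 intG h2).
rewrite -derive1E (differentiation_under_integral mD Ia h3 h1 G0 intG h2).
by apply: eq_Rintegral => y /set_mem Dy; rewrite E.
Qed.

Lemma integrable_dominated {d} {Y : measurableType d} (m : {measure set Y -> \bar R})
    (D : set Y) (f G : Y -> R) : measurable D -> m.-integrable D (EFin \o G) ->
  measurable_fun D f -> (forall y, D y -> `|f y| <= G y) ->
  m.-integrable D (EFin \o f).
Proof.
move=> mD iG mf fG; apply: (@le_integrable _ _ _ m D mD (EFin \o f) (EFin \o G)) => //.
- exact/measurable_EFinP.
- by move=> y Dy /=; rewrite lee_fin (le_trans (fG _ Dy))// ler_norm.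
Qed.

Lemma integrable_cst_fin {d} {Y : measurableType d} (m : {measure set Y -> \bar R})
    (D : set Y) (M : R) : measurable D -> (m D < +oo)%E ->
  m.-integrable D (EFin \o cst M).
Proof.
move=> mD mDoo; apply/integrableP; split; first by apply/measurable_EFinP; exact: measurable_cst.
apply: (@le_lt_trans _ _ (\int[m]_(y in D) (cst `|M|%:E) y)%E) => //.
rewrite integral_cst// lte_mul_pinfty//.
Qed.

Lemma integrable_bounded {d} {Y : measurableType d} (m : {measure set Y -> \bar R})
    (D : set Y) (f : Y -> R) (M : R) : measurable D -> (m D < +oo)%E ->
  measurable_fun D f -> (forall y, D y -> `|f y| <= M) ->
  m.-integrable D (EFin \o f).
Proof.
move=> mD mDoo mf fM; apply: (@integrable_dominated _ _ m D f (cst M)) => //.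
exact: integrable_cst_fin.
Qed.

Lemma Rintegral_bounded_cvg {d} {Y : measurableType d}
    (m : {measure set Y -> \bar R}) (D : set Y)
    (u_ : nat -> Y -> R) (u : Y -> R) (M : R) :
  measurable D -> (m D < +oo)%E -> (forall n, measurable_fun D (u_ n)) ->
  measurable_fun D u ->
  {ae m, forall y, D y -> u_ n y @[n --> \oo] --> u y} ->
  (forall n y, D y -> `|u_ n y| <= M) ->
  \int[m]_(y in D) u_ n y @[n --> \oo] --> \int[m]_(y in D) u y.
Proof.
move=> mD mDoo mu_ mu' u_u uM.
have mEu n : measurable_fun D (EFin \o u_ n) by exact/measurable_EFinP.
have [] := @dominated_convergence _ _ _ m D mD (fun n => EFin \o u_ n)
  (EFin \o u) (EFin \o cst M) => //.
- exact/measurable_EFinP.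
- apply: filterS u_u => y uy Dy; apply: cvg_EFin; first exact: nearW.
  exact: uy.
- exact: integrable_cst_fin.
- by apply: aeW => x n Dx; rewrite lee_fin uM.
move=> iu _ h; apply: fine_cvg; rewrite fineK//.
exact: integrable_fin_num.
Qed.

Lemma probability_lty {d} {Y : measurableType d} (P : probability Y R) :
  (P setT < +oo)%E.
Proof. by rewrite probability_setT ltry. Qed.

Section fubini.
Context {d1 d2} {Y1 : measurableType d1} {Y2 : measurableType d2}
    (m1 : {sigma_finite_measure set Y1 -> \bar R})
    (m2 : {sigma_finite_measure set Y2 -> \bar R}).

(** Sections may fail to be integrable: positive and negative parts are measurable by Tonelli, and
    [fine] turns any infinite value into 0. *)
Lemma measurable_Rintegral (h : Y1 * Y2 -> R) : measurable_fun setT h ->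
  measurable_fun setT (fun x => \int[m2]_y h (x, y)).
Proof.
move=> mh; apply: measurableT_comp => //.
have mEh : measurable_fun setT (EFin \o h) by exact/measurable_EFinP.
rewrite (_ : (fun x => _) = (fun x => \int[m2]_y (EFin \o h)^\+ (x, y)) \-
    (fun x => \int[m2]_y (EFin \o h)^\- (x, y)))%E; last first.
  by apply/funext => x; rewrite integralE; congr (_ - _)%E; apply: eq_integral => y _; rewrite ?funeposE ?funenegE.
apply: emeasurable_funB.
- by apply: (measurable_fun_fubini_tonelli_F (EFin \o h)^\+)%E => //; exact: measurable_funepos.
- by apply: (measurable_fun_fubini_tonelli_F (EFin \o h)^\-)%E => //; exact: measurable_funeneg.
Qed.

(** The inner real integrals agree with the extended ones outside a null set, on which a section may
    fail to be integrable. [Fubini] is applied to the extended integrals and [fine] is taken at the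
    end. *)
Lemma Rintegral_fubiniT (g : Y1 * Y2 -> R) :
  (m1 \x m2)%E.-integrable setT (EFin \o g) ->
  \int[m1]_x \int[m2]_y g (x, y) = \int[m2]_y \int[m1]_x g (x, y).
Proof.
move=> ig.
have E1 : \int[m1]_x \int[m2]_y g (x, y) = fine (\int[m1]_x \int[m2]_y (g (x, y))%:E)%E.
  rewrite {1}/Rintegral; congr fine; apply: ae_eq_integral => //.
  - apply/measurable_EFinP; apply: measurableT_comp => //.
    exact: (measurable_fubini_F ig).
  - exact: (measurable_fubini_F ig).
  - have := integrable_ae measurableT (integrable_fubini_F ig).
    by apply: filterS => x /= /[swap] _ /(_ I) h; rewrite fineK.
have E2 : \int[m2]_y \int[m1]_x g (x, y) = fine (\int[m2]_y \int[m1]_x (g (x, y))%:E)%E.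
  rewrite {1}/Rintegral; congr fine; apply: ae_eq_integral => //.
  - apply/measurable_EFinP; apply: measurableT_comp => //.
    exact: (measurable_fubini_G ig).
  - exact: (measurable_fubini_G ig).
  - have := ae_integrable2 ig; apply: filterS => y /= h _; rewrite fineK//.
    exact: integrable_fin_num h.
by rewrite E1 E2; congr fine; exact: Fubini ig.
Qed.

Lemma Rintegral_fubini (D1 : set Y1) (D2 : set Y2) (f : Y1 * Y2 -> R) :
  measurable D1 -> measurable D2 -> measurable_fun setT f ->
  (\int[m1]_(x in D1) \int[m2]_(y in D2) `|f (x, y)|%:E < +oo)%E ->
  \int[m1]_(x in D1) \int[m2]_(y in D2) f (x, y) =
  \int[m2]_(y in D2) \int[m1]_(x in D1) f (x, y).
Proof.
move=> mD1 mD2 mf fin.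
(* Extension by zero outside the rectangle, so that the version on the whole spaces applies. *)
pose g z : R := f z * (\1_D1 z.1 * \1_D2 z.2).
have mg : measurable_fun setT g.
  apply: measurable_funM => //; apply: measurable_funM.
    by apply: measurableT_comp; [exact: measurable_indic|exact: measurable_fst].
  by apply: measurableT_comp; [exact: measurable_indic|exact: measurable_snd].
have ig : (m1 \x m2)%E.-integrable setT (EFin \o g).
  apply/integrable12ltyP; first exact/measurable_EFinP.
  move: fin; rewrite integral_mkcond; congr (_ < _)%E; apply: eq_integral => x _.
  rewrite patchE; case: ifPn => [/set_mem|/negP] xD1.
    rewrite integral_mkcond; apply: eq_integral => y _.
    rewrite patchE /g/= [\1_D1 _]indicE (mem_set xD1) mul1r indicE.
    by case: ifPn => _; rewrite ?mulr1 ?mulr0 ?normr0.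
  rewrite integral0_eq// => y _; rewrite /g/= [\1_D1 _]indicE.
  by case: (_ \in _) xD1 => // _; rewrite mul0r mulr0 normr0.
transitivity (\int[m1]_x \int[m2]_y g (x, y)).
  rewrite [LHS]Rintegral_mkcond; apply: eq_Rintegral => x _.
  rewrite patchE; case: ifPn => xD1.
    rewrite [LHS]Rintegral_mkcond; apply: eq_Rintegral => y _.
    rewrite patchE /g/= [\1_D1 _]indicE xD1 mul1r indicE.
    by case: ifPn => _; rewrite ?mulr1 ?mulr0.
  rewrite [RHS](@eq_Rintegral _ _ _ _ _ (cst 0)) ?Rintegral_cst ?mul0r// => y _.
  by rewrite /g/= [\1_D1 _]indicE (negbTE xD1) mul0r mulr0.
rewrite (Rintegral_fubiniT ig) [RHS]Rintegral_mkcond; apply: eq_Rintegral => y _.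
rewrite patchE; case: ifPn => yD2.
  rewrite [RHS]Rintegral_mkcond; apply: eq_Rintegral => x _.
  rewrite patchE /g/= [\1_D2 _]indicE yD2 mulr1 indicE.
  by case: ifPn => _; rewrite ?mulr1 ?mulr0.
rewrite (@eq_Rintegral _ _ _ _ _ (cst 0)) ?Rintegral_cst ?mul0r// => x _.
by rewrite /g/= [\1_D2 _]indicE (negbTE yD2) mulr0 mulr0.
Qed.

Lemma Rintegral_fubini_bounded (D1 : set Y1) (D2 : set Y2) (f : Y1 * Y2 -> R)
    (M : R) : measurable D1 -> measurable D2 -> measurable_fun setT f ->
  (m1 D1 < +oo)%E -> (m2 D2 < +oo)%E ->
  (forall x y, D1 x -> D2 y -> `|f (x, y)| <= M) ->
  \int[m1]_(x in D1) \int[m2]_(y in D2) f (x, y) =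
  \int[m2]_(y in D2) \int[m1]_(x in D1) f (x, y).
Proof.
move=> mD1 mD2 mf m1oo m2oo fM; apply: Rintegral_fubini => //.
apply: (@le_lt_trans _ _ (\int[m1]_(x in D1) (`|M|%:E * m2 D2))%E).
  apply: ge0_le_integral => //.
  - by move=> x _; apply: integral_ge0 => y _; rewrite lee_fin.
  - apply: measurable_funTS.
    rewrite (_ : (fun x => _) = fun x => \int[m2]_y (`|f (x, y)| * \1_D2 y)%:E)%E; last first.
      apply/funext => x; rewrite integral_mkcond; apply: eq_integral => y _.
      by rewrite patchE indicE; case: ifPn => _; rewrite ?mulr1 ?mulr0.
    apply: (@measurable_fun_fubini_tonelli_F _ _ _ _ _ _ (fun z => (`|f z| * \1_D2 z.2)%:E)).
    + apply/measurable_EFinP; apply: measurable_funM; first exact: measurableT_comp.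
      by apply: measurableT_comp; [exact: measurable_indic|exact: measurable_snd].
    + by move=> z; rewrite lee_fin mulr_ge0.
  - move=> x D1x; rewrite -integral_cst//; apply: ge0_le_integral => //.
    + apply/measurable_EFinP; apply: measurable_funTS; apply: measurableT_comp => //.
      by apply: measurableT_comp => //; exact: measurable_pair1.
    + by move=> y D2y; rewrite lee_fin (le_trans (fM _ _ _ _)) ?ler_norm.
rewrite integral_cst// lte_mul_pinfty//.
  by rewrite mule_ge0.
by rewrite fin_numM// ge0_fin_numE.
Qed.

End fubini.

End real_integrals.

(** * Laplace transforms determine finite measures *)

Section density.
Local Open Scope ereal_scope.
Context {d} {T : measurableType d} {R : realType}.
Variables (mu : {measure set T -> \bar R}) (f : T -> R).

(** The proofs [f0] and [mf] are arguments of the set function, so that the measure structure built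
    from them can be attached to it. *)
Definition mdensity (f0 : forall x, (0 <= f x)%R)
  (mf : measurable_fun setT f) := fun A => \int[mu]_(x in A) (f x)%:E.

Hypotheses (f0 : forall x, (0 <= f x)%R) (mf : measurable_fun setT f).

Let mdensity0 : mdensity f0 mf set0 = 0.
Proof. exact: integral_set0. Qed.

Let mdensity_ge0 A : 0 <= mdensity f0 mf A.
Proof. by apply: integral_ge0 => x _; rewrite lee_fin. Qed.

Let mdensity_sigma_additive : semi_sigma_additive (mdensity f0 mf).
Proof.
move=> F mF tF mUF; rewrite /mdensity ge0_integral_bigcup//=.
- by apply: is_cvg_ereal_nneg_natsum => n _; exact: mdensity_ge0.
- by apply/measurable_EFinP; exact: measurable_funTS.
- by move=> x _; rewrite lee_fin.
Qed.

HB.instance Definition _ := isMeasure.Build _ _ _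
  (mdensity f0 mf) mdensity0 mdensity_ge0 mdensity_sigma_additive.

Import HBNNSimple.

(** For an indicator this is the definition of [mdensity]; simple functions follow by linearity and
    the general case by monotone convergence. *)
Lemma ge0_integral_mdensity (h : T -> \bar R) : (forall x, 0 <= h x) ->
  measurable_fun setT h ->
  \int[mdensity f0 mf]_x h x = \int[mu]_x (h x * (f x)%:E).
Proof.
move=> h0 mh; pose g := nnsfun_approx measurableT mh.
have gh x : (g n x)%:E @[n --> \oo] --> h x by exact: cvg_nnsfun_approx.
have gnd x : {homo (fun n => (g n x)%:E) : m n / (m <= n)%N >-> m <= n}.
  by move=> m n mn; rewrite lee_fin; exact/lefP/nd_nnsfun_approx.
have mg n : measurable_fun setT (fun x => (g n x)%:E) by exact/measurable_EFinP.
have mEf : measurable_fun setT (EFin \o f) by exact/measurable_EFinP.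
have -> : \int[mdensity f0 mf]_x h x =
    limn (fun n => \int[mdensity f0 mf]_x (g n x)%:E).
  rewrite -monotone_convergence//.
  - by apply: eq_integral => x _; apply/esym/cvg_lim.
  - by move=> n x _; rewrite lee_fin.
have -> : \int[mu]_x (h x * (f x)%:E) =
    limn (fun n => \int[mu]_x ((g n x)%:E * (f x)%:E)).
  rewrite -monotone_convergence//.
  - by apply: eq_integral => x _; apply/esym/cvg_lim => //; exact: cvgeZr.
  - by move=> n; exact: emeasurable_funM.
  - by move=> n x _; rewrite mule_ge0// lee_fin.
  - by move=> x _ m n mn; rewrite lee_wpmul2r ?lee_fin//; exact: gnd.
congr (limn _); apply/funext => n.
rewrite integralT_nnsfun sintegralE.
under [RHS]eq_integral => x _ do rewrite fimfunE -fsumEFin//.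
under [RHS]eq_integral => x _ do
  (rewrite ge0_mule_fsuml; last by move=> y; exact: nnfun_muleindic_ge0).
rewrite ge0_integral_fsum//; last 2 first.
- move=> y; apply: emeasurable_funM => //.
  by apply/measurable_EFinP; exact: measurable_funM.
- move=> y x _; apply: mule_ge0; last by rewrite lee_fin.
  exact: nnfun_muleindic_ge0.
apply: eq_fsbigr => y /[!inE] -[x _ <-].
under [RHS]eq_integral => z _ do rewrite EFinM -muleA.
rewrite ge0_integralZl//; last 3 first.
- by apply: emeasurable_funM => //; exact/measurable_EFinP.
- by move=> z _; rewrite mule_ge0 ?lee_fin.
- by rewrite lee_fin.
congr *%E; rewrite [LHS]integral_mkcond; apply: eq_integral => z _.
by rewrite epatch_indic muleC.
Qed.

End density.

(** Open lower rays are stable under intersection, generate the Borel sets and, at the integers,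
    exhaust the line with finite mass. *)
Lemma measure_unique_ray {R : realType}
    (m1 m2 : {measure set R -> \bar R}) :
  (forall b : R, m1 `]-oo, b[%classic = m2 `]-oo, b[%classic) ->
  (forall b : R, (m1 `]-oo, b[%classic < +oo)%E) ->
  forall A, measurable A -> m1 A = m2 A.
Proof.
move=> m12 m1fin A mA.
pose G : set (set R) := [set `]-oo, b[%classic | b in setT].
apply: (@measure_unique _ R _ G (fun n => `]-oo, n%:R[%classic)) => //.
- rewrite [LHS](RGenInftyO.measurableE R); congr (_.-sigma.-measurable).
  by apply/seteqP; split=> [_ [x ->]|_ [x _ <-]]; exists x.
- move=> _ _ [x _ <-] [y _ <-]; exists (Order.min x y) => //.
  by apply/seteqP; split => z/=; rewrite !in_itv/= lt_min => /andP.
- by move=> n; exists n%:R.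
- apply/seteqP; split=> // x _; exists (Num.truncn `|x|).+1 => //=.
  by rewrite in_itv/= (le_lt_trans (ler_norm _))// truncnS_gt.
- by move=> _ [b _ <-].
Qed.

Lemma monotone_convergence_cvg {d} {T : measurableType d} {R : realType}
    (mu : {measure set T -> \bar R}) (g : nat -> T -> \bar R) (f : T -> \bar R) :
  (forall n, measurable_fun setT (g n)) ->
  (forall n x, (0 <= g n x)%E) ->
  (forall x m n, (m <= n)%N -> (g m x <= g n x)%E) ->
  (forall x, g n x @[n --> \oo] --> f x) ->
  (\int[mu]_x g n x @[n --> \oo] --> \int[mu]_x f x)%E.
Proof.
move=> mg g0 gnd gf.
have -> : (\int[mu]_x f x = \int[mu]_x limn (g ^~ x))%E.
  by apply: eq_integral => x _; apply/esym/cvg_lim => //; exact: gf.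
by apply: cvg_monotone_convergence => // x _ m n mn; exact: gnd.
Qed.

Lemma ge0_integral_image {d1 d2} {T1 : measurableType d1}
    {T2 : measurableType d2} {R : realType} (mu : {measure set T1 -> \bar R})
    (phi : T1 -> T2) (mphi : measurable_fun setT phi) (f : T2 -> \bar R) :
  measurable_fun setT f -> (forall y, (0 <= f y)%E) ->
  (\int[pushforward mu phi]_y f y = \int[mu]_x f (phi x))%E.
Proof. by move=> mf f0; rewrite ge0_integral_pushforward. Qed.

Section moment_problem.
Context {R : realType}.

Lemma bounded_convergence {d} {T : measurableType d}
    (mu : {finite_measure set T -> \bar R}) (D : set T)
    (u_ : nat -> T -> R) (u : T -> R) (M : R) :
  measurable D ->
  (forall n, measurable_fun D (u_ n)) ->
  (forall x, D x -> u_ n x @[n --> \oo] --> u x) ->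
  (forall n x, D x -> `|u_ n x| <= M) ->
  (\int[mu]_(x in D) (u_ n x)%:E @[n --> \oo] -->
   \int[mu]_(x in D) (u x)%:E)%E.
Proof.
move=> mD mu_ u_u uM.
have mEu n : measurable_fun D (fun x => (u_ n x)%:E).
  exact/measurable_EFinP.
have uEu x : D x -> (u_ n x)%:E @[n --> \oo] --> (u x)%:E.
  by move=> Dx; apply: cvg_EFin; [exact: nearW|exact: u_u].
have [] := @dominated_convergence _ _ _ mu D mD (fun n x => (u_ n x)%:E)
  (fun x => (u x)%:E) (cst M%:E) => //.
- exact: emeasurable_fun_cvg mEu uEu.
- exact: aeW.
- exact: finite_measure_integrable_cst.
- by apply: aeW => x n Dx; rewrite lee_fin uM.
Qed.

Context {d1 d2} {T1 : measurableType d1} {T2 : measurableType d2}.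
Variables (m1 : {finite_measure set T1 -> \bar R})
  (m2 : {finite_measure set T2 -> \bar R}).
Variables (e1 : T1 -> R) (e2 : T2 -> R).
Hypotheses (me1 : measurable_fun setT e1) (me2 : measurable_fun setT e2).
Hypotheses (e1_01 : forall x, 0 <= e1 x <= 1) (e2_01 : forall x, 0 <= e2 x <= 1).
Hypothesis moments : forall n : nat,
  (\int[m1]_x (e1 x ^+ n)%:E = \int[m2]_x (e2 x ^+ n)%:E)%E.

Let same (u : R -> R) : Prop :=
  (\int[m1]_x (u (e1 x))%:E = \int[m2]_x (u (e2 x))%:E)%E.

Let same_lim (u_ : nat -> R -> R) (u : R -> R) (M : R) :
  (forall n, measurable_fun setT (u_ n)) ->
  (forall y, 0 <= y <= 1 -> u_ n y @[n --> \oo] --> u y) ->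
  (forall n y, 0 <= y <= 1 -> `|u_ n y| <= M) ->
  (forall n, same (u_ n)) -> same u.
Proof.
move=> mu u_u uM su.
have h1 := @bounded_convergence _ _ m1 setT (fun n x => u_ n (e1 x))
  (fun x => u (e1 x)) M measurableT
  (fun n => measurableT_comp (mu n) me1) (fun x _ => u_u _ (e1_01 x))
  (fun n x _ => uM n _ (e1_01 x)).
have h2 := @bounded_convergence _ _ m2 setT (fun n x => u_ n (e2 x))
  (fun x => u (e2 x)) M measurableT
  (fun n => measurableT_comp (mu n) me2) (fun x _ => u_u _ (e2_01 x))
  (fun n x _ => uM n _ (e2_01 x)).
move: h1; under eq_fun do rewrite su.
by move=> /(cvg_unique (@ereal_hausdorff R) h2) /esym.
Qed.

Let exprn_01 (y : R) n : 0 <= y <= 1 -> `|y ^+ n| <= 1.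
Proof.
move=> /andP[y0 y1]; rewrite normrX exprn_ile1 ?normr_ge0// ger0_norm//.
Qed.

(** The exponents are multiples of [m] because these are the partial sums of an exponential series
    in [y ^+ m]. *)
Let same_poly (a : nat -> R) (m n : nat) :
  same (fun y => \sum_(j < n) a j * y ^+ (m * j)).
Proof.
have H d (T : measurableType d) (mu : {finite_measure set T -> \bar R}) (e : T -> R) :
    measurable_fun setT e -> (forall x, 0 <= e x <= 1) ->
    (\int[mu]_x (\sum_(j < n) a j * e x ^+ (m * j))%:E =
     \sum_(j < n) (a j)%:E * \int[mu]_x (e x ^+ (m * j))%:E)%E.
  move=> me e01.
  have ie k : mu.-integrable setT (fun x => (e x ^+ k)%:E).
    apply: (@integrable_bounded _ _ _ mu setT _ 1) => //.
    - by rewrite ltey_eq fin_num_measure.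
    - exact: measurable_funX.
    - by move=> x _; exact: exprn_01.
  under eq_integral do rewrite -sumEFin.
  rewrite integral_sum//=.
    by apply: eq_bigr => j _; rewrite -integralZl//; under eq_integral do rewrite EFinM.
  move=> j; under eq_fun do rewrite EFinM.
  exact: integrableZl.
by rewrite /same !H//; apply: eq_bigr => j _; rewrite moments.
Qed.

(** On [0, 1] the partial sums of the series of [expR (- (c * y ^+ m))] are bounded by [expR c], so
    bounded convergence applies. *)
Let same_expX (c : R) m : 0 <= c -> same (fun y => expR (- (c * y ^+ m))).
Proof.
move=> c0.
pose u_ n (y : R) := \sum_(j < n) ((- c) ^+ j / j`!%:R) * y ^+ (m * j).
have uE n y : u_ n y = series (exp_coeff (- (c * y ^+ m))) n.
  rewrite /u_ /series/= big_mkord; apply: eq_bigr => j _.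
  by rewrite /exp_coeff/= -mulNr exprMn -exprM mulrAC.
apply: (@same_lim u_ _ (expR c)) => //.
- move=> n; apply: measurable_sum => j; exact: measurable_funM.
- by move=> y y01; under eq_fun do rewrite uE; exact: is_cvg_series_exp_coeff.
- move=> n y y01.
  rewrite (@le_trans _ _ (series (exp_coeff c) n))//.
    rewrite /u_ /series/= big_mkord (le_trans (ler_norm_sum _ _ _))//.
    apply: ler_sum => j _; rewrite /exp_coeff/= normrM.
    rewrite -[leRHS]mulr1 ler_pM// ?normr_ge0//; last exact: exprn_01.
    by rewrite normrM normrX normrN ger0_norm// ger0_norm// invr_ge0.
  apply: (@nondecreasing_cvgn_le R (series (exp_coeff c))).
    apply/nondecreasing_seqP => k.
    by rewrite /series/= big_nat_recr//= lerDl /exp_coeff/= mulr_ge0// exprn_ge0.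
  exact: is_cvg_series_exp_coeff.
- by move=> n; exact: (same_poly (fun j => (- c) ^+ j / j`!%:R)).
Qed.

(** As [n] grows, [(y / b) ^+ n] tends to 0 below [b], equals 1 at [b] and tends to +oo above. Hence
    [expR (- (kappa * (y / b) ^+ n))] converges to the indicator of the open ray plus a weight
    [expR (- kappa)] at [b], and the moments reach an indicator directly. *)
Let same_ray (b kappa : R) : 0 < b -> 0 < kappa ->
  same (fun y => \1_`]-oo, b[ y + expR (- kappa) * \1_[set b] y).
Proof.
move=> b0 k0.
pose u_ n (y : R) := expR (- (kappa * b ^- n * y ^+ n)).
have mi (A : set R) : measurable A -> measurable_fun setT (\1_A : R -> R).
  by move=> mA; exact: measurable_indic.
apply: (@same_lim u_ _ 1) => //.
- move=> n; apply: measurableT_comp => //; apply: measurableT_comp => //.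
  exact: measurable_funM.
- move=> y /andP[y0 y1]; rewrite /u_.
  under eq_fun do rewrite -mulrA -exprVn -exprMn.
  rewrite !indicE; have [yb|yb|->] := ltgtP y b.
  + rewrite mem_set ?in_itv//= memNset/=; last by move=> yb'; rewrite yb' ltxx in yb.
    rewrite mulr0 addr0 -expR0; apply: (continuous_cvg _ (@continuous_expR R _)).
    rewrite -[X in _ --> X]oppr0; apply: cvgN.
    rewrite -[X in _ --> X](mulr0 kappa); apply: cvgMr; apply: cvg_expr.
    by rewrite ger0_norm ?mulr_ge0// ?invr_ge0 ?(ltW b0)// mulrC ltr_pdivrMr// mul1r.
  + rewrite memNset ?memNset/=; last 2 first.
    * by move=> yb'; rewrite yb' ltxx in yb.
    * by rewrite in_itv/= ltNge (ltW yb).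
    rewrite mulr0 addr0.
    apply: (@squeeze_cvgr _ _ _ _ (cst 0) (fun n => kappa^-1 * (b / y) ^+ n)).
    * apply: nearW => n; rewrite expR_ge0/= expRN -[b / y]invf_div exprVn -invfM.
      have yb_gt0 : 0 < y / b by rewrite divr_gt0// (lt_trans b0).
      rewrite [b^-1 * y]mulrC lef_pV2 ?posrE ?expR_gt0 ?mulr_gt0 ?exprn_gt0//.
      by rewrite mulrC (le_trans _ (expR_ge1Dx _))// lerDr.
    * exact: cvg_cst.
    * rewrite -[X in _ --> X](mulr0 kappa^-1); apply: cvgMr; apply: cvg_expr.
      have y_gt0 : 0 < y by exact: lt_trans yb.
      by rewrite ger0_norm ?divr_ge0 ?(ltW b0)// ltr_pdivrMr// mul1r.
  + rewrite memNset ?mem_set//=; last by rewrite in_itv/= ltxx.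
    rewrite add0r mulr1 mulVf ?gt_eqF//.
    by under eq_fun do rewrite expr1n mulr1; exact: cvg_cst.
- move=> n y /andP[y0 y1]; rewrite ger0_norm ?expR_ge0// -[leRHS]expR0 ler_expR.
  by rewrite oppr_le0 !mulr_ge0 ?(ltW k0)// ?exprn_ge0// invr_ge0 exprn_ge0// ltW.
- move=> n; apply: same_expX.
  by rewrite mulr_ge0 ?(ltW k0)// invr_ge0 exprn_ge0// ltW.
Qed.

Lemma moments_unique (A : set R) : measurable A ->
  m1 (e1 @^-1` A) = m2 (e2 @^-1` A).
Proof.
have E1 (b : R) : 0 < b -> m1 (e1 @^-1` `]-oo, b[) = m2 (e2 @^-1` `]-oo, b[).
  move=> b0.
  have H d (T : measurableType d) (mu : {finite_measure set T -> \bar R}) (e : T -> R) kappa :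
      measurable_fun setT e -> 0 <= kappa ->
      (\int[mu]_x (\1_`]-oo, b[ (e x) + expR (- kappa) * \1_[set b] (e x))%:E =
       mu (e @^-1` `]-oo, b[) + (expR (- kappa))%:E * mu (e @^-1` [set b]))%E.
    move=> me k0.
    have mI (B : set R) : measurable B -> measurable (e @^-1` B).
      by move=> mB; rewrite -[X in measurable X]setTI; exact: me.
    have mE (B : set R) : measurable B -> measurable_fun setT (fun x => (\1_B (e x))%:E : \bar R).
      move=> mB; apply/measurable_EFinP; apply: measurableT_comp => //.
    under eq_integral do rewrite EFinD EFinM.
    rewrite ge0_integralD//; last 2 first.
    - exact: mE.
    - by apply: measurable_funeM; exact: mE.
    rewrite ge0_integralZl ?lee_fin ?expR_ge0//; last exact: mE.
    have iE (B : set R) : measurable B ->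
        (\int[mu]_x (\1_B (e x))%:E = mu (e @^-1` B))%E.
      move=> mB; rewrite -[e @^-1` B]setIT -integral_indic//; exact: mI.
    by rewrite !iE.
  (* [kappa = 1] and [kappa = 2] give two linear equations in the mass of the ray and the mass of
     [b]; they are independent because [expR (- 1)] and [expR (- 2)] differ. *)
  have := same_ray b0 (@ltr01 R); have := same_ray b0 (@ltr0Sn R 1).
  rewrite /same !H//.
  have mI1 (B : set R) : measurable B -> m1 (e1 @^-1` B) \is a fin_num.
    move=> mB; apply: fin_num_measure.
    by rewrite -[X in measurable X]setTI; exact: me1.
  have mI2 (B : set R) : measurable B -> m2 (e2 @^-1` B) \is a fin_num.
    move=> mB; apply: fin_num_measure.
    by rewrite -[X in measurable X]setTI; exact: me2.
  rewrite -(fineK (mI1 `]-oo, b[%classic _))// -(fineK (mI1 [set b] _))//.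
  rewrite -(fineK (mI2 `]-oo, b[%classic _))// -(fineK (mI2 [set b] _))//.
  move: (fine _) (fine _) (fine _) (fine _) => x1 y1 x2 y2.
  rewrite -!EFinM -!EFinD => -[h2] [h1]; congr EFin.
  have e12 : expR (- 2%:R) < expR (- 1) :> R by rewrite ltr_expR ltrN2 ltr1n.
  have x12 : x1 = x2.
    have h : (expR (- 1) - expR (- 2%:R)) * (x1 - x2) = 0.
      by rewrite mulrBl !mulrBr; move: h1 h2; lra.
    move/eqP : h; rewrite mulf_eq0 !subr_eq0 => /orP[/eqP e12'|/eqP//].
    by move: e12; rewrite e12' ltxx.
  by move: h1; rewrite x12 => /addIr.
pose p1 : {measure set R -> \bar R} := pushforward m1 e1.
pose p2 : {measure set R -> \bar R} := pushforward m2 e2.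
move=> mA; apply: (@measure_unique_ray _ (p1 me1) (p2 me2)) => //.
- move=> b; have [b0|b0] := ltP 0 b; first exact: E1.
  rewrite /p1 /p2/= /pushforward.
  have H T (e : T -> R) : (forall x, 0 <= e x <= 1) -> e @^-1` `]-oo, b[ = set0.
    move=> e01; rewrite -subset0 => x/=; rewrite in_itv/= ltNge.
    by have /andP[e0 _] := e01 x; rewrite (le_trans b0).
  by rewrite !H// !measure0.
- move=> b; rewrite /p1 /pushforward/= ltey_eq fin_num_measure//.
  by rewrite -[X in measurable X]setTI; exact: me1.
Qed.

End moment_problem.

Section exp_neg.
Context {R : realType}.
Local Open Scope ereal_scope.

(** Meant for [t] in [0, +oo], with value 0 at +oo. It is real-valued so that moments and bounded
    convergence apply; the 0 taken at -oo is a default value. *)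
Definition expNe (t : \bar R) : R := fine (expeR (- t)).

Lemma expNe_01 t : 0 <= t -> (0 <= expNe t <= 1)%R.
Proof.
case: t => [t||]//; rewrite /expNe/= ?lexx ?ler01//.
by rewrite lee_fin => t0; rewrite expR_ge0/= -[leRHS]expR0 ler_expR lerNl oppr0.
Qed.

Lemma expNe_EFin (t : R) : expNe t%:E = expR (- t).
Proof. by []. Qed.

Lemma expNeD (s t : \bar R) : 0 <= s -> 0 <= t ->
  expNe (s + t) = (expNe s * expNe t)%R.
Proof.
move: s t => [s||] [t||]//; rewrite /expNe/= ?(mulr0, mul0r)//.
by rewrite opprD expRD.
Qed.

Lemma expNe_muln (n : nat) (t : \bar R) : 0 <= t ->
  (expNe t ^+ n)%R = expNe (n%:R%:E * t).
Proof.
case: t => [t||]// t0; rewrite /expNe/=; first by rewrite -mulrN -expRM_natl.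
case: n => [|n]; first by rewrite mul0e/= oppr0 expR0.
by rewrite gt0_muley ?lte_fin// expr0n.
Qed.

Lemma measurable_expNe : measurable_fun setT expNe.
Proof.
rewrite (_ : expNe = fun t : \bar R => if t == +oo%E then 0%R else
  if t == -oo%E then 0%R else expR (- fine t)); last first.
  by apply/funext => -[].
apply: measurable_fun_ifT => //; first exact: measurable_fun_eqe.
apply: measurable_fun_ifT => //; first exact: measurable_fun_eqe.
by do 2 apply: measurableT_comp => //.
Qed.

(** Measurable inverse of [expNe] on [0, +oo]; it sends every [y <= 0] to +oo. *)
Definition lnNe (y : R) : \bar R := - lne y%:E.

Lemma expNeK (t : \bar R) : 0 <= t -> lnNe (expNe t) = t.
Proof.
case: t => [t||]// _; rewrite /lnNe /expNe/=; last by rewrite lexx.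
by rewrite leNgt expR_gt0/= expRK opprK.
Qed.

Lemma measurable_lnNe : measurable_fun setT lnNe.
Proof.
rewrite (_ : lnNe = fun y => if (y <= 0)%R then +oo else (- ln y)%:E); last first.
  by apply/funext => y; rewrite /lnNe/=; case: ifPn.
apply: measurable_fun_ifT => //; first exact: measurable_fun_ler.
by apply/measurable_EFinP; exact: measurableT_comp.
Qed.

(** [expNe] embeds [0, +oo] into [0, 1] with a measurable inverse, and the moments of [expNe \o f]
    are the Laplace transform of [f] at the integers. Mass at +oo goes to the point 0, and [n = 0]
    compares the total masses. *)
Lemma laplace_unique {d1 d2} {T1 : measurableType d1} {T2 : measurableType d2}
    (m1 : {finite_measure set T1 -> \bar R})
    (m2 : {finite_measure set T2 -> \bar R})
    (f1 : T1 -> \bar R) (f2 : T2 -> \bar R) :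
  measurable_fun setT f1 -> measurable_fun setT f2 ->
  (forall x, 0 <= f1 x) -> (forall x, 0 <= f2 x) ->
  (forall n : nat, \int[m1]_x (expNe (n%:R%:E * f1 x))%:E =
                   \int[m2]_x (expNe (n%:R%:E * f2 x))%:E) ->
  forall A, measurable A -> m1 (f1 @^-1` A) = m2 (f2 @^-1` A).
Proof.
move=> mf1 mf2 f10 f20 L A mA.
have E T (f : T -> \bar R) : (forall x, 0 <= f x) ->
    f @^-1` A = (expNe \o f) @^-1` (lnNe @^-1` A).
  by move=> f0; apply/seteqP; split => x /=; rewrite expNeK.
rewrite (E _ f1)// (E _ f2)//.
apply: (@moments_unique R _ _ _ _ m1 m2 (expNe \o f1) (expNe \o f2)).
- by apply: measurableT_comp => //; exact: measurable_expNe.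
- by apply: measurableT_comp => //; exact: measurable_expNe.
- by move=> x; exact: expNe_01.
- by move=> x; exact: expNe_01.
- move=> n; under eq_integral do rewrite /= expNe_muln//.
  by under [RHS]eq_integral do rewrite /= expNe_muln//.
- by rewrite -[X in measurable X]setTI; exact: measurable_lnNe.
Qed.

End exp_neg.

(** * Joint laws from conditional kernels *)

Section semidirect.
Context {d d'} {X : measurableType d} {Y : measurableType d'} {R : realType}.
Variables (mu : {measure set X -> \bar R}) (k : R.-pker X ~> Y).
Local Open Scope ereal_scope.

Definition semidirect (D : set (X * Y)) := \int[mu]_x k x (xsection D x).

Let semidirect0 : semidirect set0 = 0.
Proof.
by rewrite /semidirect integral0_eq// => x _; rewrite xsection0 measure0.
Qed.

Let semidirect_ge0 D : 0 <= semidirect D.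
Proof. exact: integral_ge0. Qed.

Let semidirect_sigma_additive : semi_sigma_additive semidirect.
Proof.
move=> F mF tF mUF.
rewrite [X in _ --> X](_ : _ =
    \sum_(n <oo) \int[mu]_x k x (xsection (F n) x)).
  by apply: is_cvg_ereal_nneg_natsum => n _; exact: semidirect_ge0.
rewrite -integral_nneseries//; last first.
  by move=> n; apply: measurable_fun_xsection_finite_kernel; rewrite inE.
apply: eq_integral => x _; rewrite xsection_bigcup measure_bigcup//.
- by apply: eq_eseriesl => n; rewrite in_setT.
- by move=> n _; exact: measurable_xsection.
- exact: trivIset_xsection.
Qed.

HB.instance Definition _ := isMeasure.Build _ _ _
  semidirect semidirect0 semidirect_ge0 semidirect_sigma_additive.

End semidirect.

Section regular_conditional.
Context {d d'} {T : measurableType d} {T' : measurableType d'} {R : realType}.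
Variables (P : probability T R) (f : T -> T') (L : {mfun T >-> R}).
Hypothesis mf : measurable_fun setT f.
Local Open Scope ereal_scope.

(** The definition tests rectangles only. Both sides are measures in [D] that agree on rectangles,
    hence everywhere. This gives access to events that mix [L] and [f], such as [N * L + f < x]. *)
Lemma rcd_joint (kappa : R.-pker R ~> T') :
  regular_conditional_distribution P f L kappa ->
  forall D : set (R * T'), measurable D ->
  P [set w | D (L w, f w)] =
  \int[distribution P L]_s kappa s [set t | D (s, t)].
Proof.
move=> K D mD.
have mLf : measurable_fun setT (fun w => (L w, f w)) by exact/measurable_fun_pair.
pose Lf : {mfun T >-> (R * T')%type} := mfun_Sub (mem_set mLf).
pose p : {measure set (R * T') -> \bar R} := distribution P Lf.
pose q : {measure set (R * T') -> \bar R} := semidirect (distribution P L) kappa.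
transitivity (p D) => //; transitivity (q D); last first.
  by apply: eq_integral => s _; congr (kappa s _); apply/seteqP; split => t/=; rewrite /xsection/= inE.
pose C : set (set (R * T')) := [set A `*` B | A in measurable & B in measurable].
apply: (@measure_unique _ R _ C (fun=> setT)) => //.
- exact: measurable_prod_measurableType.
- move=> _ _ [A1 mA1 [B1 mB1 <-]] [A2 mA2 [B2 mB2 <-]].
  exists (A1 `&` A2); first exact: measurableI.
  by exists (B1 `&` B2); [exact: measurableI|rewrite setXI].
- by move=> n; exists setT => //; exists setT => //; rewrite setXTT.
- by rewrite bigcup_const.
- move=> _ [B mB [A mA <-]].
  transitivity (P (f @^-1` A `&` L @^-1` B)).
    by congr (P _); apply/seteqP; split => w /= [].
  rewrite K// integral_mkcond; apply: eq_integral => s _; rewrite patchE.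
  case: ifPn => sB; first by rewrite in_xsectionX.
  by rewrite notin_xsectionX// measure0.
- by move=> _; rewrite /p /= /distribution /pushforward preimage_setT probability_setT ltry.
Qed.

End regular_conditional.

(** * Laplace functional of a Poisson point process *)

Section plane_measure.
Context {R : realType}.

(* [lebesgue2] lives on the type [measurableTypeR R]; this is the same measure
   for the canonical measurable structure of [R * R]. *)
Definition plane_measure : set (R * R) -> \bar R := @lebesgue2 R.

Let plane0 : plane_measure set0 = 0%E.
Proof. exact: measure0. Qed.

Let plane_ge0 A : (0 <= plane_measure A)%E.
Proof. exact: measure_ge0. Qed.

Let plane_sigma_additive : semi_sigma_additive plane_measure.
Proof. by move=> F mF tF mUF; exact: measure_semi_sigma_additive. Qed.

HB.instance Definition _ := isMeasure.Build _ _ _ plane_measure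
  plane0 plane_ge0 plane_sigma_additive.

Definition centered_square (n : nat) : set (R * R) :=
  `[- n%:R, n%:R] `*` `[- n%:R, n%:R].

Lemma measurable_centered_square n : measurable (centered_square n).
Proof. exact: measurableX. Qed.

Lemma centered_square_fin n : (plane_measure (centered_square n) < +oo)%E.
Proof.
rewrite /plane_measure /lebesgue2 /centered_square product_measure1E//.
rewrite /= !lebesgue_measure_itv/=.
by case: ifPn => _; rewrite -?EFinD -?EFinM ?mule0 ltry.
Qed.

Lemma centered_square_exhaust x : exists n, centered_square n x.
Proof.
exists (Num.truncn (Num.max `|x.1| `|x.2|)).+1.
rewrite /centered_square/= !in_itv/= -!ler_norml.
have := truncnS_gt (Num.max `|x.1| `|x.2|); rewrite gt_max => /andP[h1 h2].
by rewrite !ltW.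
Qed.

Let plane_sigma_finite : sigma_finite setT plane_measure.
Proof.
exists centered_square.
  apply/seteqP; split => // x _; have [n nx] := centered_square_exhaust x.
  by exists n.
move=> n; split; first exact: measurable_centered_square.
exact: centered_square_fin.
Qed.

HB.instance Definition _ := Measure_isSigmaFinite.Build _ _ _ plane_measure
  plane_sigma_finite.

End plane_measure.

Section poisson_laplace.
Context {d : measure_display} {T : measurableType d} {R : realType}.
Variables (P : probability T R) (lambda : R).
Variable X : nat -> {mfun T >-> (R * R)%type}.
Hypotheses (lambda_gt0 : 0 < lambda) (X_poisson : homogeneous_PPP P lambda X).

Lemma point_count_natVy A w :
  (exists k : nat, point_count X A w = k%:R%:E) \/ point_count X A w = +oo%E.
Proof.
have -> : point_count X A w = counting [set i | A (X i w)] :> \bar R.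
  rewrite counting_dirac; apply: eq_eseriesr => i _.
  by rewrite !diracE; congr (_%:R%:E); apply/idP/idP; rewrite !inE.
by rewrite /counting; case: ifPn => _; [left; eexists|right].
Qed.

Lemma measurable_point_count A : measurable A ->
  measurable_fun setT (point_count X A).
Proof.
move=> mA; apply: ge0_emeasurable_sum => //.
move=> i _; rewrite (_ : (fun w => _) = fun w => (\1_A (X i w))%:E).
  by apply/measurable_EFinP; apply: measurableT_comp.
by [].
Qed.

Definition count_is A (k : nat) : set T := [set w | point_count X A w = k%:R%:E].

Lemma measurable_count_is A k : measurable A -> measurable (count_is A k).
Proof.
move=> mA; rewrite -[X in measurable X]setTI.
exact: (measurable_point_count mA measurableT (emeasurable_set1 _)).
Qed.

(** An infinite count gives 0 on both sides since [y > 0], so the events with a finite count, whose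
    probabilities the Poisson property prescribes, carry the whole expectation. *)
Lemma expNe_point_count A (y : R) w : 0 < y ->
  (expNe (y%:E * point_count X A w))%:E =
  (\sum_(k <oo) (expR (- (y * k%:R)) * \1_(count_is A k) w)%:E)%E.
Proof.
move=> y0; have [[k Ek]|Ey] := point_count_natVy A w.
  rewrite (nneseriesD1 (n := k))//.
  rewrite eseries0 ?adde0; last first.
    move=> m _ /andP[_ mk].
    rewrite indicE memNset ?mulr0// /count_is/= Ek => -[/eqP].
    by rewrite eqr_nat eq_sym (negbTE mk).
  by rewrite indicE mem_set// mulr1 Ek -EFinM expNe_EFin.
rewrite eseries0; first by rewrite Ey gt0_muley ?lte_fin.
move=> m _ _; rewrite indicE memNset ?mulr0// /count_is/= Ey.
by [].
Qed.

(** The exponential series at [m * expR (- y)]: the generating function of the Poisson law. *)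
Lemma sum_poisson_weight (m y : R) : 0 <= m -> 0 < y ->
  (\sum_(k <oo) (expR (- (y * k%:R)) * poisson_weight m k)%:E =
   (expR (- (m * (1 - expR (- y)))))%:E)%E.
Proof.
move=> m0 y0.
pose c := m * expR (- y).
have c0 : 0 <= c by rewrite mulr_ge0// expR_ge0.
have E k : expR (- (y * k%:R)) * poisson_weight m k = expR (- m) * exp_coeff c k.
  rewrite /poisson_weight /exp_coeff/= /c exprMn -expRM_natr mulNr; ring.
under eq_eseriesr do rewrite E EFinM.
rewrite nneseriesZl; last by move=> k _; rewrite lee_fin exp_coeff_ge0.
have -> : (\sum_(k <oo) (exp_coeff c k)%:E = (expR c)%:E)%E.
  apply/cvg_lim => //; rewrite (_ : (fun n => _) = EFin \o series (exp_coeff c)).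
    by apply: cvg_EFin; [exact: nearW|exact: is_cvg_series_exp_coeff].
  by apply/funext => n/=; rewrite sumEFin.
by rewrite -EFinM -expRD /c; congr (expR _)%:E; ring.
Qed.

Section boxes.
Variables (n : nat) (A : 'I_n -> set (R * R)) (y : 'I_n -> R).
Hypotheses (mA : forall j, measurable (A j))
  (Afin : forall j, (lebesgue2 (A j) < +oo)%E) (tA : trivIset setT A)
  (y_gt0 : forall j, 0 < y j).

Let mu j := lambda * fine (lebesgue2 (A j)).
Let N j w := point_count X (A j) w.
(** Hybrid factor: boxes below [m] already carry their exponential, the others still carry the event
    that the count is [k j]. At [m = 0] this is the defining property of the process, at [m = n] the
    joint Laplace transform. *)
Let F m (k : 'I_n -> nat) (j : 'I_n) w : R :=
  if (j < m)%N then expNe ((y j)%:E * N j w) else \1_(count_is (A j) (k j)) w.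
Let G m (k : 'I_n -> nat) (j : 'I_n) : R :=
  if (j < m)%N then expR (- (mu j * (1 - expR (- y j))))
  else poisson_weight (mu j) (k j).

Let N_ge0 j w : (0 <= N j w)%E.
Proof. by apply: nneseries_ge0. Qed.

Let F_ge0 m k j w : 0 <= F m k j w.
Proof.
rewrite /F; case: ifPn => // _.
have /expNe_01/andP[] // : (0 <= (y j)%:E * N j w)%E.
by rewrite mule_ge0// lee_fin ltW.
Qed.

Let mF m k j : measurable_fun setT (F m k j).
Proof.
rewrite /F; case: (_ < _)%N.
  apply: measurableT_comp; first exact: measurable_expNe.
  by apply: measurable_funeM; exact: measurable_point_count.
by apply: measurable_indic; exact: measurable_count_is.
Qed.

(** Induction on [m], for all [k] at once: the exponential of box [m] is expanded over the values
    [l] of its count, the induction hypothesis is used with [k] changed to [l] in that box, and the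
    Poisson weights are summed. *)
Let boxes_step m k : (m <= n)%N ->
  (\int[P]_w (\prod_(j < n) F m k j w)%:E = (\prod_(j < n) G m k j)%:E)%E.
Proof.
elim: m k => [|m IH] k mn.
  rewrite -X_poisson// -[X in P X]setIT -integral_indic//; last first.
    rewrite (_ : [set w | _] = \bigcap_(j in setT) count_is (A j) (k j)).
      by apply: fin_bigcap_measurable => // j _; exact: measurable_count_is.
    by apply/seteqP; split => [w h j _|w h j]; apply: h.
  apply: eq_integral => w _; congr EFin; rewrite /F/= indicE.
  have [h|h] := boolP (w \in _).
    rewrite big1// => j _; rewrite indicE mem_set//.
    by move: h; rewrite inE => /(_ j).
  have [j hj] : exists j, ~ count_is (A j) (k j) w.
    by apply/existsNP => hh; move: h; rewrite notin_setE; apply.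
  by rewrite (bigD1 j)//= indicE memNset// mul0r.
pose i := Ordinal mn.
pose k' l : 'I_n -> nat := fun j => if j == i then l else k j.
have ltS (j : 'I_n) : j != i -> (j < m.+1)%N = (j < m)%N.
  by move=> ji; rewrite ltnS leq_eqVlt -[X in X == m]/(nat_of_ord j) -[m in X in X || _]/(nat_of_ord i) (inj_eq val_inj) (negbTE ji).
have EF w : (\prod_(j < n) F m.+1 k j w)%:E =
    (\sum_(l <oo) (expR (- (y i * l%:R)))%:E * (\prod_(j < n) F m (k' l) j w)%:E)%E.
  rewrite (bigD1 i)//= {1}/F ltnSn EFinM expNe_point_count//.
  rewrite muleC -nneseriesZl; last first.
    by move=> l _; rewrite lee_fin mulr_ge0// expR_ge0.
  apply: eq_eseriesr => l _; rewrite [in RHS](bigD1 i)//= {2}/F ltnn /k' eqxx.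
  rewrite -!EFinM; congr EFin.
  rewrite [in LHS](eq_bigr (fun j => F m (k' l) j w)); last first.
    by move=> j ji; rewrite /F ltS// /k' (negbTE ji).
  rewrite /k'; ring.
under eq_integral do rewrite EF.
rewrite integral_nneseries//; last 2 first.
- move=> l; apply: measurable_funeM; apply/measurable_EFinP.
  by apply: measurable_prod => j _; exact: mF.
- move=> l w _; rewrite mule_ge0// lee_fin ?expR_ge0//.
  by apply: prodr_ge0 => j _.
have EG l : (\int[P]_w ((expR (- (y i * l%:R)))%:E * (\prod_(j < n) F m (k' l) j w)%:E) =
    (expR (- (y i * l%:R)))%:E * (\prod_(j < n) G m (k' l) j)%:E)%E.
  rewrite ge0_integralZl//; last 2 first.
  - by apply/measurable_EFinP; apply: measurable_prod => j _; exact: mF.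
  - by move=> w _; rewrite lee_fin; apply: prodr_ge0 => j _.
  by rewrite IH// ltnW.
under eq_eseriesr do rewrite EG.
have mu0 j : 0 <= mu j by rewrite mulr_ge0 ?(ltW lambda_gt0)// fine_ge0.
pose C := \prod_(j < n | j != i) G m.+1 k j.
have G_ge0 m' k0 j : 0 <= G m' k0 j.
  rewrite /G; case: ifPn => _; first exact: expR_ge0.
  by rewrite /poisson_weight !mulr_ge0// ?expR_ge0// exprn_ge0.
rewrite (eq_eseriesr (g := fun l => C%:E * (expR (- (y i * l%:R)) * poisson_weight (mu i) l)%:E)%E).
  rewrite nneseriesZl; last first.
    move=> l _; rewrite lee_fin mulr_ge0 ?expR_ge0//.
    by have := G_ge0 0%N (fun=> l) i.
  rewrite sum_poisson_weight// -EFinM; congr EFin.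
  by rewrite [RHS](bigD1 i)//= mulrC; congr (_ * _); rewrite /G ltnSn.
move=> l _; rewrite -!EFinM; congr EFin; rewrite (bigD1 i)//= {1}/G ltnn /k' eqxx.
rewrite (eq_bigr (fun j => G m.+1 k j)); last first.
  by move=> j ji; rewrite /G ltS// (negbTE ji).
by rewrite -/C; ring.
Qed.

Lemma laplace_boxes :
  (\int[P]_w (expNe (\sum_(j < n) (y j)%:E * point_count X (A j) w))%:E =
   (expR (- (lambda * \sum_(j < n) (1 - expR (- y j)) * fine (lebesgue2 (A j)))))%:E)%E.
Proof.
have := boxes_step (fun=> 0%N) (leqnn n).
under eq_integral => w _.
  under eq_bigr => j _ do rewrite /F ltn_ord.
  over.
move=> h; transitivity (\int[P]_w (\prod_(j < n) expNe ((y j)%:E * N j w))%:E)%E.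
  apply: eq_integral => w _; congr EFin.
  have yN0 j : (0 <= (y j)%:E * N j w)%E by rewrite mule_ge0// lee_fin ltW.
  (* Nonnegativity of the partial sums is carried along, because [expNeD] needs it. *)
  apply: (big_ind2 (fun a b => 0 <= a /\ expNe a = b)%E _ _ (fun j _ => conj (yN0 j) erefl)).2.
  - by rewrite /expNe/= oppr0 expR0.
  - by move=> a1 a2 b1 b2 [a10 <-] [b10 <-]; rewrite adde_ge0// expNeD.
rewrite h; congr EFin.
under eq_bigr => j _ do rewrite /G ltn_ord.
rewrite -expR_sum; congr expR. rewrite sumrN mulr_sumr; congr (- _).
by apply: eq_bigr => j _; rewrite /mu; ring.
Qed.

End boxes.

Notation leb2 := (@plane_measure R).

(** The point process as a random measure: sums over the points become integrals, to which monotone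
    convergence and the decomposition of simple functions apply. *)
Definition point_measure (w : T) : {measure set (R * R) -> \bar R} :=
  mseries (fun i => \d_(X i w)) 0.

Lemma integral_point_measure (w : T) (h : R * R -> \bar R) :
  (forall x, 0 <= h x)%E -> measurable_fun setT h ->
  (\int[point_measure w]_x h x = \sum_(i <oo) h (X i w))%E.
Proof.
move=> h0 mh; rewrite ge0_integral_measure_series//; apply: eq_eseriesr => i _.
by rewrite integral_dirac// diracT mul1e.
Qed.

Import HBNNSimple.

(** The nonzero values of [g] cut out finitely many disjoint sets of finite measure inside [D],
    which reduces the claim to [laplace_boxes]. The value 0 is left out: its level set may have
    infinite measure, and it contributes to neither integral. *)
Lemma laplace_simple (g : {nnsfun (R * R)%type >-> R}) (D : set (R * R)) :
  measurable D -> (lebesgue2 D < +oo)%E -> (forall x, ~ D x -> g x = 0) ->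
  (\int[P]_w (expNe (\int[point_measure w]_x (g x)%:E))%:E =
   (expNe (lambda%:E * \int[leb2]_x (1 - expNe (g x)%:E)%:E))%:E)%E.
Proof.
move=> mD Dfin gD.
pose s := [seq y <- finmap.enum_fset (fset_set (range g)) | y != 0].
pose y (j : 'I_(size s)) := s`_j; pose A j := g @^-1` [set y j].
have s_uniq : uniq s by rewrite filter_uniq// finmap.fset_uniq.
have ys j : y j \in s by rewrite mem_nth.
have y_gt0 j : 0 < y j.
  have := ys j; rewrite mem_filter => /andP[y0].
  rewrite in_fset_set// inE => -[x _ yx].
  by rewrite lt_neqAle eq_sym y0/= -yx.
have mA j : measurable (A j).
  by rewrite -[X in measurable X]setTI; apply: (measurable_funPT g) => //.
have AD j : A j `<=` D.
  move=> x; rewrite /A/= => gx; apply: contrapT => /gD gx0.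
  by have := y_gt0 j; rewrite -gx gx0 ltxx.
have Afin j : (lebesgue2 (A j) < +oo)%E.
  apply: (@le_lt_trans _ _ (leb2 D)) => //; apply: (le_measure (@plane_measure R)); last exact: AD.
  - by rewrite inE.
  - by rewrite inE.
have tA : trivIset setT A.
  move=> i j _ _ [x [/= gxi gxj]]; apply/val_inj/eqP.
  rewrite -(nth_uniq 0 _ _ s_uniq) ?ltn_ord//; apply/eqP.
  by transitivity (g x); [exact/esym/gxi|exact: gxj].
have sumE (F : R -> R) x : F 0 = 0 ->
    F (g x) = \sum_(j < size s) F (y j) * \1_(A j) x.
  move=> F0; have [gx0|gx0] := eqVneq (g x) 0.
    rewrite gx0 F0 big1// => j _; rewrite indicE memNset ?mulr0//.
    by rewrite /A/= gx0 => y0; have := y_gt0 j; rewrite -y0 ltxx.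
  have gxs : g x \in s by rewrite mem_filter gx0/= in_fset_set// inE.
  have gxn : (index (g x) s < size s)%N by rewrite index_mem.
  rewrite (bigD1 (Ordinal gxn))//= big1 ?addr0.
    by rewrite indicE mem_set ?mulr1 /y/= ?nth_index// /A/= /y/= nth_index.
  move=> j jx; rewrite indicE memNset ?mulr0// /A/= => gxj.
  by move/eqP : jx; apply; apply/val_inj => /=; rewrite gxj index_uniq.
(* Serves twice: [F] is the identity against the point measure, and [1 - expNe] against the plane
   measure. *)
have sum_int (m : {measure set (R * R) -> \bar R}) (F : R -> R) : F 0 = 0 ->
    (forall j, 0 <= F (y j)) ->
    (\int[m]_x (F (g x))%:E = \sum_(j < size s) (F (y j))%:E * m (A j))%E.
  move=> F0 Fy; under eq_integral => x _ do rewrite sumE// -sumEFin.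
  rewrite ge0_integral_sum//; last 2 first.
  - by move=> j; apply/measurable_EFinP; exact: measurable_funM.
  - by move=> j x _; rewrite lee_fin mulr_ge0.
  apply: eq_bigr => j _; under eq_integral => x _ do rewrite EFinM.
  rewrite ge0_integralZl ?lee_fin//; last first.
    by apply/measurable_EFinP; exact: measurable_indic.
  by rewrite integral_indic// setIT.
transitivity (\int[P]_w (expNe (\sum_(j < size s) (y j)%:E * point_count X (A j) w))%:E)%E.
  apply: eq_integral => w _; congr (expNe _)%:E.
  by rewrite (sum_int _ id)// => j; exact: ltW.
rewrite laplace_boxes//; congr EFin.
have -> : (\int[leb2]_x (1 - expNe (g x)%:E)%:E =
    \sum_(j < size s) (1 - expNe (y j)%:E)%:E * lebesgue2 (A j))%E.
  apply: (sum_int leb2 (fun t => 1 - expNe t%:E)).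
- by rewrite expNe_EFin oppr0 expR0 subrr.
- move=> j; rewrite subr_ge0; have /andP[]// : 0 <= expNe (y j)%:E <= 1.
  by apply: expNe_01; rewrite lee_fin ltW.
rewrite (eq_bigr (fun j => ((1 - expR (- y j)) * fine (lebesgue2 (A j)))%:E)).
  by rewrite sumEFin -EFinM expNe_EFin.
by move=> j _; rewrite EFinM fineK// ge0_fin_numE// measure_ge0.
Qed.

Lemma cvg_expNe (t_ : nat -> \bar R) (t : \bar R) : (0 <= t)%E ->
  t_ n @[n --> \oo] --> t -> expNe (t_ n) @[n --> \oo] --> expNe t.
Proof.
case: t => [t||]// _ h.
  have /fine_cvgP[fn ft] := h.
  apply: (@cvg_trans _ ((fun n => expR (- fine (t_ n))) @ \oo)).
    by apply: near_eq_cvg; apply: filterS fn => n; case: (t_ n).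
  apply: (continuous_cvg _ (@continuous_expR R _)); exact: cvgN.
apply/cvgrPdist_le => e e0; rewrite /expNe/=.
(* Beyond the threshold [- ln e] the exponential is at most [e]. *)
have /cvgeyPge/(_ (- ln e)) := h.
apply: filterS => n; case: (t_ n) => [r||]//=; rewrite ?subrr ?normr0 ?(ltW e0)//.
rewrite lee_fin => hr; rewrite sub0r normrN ger0_norm ?expR_ge0//.
by rewrite -[leRHS]lnK ?posrE// ler_expR lerNl.
Qed.

Lemma measurable_sum_points (h : R * R -> \bar R) :
  (forall x, 0 <= h x)%E -> measurable_fun setT h ->
  measurable_fun setT (fun w => \sum_(i <oo) h (X i w))%E.
Proof.
move=> h0 mh; apply: ge0_emeasurable_sum => // i _.
exact: measurableT_comp.
Qed.

(** Simple approximations of [h], cut off by growing squares, increase to [h] and are supported on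
    sets of finite measure. The left side converges by bounded convergence, since [expNe] stays in
    [0, 1], the right side by monotone convergence. *)
Lemma laplace_poisson (h : R * R -> \bar R) :
  (forall x, 0 <= h x)%E -> measurable_fun setT h ->
  (\int[P]_w (expNe (\sum_(i <oo) h (X i w)))%:E =
   (expNe (lambda%:E * \int[leb2]_x (1 - expNe (h x))%:E))%:E)%E.
Proof.
move=> h0 mh.
pose D := @centered_square R.
have mD : forall n, measurable (D n) := @measurable_centered_square R.
have Dfin : forall n, (lebesgue2 (D n) < +oo)%E := @centered_square_fin R.
have Dnd m n : (m <= n)%N -> D m `<=` D n.
  move=> mn x [/=]; rewrite !in_itv/= => /andP[a1 a2] /andP[b1 b2].
  have mn' : m%:R <= n%:R :> R by rewrite ler_nat.
  by rewrite /D /centered_square/= !in_itv/=; split; apply/andP; split; lra.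
pose g n : {nnsfun (R * R)%type >-> R} :=
  proj_nnsfun (nnsfun_approx measurableT mh n) (mD n).
have gh x : (g n x)%:E @[n --> \oo] --> h x.
  have := cvg_nnsfun_approx measurableT mh (fun x _ => h0 x) (I : setT x).
  apply: cvg_trans; apply: near_eq_cvg; have [n0 Dn0x] := centered_square_exhaust x.
  exists n0 => // n /= n0n; rewrite mindicE mem_set ?mulr1//.
  exact: Dnd n0n _ Dn0x.
have gnd x : {homo (fun n => (g n x)%:E) : m n / (m <= n)%N >-> (m <= n)%E}.
  move=> m n mn; rewrite lee_fin /= !mindicE.
  apply: ler_pM => //.
    by have /lefP := nd_nnsfun_approx measurableT mh mn.
  rewrite ler_nat; case: (boolP (x \in D m)) => //; rewrite inE => Dmx.
  by rewrite mem_set//; exact: Dnd mn _ Dmx.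
have mg n : measurable_fun setT (fun x => (g n x)%:E) by exact/measurable_EFinP.
have gD n x : ~ D n x -> g n x = 0.
  by move=> nDx; rewrite /= mindicE memNset// mulr0.
have lhs : (\int[P]_w (expNe (\int[point_measure w]_x (g n x)%:E))%:E @[n --> \oo] -->
    \int[P]_w (expNe (\sum_(i <oo) h (X i w)))%:E)%E.
  apply: (bounded_convergence (M := 1)) => //.
  - move=> n; apply: measurableT_comp; first exact: measurable_expNe.
    rewrite (_ : (fun w => _) = fun w => \sum_(i <oo) (g n (X i w))%:E)%E.
      by apply: (@measurable_sum_points (fun x => (g n x)%:E)) => // x; rewrite lee_fin.
    by apply/funext => w; apply: (@integral_point_measure w (fun x => (g n x)%:E)) => // x; rewrite lee_fin.
  - move=> w _; apply: cvg_expNe; first exact: nneseries_ge0.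
    rewrite -[X in _ --> X](integral_point_measure w h0 mh).
    apply: monotone_convergence_cvg => //.
    by move=> n x; rewrite lee_fin.
  - move=> n w _; have /expNe_01/andP[e0 e1] :
      (0 <= \int[point_measure w]_x (g n x)%:E)%E.
      by apply: integral_ge0 => x _; rewrite lee_fin.
    by rewrite ger0_norm.
have {lhs} := lhs; under eq_fun => n do rewrite (laplace_simple (mD n) (Dfin n) (gD n)).
move=> lhs.
apply: (cvg_unique (@ereal_hausdorff R) lhs).
apply: cvg_EFin; first exact: nearW.
have mE u : measurable_fun setT u -> measurable_fun setT (fun x : R * R => (1 - expNe (u x))%:E).
  move=> mu; apply/measurable_EFinP; apply: measurable_funB => //.
  by apply: measurableT_comp => //; exact: measurable_expNe.
apply: cvg_expNe.
  rewrite mule_ge0 ?lee_fin ?(ltW lambda_gt0)//; apply: integral_ge0 => x _.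
  by rewrite lee_fin subr_ge0; have /andP[] := expNe_01 (h0 x).
apply: cvgeZl => //; apply: monotone_convergence_cvg => //.
- by move=> n; exact: mE.
- move=> n x; rewrite lee_fin subr_ge0.
  by have /expNe_01/andP[] : (0 <= (g n x)%:E)%E by rewrite lee_fin.
- move=> x m n mn; rewrite lee_fin lerD2l lerN2 !expNe_EFin ler_expR lerN2.
  by rewrite -lee_fin; exact: gnd.
- by move=> x; apply: cvg_EFin; [exact: nearW|apply: cvgB; [exact: cvg_cst|exact: cvg_expNe]].
Qed.

End poisson_laplace.

(** * Independent marks *)

Section rectangles.
Context {d1 d2 da db} {T1 : measurableType d1} {T2 : measurableType d2}
  {A : measurableType da} {B : measurableType db} {R : realType}.
Variables (m1 : {measure set T1 -> \bar R}) (m2 : {measure set T2 -> \bar R}).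
Variables (G1 : T1 -> R) (G2 : T2 -> R).
Variables (V1 : T1 -> A) (V2 : T2 -> A) (Z1 : T1 -> B) (Z2 : T2 -> B).
Hypotheses (G1_ge0 : forall x, 0 <= G1 x) (G2_ge0 : forall x, 0 <= G2 x).
Hypotheses (mG1 : measurable_fun setT G1) (mG2 : measurable_fun setT G2).
Hypotheses (mV1 : measurable_fun setT V1) (mV2 : measurable_fun setT V2).
Hypotheses (mZ1 : measurable_fun setT Z1) (mZ2 : measurable_fun setT Z2).
Hypothesis G1_fin : (\int[m1]_x (G1 x)%:E < +oo)%E.
Hypothesis rect : forall C D, measurable C -> measurable D ->
  (\int[m1]_x (G1 x * (\1_C (V1 x) * \1_D (Z1 x)))%:E =
   \int[m2]_x (G2 x * (\1_C (V2 x) * \1_D (Z2 x)))%:E)%E.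

(** The images of the two weighted measures under the pair (V, Z) agree on rectangles by [rect],
    hence on all measurable sets; integrating [u] against the image measures gives the claim. *)
Lemma eq_integral_rectangles (u : A * B -> \bar R) :
  (forall x, 0 <= u x)%E -> measurable_fun setT u ->
  (\int[m1]_x (u (V1 x, Z1 x) * (G1 x)%:E) =
   \int[m2]_x (u (V2 x, Z2 x) * (G2 x)%:E))%E.
Proof.
move=> u0 mu.
pose VZ1 x := (V1 x, Z1 x); pose VZ2 x := (V2 x, Z2 x).
have mVZ1 : measurable_fun setT VZ1 by exact: measurable_fun_pair.
have mVZ2 : measurable_fun setT VZ2 by exact: measurable_fun_pair.
pose n1 : {measure set T1 -> \bar R} := mdensity m1 G1_ge0 mG1.
pose n2 : {measure set T2 -> \bar R} := mdensity m2 G2_ge0 mG2.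
pose p1 : {measure set (A * B) -> \bar R} := pushforward n1 VZ1.
pose p2 : {measure set (A * B) -> \bar R} := pushforward n2 VZ2.
have E (d : measure_display) (T : measurableType d) (m : {measure set T -> \bar R}) (G : T -> R)
    (V : T -> A) (Z : T -> B) C D :
    (\int[m]_(x in (fun x => (V x, Z x)) @^-1` (C `*` D)) (G x)%:E =
     \int[m]_x (G x * (\1_C (V x) * \1_D (Z x)))%:E)%E.
  rewrite integral_mkcond; apply: eq_integral => x _; rewrite epatch_indic/=.
  rewrite -EFinM; congr (_ * _)%:E; rewrite !indicE -natrM mulnb; congr (_%:R).
  by congr nat_of_bool; apply/idP/andP; rewrite !inE.
have p12 : forall E, measurable E -> p1 mVZ1 E = p2 mVZ2 E.
  pose C0 : set (set (A * B)) := [set C `*` D | C in measurable & D in measurable].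
  move=> E0 mE0; apply: (@measure_unique _ R _ C0 (fun=> setT)) => //.
  - exact: measurable_prod_measurableType.
  - move=> _ _ [A1 mA1 [B1 mB1 <-]] [A2 mA2 [B2 mB2 <-]].
    exists (A1 `&` A2); first exact: measurableI.
    by exists (B1 `&` B2); [exact: measurableI|rewrite setXI].
  - by move=> n; exists setT => //; exists setT => //; rewrite setXTT.
  - by rewrite bigcup_const.
  - move=> _ [C mC [D mD <-]].
    by rewrite /p1 /p2 /= /pushforward /n1 /n2 /= /mdensity !E rect.
have H (d : measure_display) (T : measurableType d) (m : {measure set T -> \bar R}) (G : T -> R)
    (G0 : forall x, 0 <= G x) (mG : measurable_fun setT G)
    (W : T -> (A * B)%type) (mW : measurable_fun setT W) :
    (\int[m]_x (u (W x) * (G x)%:E) = \int[pushforward (mdensity m G0 mG) W]_z u z)%E.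
  rewrite [RHS](ge0_integral_image (mdensity m G0 mG) mW)//.
  rewrite [RHS](@ge0_integral_mdensity _ _ _ _ _ _ _ (fun x => u (W x)))//.
  exact: measurableT_comp.
rewrite (H _ _ m1 _ G1_ge0 mG1 VZ1 mVZ1) (H _ _ m2 _ G2_ge0 mG2 VZ2 mVZ2).
by apply: eq_measure_integral => E0 mE0 _; exact: p12.
Qed.

End rectangles.

Section marks.
Context {d da : measure_display} {T : measurableType d} {R : realType}
  {A : measurableType da}.
Variables (P : probability T R) (X : nat -> {mfun T >-> A})
  (S_ : nat -> {mfun T >-> R}) (S : {mfun T >-> R}).
Hypotheses (Si_law : forall i, identically_distributed P (S_ i) S)
    (Si_indep : mutually_independent P S_)
    (XS_indep : independent_sequences P X S_).

Let prod_indic (T' : Type) (E : nat -> set T') n (w : T') :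
  \prod_(i < n) \1_(E i) w = \1_(\bigcap_(i in [set` iota 0 n]) E i) w :> R.
Proof.
have [h|h] := pselect ((\bigcap_(i in [set` iota 0 n]) E i) w).
  rewrite [RHS]indicE mem_set// big1// => i _; rewrite indicE mem_set//.
  by apply: h; rewrite /= mem_iota/=.
rewrite [RHS]indicE memNset//.
have [i [i_n nEi]] : exists i, (i < n)%N /\ ~ E i w.
  apply: contrapT => hh; apply: h => i; rewrite /= mem_iota/= add0n => i_n.
  by apply: contrapT => nE; apply: hh; exists i.
by rewrite (bigD1 (Ordinal i_n))//= indicE memNset// mul0r.
Qed.

Let sigma_of_bigcap d' (T' : measurableType d') (Y : nat -> {mfun T >-> T'})
    (C : nat -> set T') n : (forall i, measurable (C i)) ->
  sigma_of Y (\bigcap_(i in [set` iota 0 n]) (Y i @^-1` C i)).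
Proof.
move=> mC.
pose G : set (set T) := \bigcup_i preimage_set_system setT (Y i) measurable.
apply: (@fin_bigcap_measurable _ (g_sigma_algebraType G)) => // i _.
apply: sub_sigma_algebra; exists i => //; exists (C i) => //.
by rewrite setTI.
Qed.

Let measurable_bigcap_preimage d' (T' : measurableType d') (Y : nat -> {mfun T >-> T'})
    (C : nat -> set T') n : (forall i, measurable (C i)) ->
  measurable (\bigcap_(i in [set` iota 0 n]) (Y i @^-1` C i)).
Proof.
move=> mC; apply: fin_bigcap_measurable => // i _.
by rewrite -[X in measurable X]setTI; apply: (measurable_funPT (Y i)).
Qed.

(** Independence of the two sequences detaches the marks from the points and mutual independence
    splits the marks. The points may depend on each other, so their constraints stay together in one
    event. *)
Lemma marks_rectangles n (C : nat -> set A) (D : nat -> set R) :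
  (forall i, measurable (C i)) -> (forall i, measurable (D i)) ->
  (\int[P]_w (\prod_(i < n) (\1_(C i) (X i w) * \1_(D i) (S_ i w)))%:E =
   \int[P]_w (\prod_(i < n) (\1_(C i) (X i w) * fine (distribution P S (D i))))%:E)%E.
Proof.
move=> mC mD.
set XC := \bigcap_(i in [set` iota 0 n]) (X i @^-1` C i).
set SD := \bigcap_(i in [set` iota 0 n]) (S_ i @^-1` D i).
have mXC : measurable XC by exact: measurable_bigcap_preimage.
have mSD : measurable SD by exact: measurable_bigcap_preimage.
transitivity (P (XC `&` SD)).
  rewrite -[X in P X]setIT -integral_indic//; last exact: measurableI.
  apply: eq_integral => w _; congr EFin; rewrite big_split/=.
  rewrite (prod_indic (fun i => X i @^-1` C i)) (prod_indic (fun i => S_ i @^-1` D i)).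
  by rewrite !indicE -natrM mulnb -in_setI.
rewrite XS_indep; [|exact: sigma_of_bigcap|exact: sigma_of_bigcap].
rewrite Si_indep ?iota_uniq//.
have -> : (\prod_(i <- iota 0 n) P (S_ i @^-1` D i) =
    (\prod_(i < n) fine (distribution P S (D i)))%:E)%E.
  rewrite -prodEFin -(big_mkord xpredT (fun i => (fine (distribution P S (D i)))%:E)).
  rewrite /index_iota subn0; apply: eq_bigr => i _.
  rewrite -[LHS]/(distribution P (S_ i) (D i)) Si_law// fineK//.
  exact: fin_num_measure.
transitivity (\int[P]_w ((\1_XC w)%:E * (\prod_(i < n) fine (distribution P S (D i)))%:E))%E.
  rewrite ge0_integralZr//.
  - by rewrite integral_indic// setIT.
  - by apply/measurable_EFinP; exact: measurable_indic.
  - by rewrite lee_fin; apply: prodr_ge0 => i _; rewrite fine_ge0.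
apply: eq_integral => w _; rewrite -EFinM; congr EFin.
by rewrite [RHS]big_split/= (prod_indic (fun i => X i @^-1` C i)).
Qed.

Variable u : A * R -> R.
Hypotheses (u_01 : forall x, 0 <= u x <= 1) (mu : measurable_fun setT u).

Definition mark_average x : R := fine (\int[distribution P S]_y (u (x, y))%:E).

Let u_ge0 x : 0 <= u x. Proof. by have /andP[] := u_01 x. Qed.

Lemma EFin_mark_average x :
  (mark_average x)%:E = (\int[distribution P S]_y (u (x, y))%:E)%E.
Proof.
rewrite fineK// -integral_fin_num_abs//; last first.
  by apply: measurableT_comp => //; exact: measurable_fun_pair1.
apply: (@le_lt_trans _ _ (\int[distribution P S]_y (cst 1 y)))%E; last first.
  rewrite integral_cst// mul1e.
  by rewrite (le_lt_trans (probability_le1 (distribution P S) measurableT))// ltry.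
apply: ge0_le_integral => //.
- by apply/measurable_EFinP; do 2 apply: measurableT_comp => //; exact: measurable_fun_pair1.
- by move=> y _; rewrite /= lee_fin ger0_norm//; have /andP[] := u_01 (x, y).
Qed.

Lemma measurable_mark_average : measurable_fun setT mark_average.
Proof.
apply/measurable_EFinP.
rewrite (_ : EFin \o _ = fubini_F (distribution P S) (EFin \o u)).
  apply: measurable_fun_fubini_tonelli_F; first exact/measurable_EFinP.
  by move=> x; rewrite /= lee_fin.
by apply/funext => x; exact: EFin_mark_average.
Qed.

Lemma mark_average_01 x : 0 <= mark_average x <= 1.
Proof.
rewrite -!lee_fin EFin_mark_average; apply/andP; split.
  by apply: integral_ge0 => y _; rewrite lee_fin.
apply: (@le_trans _ _ (\int[distribution P S]_y (cst 1 y)))%E; last first.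
  rewrite integral_cst// mul1e.
  exact: (probability_le1 (distribution P S) measurableT).
apply: ge0_le_integral => //.
- by move=> y _; rewrite lee_fin.
- by apply/measurable_EFinP; apply: measurableT_comp => //; exact: measurable_fun_pair1.
- by move=> y _; rewrite /= lee_fin; have /andP[] := u_01 (x, y).
Qed.

(** Hybrid product again: coordinates below [m] carry the function [u], the others an indicator of a
    rectangle. The case [m = 0] is [marks_rectangles]. *)
Let lhs m (C : nat -> set A) (D : nat -> set R) i w : R :=
  if (i < m)%N then u (X i w, S_ i w) else \1_(C i) (X i w) * \1_(D i) (S_ i w).

Let rhs m (C : nat -> set A) (D : nat -> set R) i w : R :=
  if (i < m)%N then mark_average (X i w)
  else \1_(C i) (X i w) * fine (distribution P S (D i)).

Let lhs_ge0 m C D i w : 0 <= lhs m C D i w.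
Proof. by rewrite /lhs; case: ifPn => // _; rewrite mulr_ge0. Qed.

Let rhs_ge0 m C D i w : 0 <= rhs m C D i w.
Proof.
rewrite /rhs; case: ifPn => _; first by have /andP[] := mark_average_01 (X i w).
by rewrite mulr_ge0// fine_ge0.
Qed.

Let lhs_le1 m C D i w : lhs m C D i w <= 1.
Proof.
rewrite /lhs; case: ifPn => _; first by have /andP[] := u_01 (X i w, S_ i w).
by rewrite !indicE -natrM lern1 mulnb leq_b1.
Qed.

Let mlhs m C D i : measurable (C i) -> measurable (D i) ->
  measurable_fun setT (lhs m C D i).
Proof.
move=> mC mD; rewrite /lhs; case: (_ < _)%N.
  by apply: measurableT_comp => //; exact: measurable_fun_pair.
by apply: measurable_funM; apply: measurableT_comp => //; exact: measurable_indic.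
Qed.

Let mrhs m C D i : measurable (C i) -> measurable_fun setT (rhs m C D i).
Proof.
move=> mC; rewrite /rhs; case: (_ < _)%N.
  by apply: measurableT_comp => //; exact: measurable_mark_average.
by apply: measurable_funM => //; apply: measurableT_comp => //; exact: measurable_indic.
Qed.

(** The induction hypothesis holds for every rectangle in coordinate [m], so
    [eq_integral_rectangles] upgrades the indicator there to [u]; Tonelli then integrates the mark
    of that coordinate out into [mark_average]. *)
Let laplace_marks_step n m C D : (m <= n)%N ->
  (forall i, measurable (C i)) -> (forall i, measurable (D i)) ->
  (\int[P]_w (\prod_(i < n) lhs m C D i w)%:E =
   \int[P]_w (\prod_(i < n) rhs m C D i w)%:E)%E.
Proof.
elim: m C D => [|m IH] C D mn mC mD; first exact: marks_rectangles.
pose j := Ordinal mn.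
have neqm (i : 'I_n) : i != j -> (nat_of_ord i == m) = false.
  by rewrite -val_eqE => /negbTE.
pose G w := \prod_(i < n | i != j) lhs m C D i w.
pose H w := \prod_(i < n | i != j) rhs m C D i w.
have ltS (i : 'I_n) : i != j -> (i < m.+1)%N = (i < m)%N.
  move=> ij; rewrite ltnS leq_eqVlt -[X in X == m]/(nat_of_ord i).
  by rewrite -[m in X in X || _]/(nat_of_ord j) (inj_eq val_inj) (negbTE ij).
have G0 w : 0 <= G w by exact: prodr_ge0.
have H0 w : 0 <= H w by exact: prodr_ge0.
have mG : measurable_fun setT G.
  rewrite /G; under eq_fun do rewrite big_mkcond.
  by apply: measurable_prod => i _; case: (i != j) => //; exact: mlhs.
have mH : measurable_fun setT H.
  rewrite /H; under eq_fun do rewrite big_mkcond.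
  by apply: measurable_prod => i _; case: (i != j) => //; exact: mrhs.
have rect (C1 : set A) (D1 : set R) : measurable C1 -> measurable D1 ->
    (\int[P]_w (G w * (\1_C1 (X m w) * \1_D1 (S_ m w)))%:E =
     \int[P \x distribution P S]_z (H z.1 * (\1_C1 (X m z.1) * \1_D1 z.2))%:E)%E.
  move=> mC1 mD1.
  (* Coordinate [m] still carries an arbitrary rectangle in the induction hypothesis; it is chosen
     to be [C1] times [D1]. *)
  pose C' i := if i == m then C1 else C i.
  pose D' i := if i == m then D1 else D i.
  have mC' i : measurable (C' i) by rewrite /C'; case: ifPn.
  have mD' i : measurable (D' i) by rewrite /D'; case: ifPn.
  have := IH C' D' (ltnW mn) mC' mD'.
  have -> : (\int[P]_w (\prod_(i < n) lhs m C' D' i w)%:E =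
      \int[P]_w (G w * (\1_C1 (X m w) * \1_D1 (S_ m w)))%:E)%E.
    apply: eq_integral => w _; congr EFin; rewrite (bigD1 j)//= mulrC; congr (_ * _).
      apply: eq_bigr => i ij; rewrite /lhs /C' /D'.
      by rewrite neqm.
    by rewrite /lhs ltnn /C' /D' eqxx.
  move=> ->.
  rewrite fubini_tonelli1//=; last 2 first.
  - apply/measurable_EFinP; apply: measurable_funM.
      by apply: measurableT_comp => //; exact: measurable_fst.
    apply: measurable_funM.
      apply: measurableT_comp; first exact: measurable_indic.
      by apply: measurableT_comp => //; exact: measurable_fst.
    by apply: measurableT_comp; first exact: measurable_indic.
  - by move=> z; rewrite lee_fin !mulr_ge0.
  apply: eq_integral => w _; rewrite /fubini_F/=.
  under [RHS]eq_integral do rewrite mulrA EFinM.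
  rewrite ge0_integralZl ?lee_fin ?mulr_ge0//; last first.
    exact/measurable_EFinP/measurable_indic.
  rewrite integral_indic// setIT.
  transitivity ((H w * \1_C1 (X m w))%:E * (fine (distribution P S D1))%:E)%E; last first.
    by rewrite fineK//; exact: fin_num_measure.
  rewrite -EFinM; congr EFin; rewrite (bigD1 j)//= mulrC -mulrA; congr (_ * _).
    apply: eq_bigr => i ij; rewrite /rhs /C' /D'.
    by rewrite neqm.
  by rewrite /rhs ltnn /C' /D' eqxx.
have Gfin : (\int[P]_w (G w)%:E < +oo)%E.
  apply: (@le_lt_trans _ _ (\int[P]_w (cst 1 w)))%E; last first.
    by rewrite integral_cst// mul1e (le_lt_trans (probability_le1 P measurableT))// ltry.
  apply: ge0_le_integral => //.
  - by move=> w _; rewrite lee_fin.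
  - exact/measurable_EFinP.
  - by move=> w _; rewrite lee_fin; apply: prodr_ile1 => i _; rewrite lhs_ge0 lhs_le1.
(* The second space has an extra factor with the law of [S]: it supplies the fresh independent mark
   that replaces [S_ m]. *)
have := @eq_integral_rectangles _ _ _ _ T (T * R)%type A R R P (P \x distribution P S)%E
  G (H \o fst) (X m) (X m \o fst) (S_ m) snd G0 (fun z => H0 z.1) mG
  (measurableT_comp mH measurable_fst) (measurable_funPT (X m))
  (measurableT_comp (measurable_funPT (X m)) measurable_fst)
  (measurable_funPT (S_ m)) measurable_snd Gfin rect (EFin \o u).
move=> E.
transitivity (\int[P]_w ((u (X m w, S_ m w))%:E * (G w)%:E))%E.
  apply: eq_integral => w _; rewrite -EFinM; congr EFin; rewrite (bigD1 j)//=.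
  rewrite {1}/lhs ltnSn; congr (_ * _); apply: eq_bigr => i ij.
  by rewrite /lhs ltS.
rewrite E; last 2 first.
- by move=> x; rewrite /= lee_fin.
- exact/measurable_EFinP.
rewrite fubini_tonelli1/=; last 2 first.
- apply/measurable_EFinP; apply: measurable_funM; last first.
    by apply: measurableT_comp => //; exact: measurable_fst.
  apply: measurableT_comp => //; apply: measurable_fun_pair => //.
  by apply: measurableT_comp => //; exact: measurable_fst.
- by move=> z; rewrite -EFinM lee_fin mulr_ge0.
apply: eq_integral => w _; rewrite /fubini_F/= ge0_integralZr ?lee_fin//.
- rewrite -EFin_mark_average -EFinM; congr EFin; rewrite [RHS](bigD1 j)//=.
  rewrite [in RHS]/rhs ltnSn; congr (_ * _); apply: eq_bigr => i ij.
  by rewrite /rhs ltS.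
- by apply/measurable_EFinP; apply: measurableT_comp => //; exact: measurable_fun_pair1.
- by move=> x _; rewrite lee_fin.
Qed.

Lemma laplace_marks n :
  (\int[P]_w (\prod_(i < n) u (X i w, S_ i w))%:E =
   \int[P]_w (\prod_(i < n) mark_average (X i w))%:E)%E.
Proof.
have := @laplace_marks_step n n (fun=> setT) (fun=> setT) (leqnn n)
  (fun=> measurableT) (fun=> measurableT).
under eq_integral do under eq_bigr do rewrite /lhs ltn_ord.
by under [X in _ = X -> _]eq_integral do under eq_bigr do rewrite /rhs ltn_ord.
Qed.

End marks.

(** * Laplace functional of the marked process *)

Section marked_poisson.
Context {d : measure_display} {T : measurableType d} {R : realType}.
Variables (P : probability T R) (lambda : R) (X : nat -> {mfun T >-> (R * R)%type})
  (S_ : nat -> {mfun T >-> R}) (S : {mfun T >-> R}).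
Hypotheses (lambda_gt0 : 0 < lambda) (X_poisson : homogeneous_PPP P lambda X)
    (Si_law : forall i, identically_distributed P (S_ i) S)
    (Si_indep : mutually_independent P S_)
    (XS_indep : independent_sequences P X S_).

Lemma expNe_sum n (V : nat -> \bar R) : (forall i, 0 <= V i)%E ->
  expNe (\sum_(i < n) V i) = \prod_(i < n) expNe (V i).
Proof.
move=> V0; elim: n => [|n IH].
  by rewrite !big_ord0 /expNe/= oppr0 expR0.
by rewrite !big_ord_recr/= expNeD// ?IH//; exact: sume_ge0.
Qed.

Lemma cvg_prod_expNe (V : nat -> T -> \bar R) :
  (forall i w, 0 <= V i w)%E -> (forall i, measurable_fun setT (V i)) ->
  (\int[P]_w (\prod_(i < n) expNe (V i w))%:E @[n --> \oo] -->
   \int[P]_w (expNe (\sum_(i <oo) V i w))%:E)%E.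
Proof.
move=> V0 mV.
apply: (bounded_convergence (M := 1)) => //.
- move=> n; apply: measurable_prod => i _.
  by apply: measurableT_comp => //; exact: measurable_expNe.
- move=> w _.
  rewrite (_ : (fun n => _) = fun n => expNe (\sum_(i < n) V i w)%E); last first.
    by apply/funext => n; rewrite (expNe_sum n (V := fun i => V i w)).
  apply: cvg_expNe; first exact: nneseries_ge0.
  under eq_fun do rewrite -(big_mkord xpredT (fun i => V i w)).
  exact: is_cvg_nneseries.
- move=> n w _; rewrite ger0_norm; last first.
    by apply: prodr_ge0 => i _; have /andP[] := expNe_01 (V0 i w).
  by apply: prodr_ile1 => i _; exact: expNe_01.
Qed.

Lemma expNe_lnNe (y : R) : 0 <= y <= 1 -> expNe (lnNe y) = y.
Proof.
move=> /andP[y0 y1]; rewrite /expNe /lnNe oppeK.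
by rewrite lneK// in_itv/= lee_fin y0 leey.
Qed.

Lemma lnNe_ge0 (y : R) : 0 <= y <= 1 -> (0 <= lnNe y)%E.
Proof. by move=> /andP[y0 y1]; rewrite /lnNe oppe_ge0 lne_le0 lee_fin. Qed.

(** Averaging the marks replaces [expNe (U (x, S))] by its mean [psi x]. Written as
    [expNe (lnNe (psi x))], this has the shape treated by [laplace_poisson]; [lnNe] takes the value
    +oo where [psi] vanishes. The averaging is done on finite products, which then pass to the limit
    on both sides. *)
Lemma laplace_marked (U : (R * R) * R -> \bar R) :
  (forall z, 0 <= U z)%E -> measurable_fun setT U ->
  (\int[P]_w (expNe (\sum_(i <oo) U (X i w, S_ i w)))%:E =
   (expNe (lambda%:E * \int[@plane_measure R \x P]_z
      (1 - expNe (U (z.1, S z.2)))%:E))%:E)%E.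
Proof.
move=> U0 mU.
have mXS i : measurable_fun setT (fun w => (X i w, S_ i w)) by exact: measurable_fun_pair.
have mu : measurable_fun setT (fun z => expNe (U z)).
  by apply: measurableT_comp => //; exact: measurable_expNe.
have u01 z : 0 <= expNe (U z) <= 1 by exact: expNe_01.
pose psi := mark_average P S (fun z => expNe (U z)).
have psi01 x : 0 <= psi x <= 1 by exact: mark_average_01.
have mpsi : measurable_fun setT psi by exact: measurable_mark_average.
have l1 := @cvg_prod_expNe (fun i w => U (X i w, S_ i w)) (fun i w => U0 _)
  (fun i => measurableT_comp mU (mXS i)).
have l2 := @cvg_prod_expNe (fun i w => lnNe (psi (X i w)))
  (fun i w => lnNe_ge0 (psi01 _)) (fun i => measurableT_comp measurable_lnNe
    (measurableT_comp mpsi (measurable_funPT (X i)))).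
have e12 n : (\int[P]_w (\prod_(i < n) expNe (U (X i w, S_ i w)))%:E =
    \int[P]_w (\prod_(i < n) expNe (lnNe (psi (X i w))))%:E)%E.
  rewrite (laplace_marks Si_law Si_indep XS_indep u01 mu).
  by apply: eq_integral => w _; congr EFin; apply: eq_bigr => i _; rewrite expNe_lnNe.
move: l1; under eq_fun do rewrite e12.
move=> /(cvg_unique (@ereal_hausdorff R) l2) <-.
rewrite (@laplace_poisson _ _ _ _ _ _ lambda_gt0 X_poisson (fun x => lnNe (psi x))); last 2 first.
- by move=> x; exact: lnNe_ge0.
- by apply: measurableT_comp => //; exact: measurable_lnNe.
congr (expNe (_ * _))%:E.
rewrite fubini_tonelli1/=; last 2 first.
- apply/measurable_EFinP; apply: measurable_funB => //.
  apply: (measurableT_comp mu); apply: measurable_fun_pair => //.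
  by apply: measurableT_comp => //; exact: measurable_snd.
- by move=> z; rewrite lee_fin subr_ge0; have /andP[] := u01 (z.1, S z.2).
apply: eq_integral => x _; rewrite expNe_lnNe// /fubini_F/= EFinB.
rewrite EFin_mark_average//.
have mux : measurable_fun setT (fun w => expNe (U (x, S w))).
  by apply: (measurableT_comp mu); exact: measurable_fun_pair.
rewrite ge0_integral_distribution//; last 2 first.
- by apply/measurable_EFinP; apply: (measurableT_comp mu); exact: measurable_fun_pair.
- by move=> y; rewrite lee_fin; have /andP[] := u01 (x, y).
under [RHS]eq_integral do rewrite EFinB.
rewrite integralB//; last 2 first.
- exact: finite_measure_integrable_cst.
- apply: (@integrable_bounded _ _ _ P setT _ 1) => // [|w _]; first exact: probability_lty.
  by have /andP[u0 u1] := u01 (x, S w); rewrite ger0_norm.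
congr (_ - _)%E; rewrite (integral_cst P measurableT 1%E) mul1e.
exact/esym/probability_setT.
Qed.

End marked_poisson.

(** * The process of propagation losses *)

Section disc.
Context {R : realType}.
Notation mu := (@lebesgue_measure R).

Lemma integral_half_circle (rho : R) : 0 < rho ->
  (\int[mu]_(x in `[(- rho)%R, rho]) (2 * Num.sqrt (rho ^+ 2 - x ^+ 2))%:E =
   (pi * rho ^+ 2)%:E)%E.
Proof.
move=> rho0.
pose F (t : R) := rho * sin t.
pose G (x : R) := 2 * Num.sqrt (rho ^+ 2 - x ^+ 2).
have dF (t : R) : is_derive t 1 F (rho * cos t) by apply: is_deriveZ.
have F'E : F^`()%classic = fun t => rho * cos t.
  by apply/funext => t; rewrite derive1E; exact: derive_val.
have cF' : continuous (fun t => rho * cos t : R).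
  by move=> t; apply: cvgM; [exact: cvg_cst|exact: continuous_cos].
have cF : continuous F.
  by move=> t; apply: cvgM; [exact: cvg_cst|exact: continuous_sin].
have cG : continuous G.
  move=> t; apply: cvgM; first exact: cvg_cst.
  apply: continuous_comp; last exact: sqrt_continuous.
  apply: cvgB; first exact: cvg_cst.
  exact: exprn_continuous.
have pi2 : - (pi / 2) <= pi / 2 :> R by rewrite ge0_cp ?divr_ge0 ?pi_ge0.
have Fa : F (- (pi / 2)) = - rho by rewrite /F sinN sin_pihalf mulrN1.
have Fb : F (pi / 2) = rho by rewrite /F sin_pihalf mulr1.
transitivity (\int[mu]_(x in `[F (- (pi / 2))%R, F (pi / 2)%R]) (G x)%:E)%E.
  by rewrite Fa Fb.
rewrite (@integration_by_substitution_increasing _ F G)//; first last.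
- exact: continuous_subspaceT.
- split; first by move=> t _; exact: ex_derive.
  + by apply: cvg_at_right_filter; exact: cF.
  + by apply: cvg_at_left_filter; exact: cF.
- by rewrite F'E; apply/cvg_ex; eexists; apply: cvg_at_left_filter; exact: cF'.
- by rewrite F'E; apply/cvg_ex; eexists; apply: cvg_at_right_filter; exact: cF'.
- by rewrite F'E => t _; exact: cF'.
- by move=> x y xI yI xy; rewrite /F ltr_pM2l// ltr_sin.
(* Antiderivative of the integrand after the substitution [x = rho * sin t]. *)
pose H (t : R) := rho ^+ 2 * (t + sin t * cos t).
have dH (t : R) : is_derive t 1 H (2 * (rho * cos t) ^+ 2).
  rewrite /H; apply: is_derive_eq; rewrite /GRing.scale/=.
  by have := cos2Dsin2 t => E; rewrite -[in LHS]E; ring.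
transitivity (\int[mu]_(t in `[(- (pi / 2))%R, (pi / 2)%R])
    (2 * (rho * cos t) ^+ 2)%:E)%E.
  apply: eq_integral => t; rewrite inE/= in_itv/= => /andP[t1 t2]; congr EFin.
  rewrite F'E /G /F/= !fctE; set c := rho ^+ 2 - _.
  have -> : c = (rho * cos t) ^+ 2.
    have E0 : cos t ^+ 2 = 1 - sin t ^+ 2 by rewrite -(cos2Dsin2 t) addrK.
    by rewrite /c !exprMn E0; ring.
  rewrite sqrtr_sqr ger0_norm; first by ring.
  by rewrite mulr_ge0 ?(ltW rho0)// cos_ge0_pihalf// t1.
rewrite (@continuous_FTC2 _ _ H).
- rewrite /H cosN cos_pihalf !mulr0 !addr0 -EFinB; congr EFin.
  by field.
- by rewrite gtrN// divr_gt0 ?pi_gt0.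
- apply: continuous_subspaceT => t.
  apply: cvgM; first exact: cvg_cst.
  by under eq_fun do rewrite expr2; apply: cvgM; exact: cF'.
- split; first by move=> t _; exact: ex_derive.
  + by apply: cvg_at_right_filter; apply: differentiable_continuous; apply/derivable1_diffP; exact: ex_derive.
  + by apply: cvg_at_left_filter; apply: differentiable_continuous; apply/derivable1_diffP; exact: ex_derive.
- by move=> t _; rewrite derive1E; exact: derive_val.
Qed.

(** The vertical slice at [x] is an interval of half-length [Num.sqrt (rho ^+ 2 - x ^+ 2)], so the
    area is the integral of [integral_half_circle]. *)
Lemma disc_area (rho : R) : 0 < rho ->
  plane_measure [set x : R * R | x.1 ^+ 2 + x.2 ^+ 2 < rho ^+ 2] =
  (pi * rho ^+ 2)%:E.
Proof.
move=> rho0; rewrite -integral_half_circle//.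
rewrite /plane_measure /lebesgue2 /product_measure1 [RHS]integral_mkcond.
apply: eq_integral => x _ /=; rewrite patchE.
set c := rho ^+ 2 - x ^+ 2.
have -> : xsection [set y : R * R | y.1 ^+ 2 + y.2 ^+ 2 < rho ^+ 2] x =
    `] - Num.sqrt c, Num.sqrt c[%classic.
  apply/seteqP; split => y; rewrite /xsection/= inE/= in_itv/= -ltr_norml -sqrtr_sqr.
    by move=> xy; rewrite ltr_sqrt /c; have := sqr_ge0 y; lra.
  have [c0|c0] := ltP 0 c; first by rewrite ltr_sqrt// /c; lra.
  (* For [c <= 0] the square root is 0 and the interval is empty, as the slice must be. *)
  by rewrite (ler0_sqrtr c0) ltNge sqrtr_ge0.
rewrite lebesgue_measure_itv/= lte_fin.
have E : (if - Num.sqrt c < Num.sqrt c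
    then ((Num.sqrt c)%:E + (- - Num.sqrt c)%:E)%E else 0%E) = (2 * Num.sqrt c)%:E.
  have := sqrtr_ge0 c; rewrite le_eqVlt => /predU1P[<-|c0].
    by rewrite oppr0 ltxx mulr0.
  by rewrite gtrN// -EFinD; congr EFin; lra.
rewrite E; case: ifPn => //; rewrite notin_setE/= in_itv/= => /negP xrho.
rewrite ler0_sqrtr ?mulr0// /c subr_le0.
by move: xrho; rewrite negb_and -!ltNge => /orP[] ?; nra.
Qed.

End disc.

Section loss_mapping.
Context {d : measure_display} {T : measurableType d} {R : realType}.
Variables (P : probability T R) (lambda K beta : R) (S : {mfun T >-> R}).
Hypotheses (lambda_gt0 : 0 < lambda) (K_gt0 : 0 < K) (beta_gt0 : 0 < beta)
  (S_gt0 : forall w, 0 < S w)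
  (S_moment : ('E_P[fun w => (S w `^ (2 / beta))%R] < +oo)%E).
Notation mu := (@lebesgue_measure R).

Definition loss (z : (R * R) * R) : R :=
  (K * euclidean_norm z.1) `^ beta / z.2.

Let m := fine ('E_P[fun w => (S w `^ (2 / beta))%R])%E.

Definition loss_rate : R := lambda * pi * m / K ^+ 2.

Definition loss_scale (v : R) : R := (v / loss_rate) `^ (beta / 2).

Lemma measurable_invr : measurable_fun setT (fun x : R => x^-1).
Proof.
rewrite (_ : (fun x => _) = fun x => x * (x ^+ 2) `^ (- 1)).
  apply: measurable_funM => //; apply: (measurableT_comp (measurable_powR _)).
  exact: measurable_funX.
apply/funext => x; rewrite powR_inv1 ?sqr_ge0//.
have [->|x0] := eqVneq x 0; first by rewrite invr0 mul0r.
by rewrite expr2 invfM mulrA divff// mul1r.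
Qed.

Lemma measurable_euclidean_norm : measurable_fun setT (@euclidean_norm R).
Proof.
rewrite (_ : euclidean_norm = fun x => (x.1 ^+ 2 + x.2 ^+ 2) `^ 2^-1).
  apply: (measurableT_comp (measurable_powR _)).
  apply: measurable_funD; apply: measurable_funX.
    exact: measurable_fst.
  exact: measurable_snd.
by apply/funext => w; rewrite powR12_sqrt// addr_ge0// sqr_ge0.
Qed.

Lemma measurable_loss : measurable_fun setT loss.
Proof.
apply: measurable_funM; last first.
  by apply: (measurableT_comp measurable_invr); exact: measurable_snd.
apply: (measurableT_comp (measurable_powR _)); apply: measurable_funM => //.
apply: (measurableT_comp measurable_euclidean_norm); exact: measurable_fst.
Qed.

Lemma loss_ge0 x s : 0 < s -> 0 <= loss (x, s).
Proof. by move=> s0; rewrite divr_ge0// ?powR_ge0// ltW. Qed.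

Lemma loss_lt x s r : 0 < s -> 0 < r -> (loss (x, s) < r) =
  (x.1 ^+ 2 + x.2 ^+ 2 < ((r * s) `^ beta^-1 / K) ^+ 2).
Proof.
move=> s0 r0; rewrite /loss/= ltr_pdivrMr//.
have n0 : 0 <= euclidean_norm x by rewrite sqrtr_ge0.
have Kn0 : 0 <= K * euclidean_norm x by rewrite mulr_ge0// ltW.
have rs0 : 0 <= r * s by rewrite mulr_ge0// ltW.
have E : (r * s) = ((r * s) `^ beta^-1) `^ beta.
  by rewrite -powRrM mulVf ?powRr1// gt_eqF.
have -> : ((K * euclidean_norm x) `^ beta < r * s) =
    (K * euclidean_norm x < (r * s) `^ beta^-1).
  apply/idP/idP => [|h]; last first.
    by rewrite E; apply: gt0_ltr_powR => //; rewrite nnegrE ?powR_ge0.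
  rewrite {1}E; apply: contraTT; rewrite -!leNgt => h.
  by apply: ge0_ler_powR; rewrite ?nnegrE ?powR_ge0// ltW.
rewrite mulrC -ltr_pdivlMr// -ltr_sqr ?nnegrE ?divr_ge0 ?powR_ge0 ?(ltW K_gt0)//.
by rewrite /euclidean_norm sqr_sqrtr// addr_ge0 ?sqr_ge0.
Qed.

Lemma measurable_S_moment : measurable_fun setT (fun w => S w `^ (2 / beta)).
Proof. exact: measurableT_comp (measurable_powR _) (measurable_funPT S). Qed.

Lemma EFin_S_moment : (m%:E = \int[P]_w (S w `^ (2 / beta))%:E)%E.
Proof.
rewrite /m unlock fineK// ge0_fin_numE.
  by move: S_moment; rewrite unlock.
by apply: integral_ge0 => w _; rewrite lee_fin powR_ge0.
Qed.

(** If the moment were 0, the power of [S] would vanish almost everywhere, whereas it is positive at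
    every point of a space of mass 1. *)
Lemma S_moment_gt0 : 0 < m.
Proof.
have m0 : 0 <= m.
  by rewrite -lee_fin EFin_S_moment; apply: integral_ge0 => w _; rewrite lee_fin powR_ge0.
rewrite lt_neqAle m0 andbT; apply/eqP => m00.
have [+ _] := @ae_eq_integral_abs _ _ _ P setT measurableT
  (fun w => (S w `^ (2 / beta))%:E) ((measurable_EFinP _ _).2 measurable_S_moment).
under eq_integral do rewrite gee0_abs ?lee_fin ?powR_ge0//.
rewrite -EFin_S_moment -m00 => /(_ erefl)[N [mN PN0 subN]].
have NT : N = setT.
  apply/seteqP; split => // w _; apply: subN => /= /(_ I) [] /eqP.
  by rewrite powR_eq0 gt_eqF// S_gt0.
have := probability_setT P; rewrite -NT PN0 => /eqP.
by rewrite eqe eq_sym oner_eq0.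
Qed.

Lemma loss_rate_gt0 : 0 < loss_rate.
Proof.
by rewrite divr_gt0 ?exprn_gt0// mulr_gt0 ?S_moment_gt0// mulr_gt0 ?pi_gt0.
Qed.

Lemma loss_scale_lt v r : 0 <= v -> 0 < r ->
  (loss_scale v < r) = (v < loss_rate * r `^ (2 / beta)).
Proof.
move=> v0 r0; rewrite mulrC -ltr_pdivrMr ?loss_rate_gt0//.
have b2 : 0 < beta / 2 by rewrite divr_gt0.
have E : r = (r `^ (2 / beta)) `^ (beta / 2).
  by rewrite -powRrM mulrA divfK ?gt_eqF// divff ?powRr1 ?ltW// pnatr_eq0.
have va0 : 0 <= v / loss_rate by rewrite divr_ge0// ltW// loss_rate_gt0.
rewrite /loss_scale; apply/idP/idP => [|h]; last first.
  by rewrite E; apply: gt0_ltr_powR => //; rewrite nnegrE ?powR_ge0.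
rewrite {1}E; apply: contraTT; rewrite -!leNgt => h.
by apply: ge0_ler_powR; rewrite ?nnegrE ?powR_ge0// ltW.
Qed.

Lemma measurable_loss_scale : measurable_fun setT loss_scale.
Proof. by apply: (measurableT_comp (measurable_powR _)); exact: measurable_funM. Qed.

Let loss' (z : (R * R) * T) : R := loss (z.1, S z.2).

Let mloss' : measurable_fun setT loss'.
Proof.
apply: (measurableT_comp measurable_loss); apply: measurable_fun_pair.
  exact: measurable_fst.
by apply: measurableT_comp => //; exact: measurable_snd.
Qed.

(** Discards negative [v], for which the real power in [loss_scale] is meaningless. *)
Let weight (v : R) : R := \1_(`[0%R, +oo[%classic) v.

Let weight_ge0 v : 0 <= weight v. Proof. by []. Qed.

Let mweight : measurable_fun setT weight.
Proof. exact: measurable_indic. Qed.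

(** For a fixed mark the section is a disc of radius [(r * S w)]^ beta^-1 /
    K[, with area proportional to]S w [^ (2 / beta)]. Averaging over the mark is where the moment of
    order [2 / beta] enters. *)
Lemma plane_loss_lt (r : R) : 0 < r ->
  ((@plane_measure R \x P) [set z | (loss (z.1, S z.2) < r)%R] =
   (pi * m / K ^+ 2 * r `^ (2 / beta))%:E)%E.
Proof.
move=> r0; pose E := [set z : (R * R) * T | loss (z.1, S z.2) < r].
have mE : measurable E.
  rewrite -[X in measurable X]setTI.
  rewrite (_ : E = loss' @^-1` `]-oo, r[%classic); first exact: mloss'.
  by apply/seteqP; split => z; rewrite /= in_itv/=.
transitivity ((@plane_measure R \x P)%E (E `&` setT)); first by rewrite setIT.
rewrite -integral_indic//.
rewrite indic_fubini_tonelli1// indic_fubini_tonelli//.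
transitivity (\int[P]_w ((pi / K ^+ 2 * r `^ (2 / beta))%:E * (S w `^ (2 / beta))%:E))%E.
  apply: eq_integral => w _; rewrite indic_fubini_tonelli_GE//=.
  have rS0 : 0 < r * S w by rewrite mulr_gt0.
  have -> : ysection E w = [set x : R * R | x.1 ^+ 2 + x.2 ^+ 2 <
      ((r * S w) `^ beta^-1 / K) ^+ 2].
    by apply/seteqP; split => x; rewrite /ysection/= inE /E/= loss_lt.
  rewrite disc_area; last by rewrite divr_gt0// powR_gt0.
  rewrite -EFinM; congr EFin; rewrite expr_div_n -(@powR_mulrn _ ((r * S w) `^ beta^-1) 2) ?powR_ge0//.
  rewrite -powRrM [beta^-1 * _]mulrC powRM ?(ltW r0) ?(ltW (S_gt0 w))//.
  by field; rewrite gt_eqF.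
rewrite ge0_integralZl//.
- by rewrite -EFin_S_moment -EFinM; congr EFin; field; rewrite gt_eqF.
- by apply/measurable_EFinP; exact: measurable_S_moment.
- by move=> w _; rewrite lee_fin powR_ge0.
- by rewrite lee_fin mulr_ge0 ?powR_ge0// divr_ge0 ?pi_ge0// exprn_ge0// ltW.
Qed.

Lemma lebesgue_loss_scale_lt (r : R) : 0 < r ->
  mu [set v | (0 <= v)%R /\ (loss_scale v < r)%R] =
  (loss_rate * r `^ (2 / beta))%:E.
Proof.
move=> r0; have a0 : 0 < loss_rate * r `^ (2 / beta).
  by rewrite mulr_gt0 ?powR_gt0 ?loss_rate_gt0.
rewrite (_ : [set v | _] = `[0, loss_rate * r `^ (2 / beta)[%classic).
  by rewrite lebesgue_measure_itv/= lte_fin a0 oppr0 adde0.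
apply/seteqP; split => v/=; rewrite in_itv/=.
  by move=> [v0]; rewrite v0 loss_scale_lt.
by move=> /andP[v0 vr]; rewrite loss_scale_lt.
Qed.

(** Two image measures on the line are compared: [lambda] times plane measure and marks under
    [loss], and Lebesgue measure on [0, +oo[ under [loss_scale]. They give the same finite mass to
    every lower ray. *)
Lemma integral_loss (k : R -> \bar R) : (forall r, 0 <= k r)%E ->
  measurable_fun setT k ->
  (lambda%:E * \int[@plane_measure R \x P]_z k (loss (z.1, S z.2)) =
   \int[mu]_(v in `[0%R, +oo[) k (loss_scale v))%E.
Proof.
move=> k0 mk.
pose lam := NngNum (ltW lambda_gt0).
pose p1 : {measure set R -> \bar R} :=
  pushforward (mscale lam (@plane_measure R \x P)%E) loss'.
pose p2 : {measure set R -> \bar R} :=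
  pushforward (mdensity mu weight_ge0 mweight) loss_scale.
have p12 : forall A, measurable A -> p1 mloss' A = p2 measurable_loss_scale A.
  have p1E b : p1 mloss' `]-oo, b[%classic =
      (lambda%:E * (@plane_measure R \x P) [set z | (loss (z.1, S z.2) < b)%R])%E.
    by [].
  apply: measure_unique_ray => b; rewrite p1E.
    rewrite /p2/= /pushforward/= /mdensity.
    have -> : (\int[mu]_(v in loss_scale @^-1` `]-oo, b[) (weight v)%:E =
        mu [set v | (0 <= v)%R /\ (loss_scale v < b)%R])%E.
      rewrite integral_indic//.
        by congr (mu _); apply/seteqP; split => v/=; rewrite !in_itv/= andbT; case.
      rewrite -[X in measurable X]setTI; exact: measurable_loss_scale.
    have [b0|b0] := ltP 0 b.
      rewrite plane_loss_lt// lebesgue_loss_scale_lt// -EFinM; congr EFin.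
      by rewrite /loss_rate; field; rewrite gt_eqF.
    rewrite (_ : [set z | _] = set0) ?measure0 ?mule0; last first.
      by rewrite -subset0 => z/=; rewrite ltNge (le_trans b0)// loss_ge0.
    rewrite (_ : [set v | _] = set0) ?measure0//.
    by rewrite -subset0 => v/= [_]; rewrite ltNge (le_trans b0)// powR_ge0.
  have [b0|b0] := ltP 0 b; first by rewrite plane_loss_lt// -EFinM ltry.
  rewrite (_ : [set z | _] = set0) ?measure0 ?mule0 ?ltry//.
  by rewrite -subset0 => z/=; rewrite ltNge (le_trans b0)// loss_ge0.
have mkl : measurable_fun setT (fun z => k (loss' z)) by exact: measurableT_comp.
have <- : (\int[p1 mloss']_r k r = lambda%:E * \int[@plane_measure R \x P]_z k (loss (z.1, S z.2)))%E.
  rewrite (ge0_integral_image (mscale lam (@plane_measure R \x P)%E) mloss')//.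
  by rewrite ge0_integral_mscale.
have -> : (\int[mu]_(v in `[0%R, +oo[) k (loss_scale v) = \int[p2 measurable_loss_scale]_r k r)%E.
  rewrite (ge0_integral_image (mdensity mu weight_ge0 mweight) measurable_loss_scale)//.
  rewrite ge0_integral_mdensity//; last first.
    by apply: measurableT_comp => //; exact: measurable_loss_scale.
  rewrite [LHS]integral_mkcond; apply: eq_integral => v _.
  by rewrite epatch_indic.
by apply: eq_measure_integral => A mA _; exact: p12.
Qed.

End loss_mapping.

(** * The Dirichlet integral *)

Section calculus.
Context {R : realType}.
Notation mu := (@lebesgue_measure R).
Implicit Types (F f : R -> R) (a b l u x y : R).

Lemma is_derive_scale f (f' : R) a x : is_derive (a * x) 1 f f' ->
  is_derive x 1 (fun t => f (a * t)) (a * f').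
Proof.
move=> df; have dg : is_derive x 1 (fun t : R => a * t) a.
  by apply: is_derive_eq; rewrite /GRing.scale/= mulr1.
by rewrite mulrC; exact: (@is_derive1_comp _ f (fun t => a * t)).
Qed.

(** With these instances the derivative of a closed formula is found by search, and only an
    algebraic identity is left to check. *)
#[export] Instance is_derive_expRZ a x :
  is_derive x 1 (fun t : R => expR (a * t)) (a * expR (a * x)).
Proof. exact: is_derive_scale. Qed.

#[export] Instance is_derive_sinZ a x :
  is_derive x 1 (fun t : R => sin (a * t)) (a * cos (a * x)).
Proof. exact: is_derive_scale. Qed.

#[export] Instance is_derive_cosZ a x :
  is_derive x 1 (fun t : R => cos (a * t)) (a * - sin (a * x)).
Proof. exact: is_derive_scale. Qed.

Lemma is_derive_continuous F (f : R) x : is_derive x 1 F f -> {for x, continuous F}.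
Proof.
by move=> dF; apply: differentiable_continuous; apply/derivable1_diffP; exact: ex_derive.
Qed.

Lemma FTC F f a b : a <= b -> (forall x, is_derive x 1 F (f x)) ->
  continuous f -> \int[mu]_(x in `[a, b]) f x = F b - F a.
Proof.
rewrite le_eqVlt => /predU1P[<-|ab] dF cf.
  by rewrite subrr set_itv1 Rintegral_set1.
rewrite /Rintegral (@continuous_FTC2 _ f F a b)//.
- exact: continuous_subspaceT.
- split; first by move=> x _; exact: ex_derive.
  + by apply: cvg_at_right_filter; exact: is_derive_continuous.
  + by apply: cvg_at_left_filter; exact: is_derive_continuous.
- by move=> x _; rewrite derive1E; exact: derive_val.
Qed.

Lemma FTC_infinity F f a l : (forall x, a <= x -> 0 <= f x) ->
  (forall x, a <= x -> is_derive x 1 F (f x)) ->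
  (forall x, a <= x -> {for x, continuous f}) -> F x @[x --> +oo] --> l ->
  (\int[mu]_(x in `[a, +oo[) (f x)%:E = (l - F a)%:E)%E.
Proof.
move=> f0 dF cf Fl; rewrite EFinB; apply: ge0_continuous_FTC2y => //.
- by apply: continuous_in_subspaceT => x; rewrite inE/= in_itv/= andbT => /cf.
- by move=> x /ltW ax; have ? := dF _ ax; exact: ex_derive.
- by apply: cvg_at_right_filter; apply: is_derive_continuous; exact: dF.
- move=> x; rewrite in_itv/= andbT => /ltW ax.
  by rewrite derive1E; have ? := dF _ ax; exact: derive_val.
Qed.

Lemma lipschitz_bound F f M x : (forall y, is_derive y 1 F (f y)) ->
  (forall y, 0 <= y -> `|f y| <= M) -> 0 <= x -> `|F x - F 0| <= M * x.
Proof.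
move=> dF fM; rewrite le_eqVlt => /predU1P[<-|x0].
  by rewrite subrr normr0 mulr0.
have [|c] := @MVT _ F f 0 x x0 (fun y _ => dF y).
  by apply: continuous_subspaceT => y; exact: is_derive_continuous.
rewrite in_itv/= => /andP[c0 _] ->.
by rewrite subr0 normrM (ger0_norm (ltW x0)) ler_wpM2r ?(ltW x0)// fM// ltW.
Qed.

Lemma ler_norm_sinB x y : `|sin x - sin y| <= `|x - y|.
Proof.
wlog xy : x y / y <= x.
  move=> h; have [/h//|/ltW/h] := leP y x.
  by rewrite distrC [`|y - x|]distrC.
have dF (t : R) : is_derive t 1 (fun t => sin (y + t)) (cos (y + t)).
  by apply: is_derive_eq; rewrite /GRing.scale/= !add0r mulr1.
have xy0 : 0 <= x - y by rewrite subr_ge0.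
have := @lipschitz_bound (fun t => sin (y + t)) (fun t => cos (y + t)) 1 (x - y) dF.
rewrite addr0 (addrC y) subrK mul1r (ger0_norm xy0); apply => // t _; exact: cos_max.
Qed.

Lemma ler_norm_sin x : `|sin x| <= `|x|.
Proof. by have := ler_norm_sinB x 0; rewrite sin0 !subr0. Qed.

Lemma cvg_expRN a : 0 < a -> expR (- a * x) @[x --> +oo] --> (0 : R).
Proof.
move=> a0; under eq_fun do rewrite mulNr; apply: (@cvg_comp _ _ _ (fun x => a * x) (fun x => expR (- x)) _ (pinfty_nbhs R)).
- exact: gt0_cvgMry.
- exact: cvgr_expR.
Qed.

Lemma integral_expRN a : 0 < a ->
  (\int[mu]_(t in `[0%R, +oo[) (expR (- a * t))%:E = (a^-1)%:E)%E.
Proof.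
move=> a0; apply: (etrans (@FTC_infinity (fun t => - a^-1 * expR (- a * t)) _ 0 0 _ _ _ _)) => //; last first.
- by rewrite mulr0 expR0 mulr1 opprK add0r.
- rewrite -[X in _ --> X](mulr0 (- a^-1)); apply: cvgMr; exact: cvg_expRN.
- by move=> x _; exact: is_derive_continuous.
- move=> x _; apply: is_derive_eq; rewrite /GRing.scale/=.
  by field; rewrite gt_eqF.
Qed.

Lemma integrable_expRN a : 0 < a ->
  mu.-integrable `[0, +oo[ (EFin \o (fun t => expR (- a * t))).
Proof.
move=> a0; apply/integrableP; split.
  apply/measurable_EFinP; apply: measurable_funTS; apply: continuous_measurable_fun => t.
  exact: is_derive_continuous.
apply: (@le_lt_trans _ _ ((a^-1)%:E)); last exact: ltry.
rewrite -integral_expRN// le_eqVlt; apply/orP; left; apply/eqP.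
by apply: eq_integral => t _ /=; rewrite ger0_norm.
Qed.

Lemma measurable_sinr x : measurable_fun setT (fun u : R => sin (x * u)).
Proof.
apply: continuous_measurable_fun => u; exact: is_derive_continuous.
Qed.

End calculus.

Lemma norm_Rintegral_le {R : realType} {d} {Y : measurableType d}
    (m : {measure set Y -> \bar R}) (D : set Y) (f : Y -> R) (M : R) :
  measurable D -> (m D < +oo)%E -> measurable_fun D f ->
  (forall y, D y -> `|f y| <= M) -> `|\int[m]_(y in D) f y| <= M * fine (m D).
Proof.
move=> mD mDoo mf fM.
have i1 := integrable_bounded mD mDoo mf fM.
rewrite (le_trans (le_normr_Rintegral _ _))//.
rewrite -Rintegral_cst//; apply: le_Rintegral => //.
  apply: (@integrable_bounded _ _ _ m _ _ M) => //; first exact: measurableT_comp.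
  by move=> y Dy; rewrite normr_id fM.
exact: integrable_cst_fin.
Qed.

Section sine_integral.
Context {R : realType}.
Notation mu := (@lebesgue_measure R).
Implicit Types (x u M t : R).

(** The truncated Dirichlet integral, that is the sine integral Si at [x * M]. The origin is
    excluded so that [u > 0] throughout the domain. *)
Definition sine_integral M x : R := \int[mu]_(u in `]0, M]) (sin (x * u) / u).

Lemma norm_sinc_le x u : 0 < u -> `|sin (x * u) / u| <= `|x|.
Proof.
move=> u0; rewrite normrM normrV ?unitfE ?gt_eqF// ler_pdivrMr ?normr_gt0 ?gt_eqF//.
by rewrite (le_trans (ler_norm_sin _))// normrM.
Qed.

Lemma itv0M_fin M : (mu `]0%R, M] < +oo)%E.
Proof. by rewrite lebesgue_measure_itv/=; case: ifP => // _; rewrite -EFinD ltry. Qed.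

Lemma fine_itv0M M : 0 <= M -> fine (mu `]0, M]) = M.
Proof.
move=> M0; rewrite lebesgue_measure_itv/= lte_fin.
by have [//|M0'] := ltP 0 M; rewrite ?oppr0 ?adde0 ?addr0//; apply/le_anti; rewrite M0 M0'.
Qed.

Lemma measurable_sinc x : measurable_fun setT (fun u : R => sin (x * u) / u).
Proof. by apply: measurable_funM; [exact: measurable_sinr|exact: measurable_invr]. Qed.

Lemma sine_integralN M x : sine_integral M (- x) = - sine_integral M x.
Proof.
rewrite /sine_integral -[RHS]mulN1r -RintegralZl//.
  by apply: eq_Rintegral => u _; rewrite mulNr sinN mulNr mulN1r.
apply: (@integrable_bounded _ _ _ mu _ _ `|x|) => //.
- exact: itv0M_fin.
- by apply: measurable_funTS; exact: measurable_sinc.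
- by move=> u; rewrite /= in_itv/= => /andP[u0 _]; exact: norm_sinc_le.
Qed.

Lemma sine_integral_le M x : 0 <= M -> `|sine_integral M x| <= `|x| * M.
Proof.
move=> M0; rewrite -[M in leRHS]fine_itv0M//; apply: norm_Rintegral_le => //.
- exact: itv0M_fin.
- by apply: measurable_funTS; exact: measurable_sinc.
- by move=> u; rewrite /= in_itv/= => /andP[u0 _]; exact: norm_sinc_le.
Qed.

Lemma integral_lorentz x : 0 < x ->
  (\int[mu]_(t in `[0%R, +oo[) (x / (x ^+ 2 + t ^+ 2))%:E = (pi / 2)%:E)%E.
Proof.
move=> x0; have q0 t : 0 < x ^+ 2 + t ^+ 2.
  by rewrite ltr_pwDl ?exprn_gt0 ?sqr_ge0.
have dF t : 0 <= t -> is_derive t 1 (fun t => atan (x^-1 * t)) (x / (x ^+ 2 + t ^+ 2)).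
  move=> _; apply: is_derive_eq; rewrite /GRing.scale/=.
  by have h := q0 t; field; rewrite !gt_eqF//= addr_gt0 ?exprn_gt0.
apply: (etrans (FTC_infinity (l := pi / 2) _ dF _ _)); last first.
- by rewrite mulr0 atan0 subr0.
- apply: (@cvg_comp _ _ _ (fun t => x^-1 * t) atan _ (pinfty_nbhs R)); last exact: cvgy_atan.
  by apply: gt0_cvgMry; rewrite ?invr_gt0.
- move=> t _; apply: cvgM; first exact: cvg_cst.
  apply: cvgV; first by rewrite gt_eqF.
  by apply: cvgD; [exact: cvg_cst|exact: exprn_continuous].
- by move=> t _; rewrite divr_ge0 ?ltW.
Qed.

(** Opposite of the value at [u = M] of an antiderivative in [u] of
    [sin (x * u) * expR (- u * t)]. *)
Let rem M x t : R :=
  expR (- M * t) * (x * cos (x * M) + t * sin (x * M)) / (x ^+ 2 + t ^+ 2).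

(** Write [u^-1] as the integral of [expR (- u * t)] over [t >= 0] and exchange the integrals, which
    is legitimate because [|sin (x * u) / u| <= |x|] on a bounded interval. The main term is the
    Lorentz integral [pi / 2]; the remainder is at most [2 / x * expR (- M * t)], with integral
    [2 / (x * M)]. *)
Lemma sine_integral_cvg_le M x : 0 < M -> 0 < x ->
  `|sine_integral M x - pi / 2| <= 2 / (x * M).
Proof.
move=> M0 x0; have q0 t : 0 < x ^+ 2 + t ^+ 2.
  by rewrite ltr_pwDl ?exprn_gt0 ?sqr_ge0.
pose f (z : R * R) := sin (x * z.1) * expR (- z.1 * z.2).
have mf : measurable_fun setT f.
  apply: measurable_funM.
    by apply: (measurableT_comp (measurable_sinr x)); exact: measurable_fst.
  apply: measurableT_comp => //; apply: measurable_funM.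
    by apply: measurableT_comp => //; exact: measurable_fst.
  exact: measurable_snd.
have Eu u : 0 < u -> \int[mu]_(t in `[0, +oo[) f (u, t) = sin (x * u) / u.
  move=> u0; rewrite /f/= RintegralZl//; first by rewrite /Rintegral integral_expRN.
  exact: integrable_expRN.
have -> : sine_integral M x = \int[mu]_(u in `]0, M]) \int[mu]_(t in `[0, +oo[) f (u, t).
  by apply: eq_Rintegral => u; rewrite inE/= in_itv/= => /andP[u0 _]; rewrite Eu.
have Et t : \int[mu]_(u in `]0, M]) f (u, t) = x / (x ^+ 2 + t ^+ 2) - rem M x t.
  pose F u := - expR (- t * u) * (x * cos (x * u) + t * sin (x * u)) / (x ^+ 2 + t ^+ 2).
  have dF u : is_derive u 1 F (f (u, t)).
    rewrite /F; apply: is_derive_eq; rewrite /GRing.scale/= /f/= (_ : - u * t = - t * u); last by ring.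
    by field; rewrite gt_eqF.
  have cf : continuous (fun u => f (u, t)).
    have -> : (fun u => f (u, t)) = fun u => sin (x * u) * expR (- t * u).
      by apply/funext => u; rewrite /f/= mulNr mulrC -[u * t]mulrC -mulNr mulrC.
    move=> u; apply: cvgM; first exact: (is_derive_continuous (is_derive_sinZ x u)).
    exact: (is_derive_continuous (is_derive_expRZ (- t) u)).
  rewrite Rintegral_itv_obnd_cbnd; last first.
    apply: (@integrable_bounded _ _ _ mu _ _ (expR (`|t| * M))) => //.
    - exact: itv0M_fin.
    - by apply: measurable_funTS; exact: continuous_measurable_fun.
    - move=> u; rewrite /= in_itv/= => /andP[u0 uM]; rewrite /f/= normrM.
      rewrite -[leRHS]mul1r ler_pM ?normr_ge0 ?sin_max// ger0_norm ?expR_ge0// ler_expR.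
      rewrite mulNr -mulrN mulrC (@le_trans _ _ (`|t| * u))//.
        by rewrite ler_wpM2r ?(ltW u0)// -normrN ler_norm.
      by rewrite ler_wpM2l.
  rewrite (@FTC _ F _ 0 M (ltW M0) dF cf) /F /rem !mulr0 expR0 cos0 sin0.
  by rewrite (_ : - t * M = - M * t); [field; rewrite gt_eqF|ring].
rewrite Rintegral_fubini//; last first.
  apply: (@le_lt_trans _ _ (\int[mu]_(u in `]0%R, M]) (cst `|x|%:E) u)%E).
    apply: (@le_trans _ _ (\int[mu]_(u in `]0%R, M]) `|sin (x * u) / u|%:E)%E).
      rewrite le_eqVlt; apply/orP; left; apply/eqP; apply: eq_integral => u; rewrite inE/= in_itv/= => /andP[u0 _].
      rewrite normrM normrV ?unitfE ?gt_eqF// (ger0_norm (ltW u0)) EFinM -integral_expRN//.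
      rewrite -[RHS]ge0_integralZl//.
      + by apply: eq_integral => t _; rewrite /f/= normrM (ger0_norm (expR_ge0 _)) EFinM.
      + exact: (measurable_int _ (integrable_expRN u0)).
    apply: ge0_le_integral => //.
    + apply/measurable_EFinP; apply: measurable_funTS; apply: measurableT_comp => //.
      exact: measurable_sinc.
    + by move=> u; rewrite /= in_itv/= lee_fin => /andP[u0 _]; exact: norm_sinc_le.
  by rewrite integral_cst// lte_mul_pinfty//; exact: itv0M_fin.
under eq_Rintegral do rewrite Et.
have remE t : 0 <= t -> `|rem M x t| <= 2 / x * expR (- M * t).
  move=> t0; rewrite /rem -mulrA normrM (ger0_norm (expR_ge0 _)) mulrC ler_wpM2r ?expR_ge0//.
  rewrite normrM (ger0_norm (_ : 0 <= (_ + _)^-1)) ?invr_ge0 ?(ltW (q0 t))//.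
  rewrite ler_pdivrMr//; apply: (@le_trans _ _ (x + t)).
    rewrite (le_trans (ler_normD _ _))// !normrM (ger0_norm t0) (ger0_norm (ltW x0)).
    by rewrite lerD// ler_piMr ?(ltW x0)// ?cos_max ?sin_max.
  (* This is [(x + t) * x <= 2 * (x ^+ 2 + t ^+ 2)]. *)
  by rewrite mulrAC ler_pdivlMr//; have := sqr_ge0 (x - t); have := sqr_ge0 t; nra.
have ic : mu.-integrable `[0, +oo[ (EFin \o (fun t => 2 / x * expR (- M * t))).
  rewrite (_ : _ \o _ = fun t => (2 / x)%:E * (EFin \o (fun t => expR (- M * t))) t)%E.
    by apply: integrableZl => //; exact: integrable_expRN.
  by apply/funext => t.
have ir : mu.-integrable `[0, +oo[ (EFin \o rem M x).
  apply: (integrable_dominated _ ic) => //.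
    apply: measurable_funTS; apply: continuous_measurable_fun => t; apply: cvgM.
      apply: cvgM; first exact: (is_derive_continuous (is_derive_expRZ (- M) t)).
      by apply: cvgD; [exact: cvg_cst|apply: cvgM; [exact: cvg_id|exact: cvg_cst]].
    apply: cvgV; first by rewrite gt_eqF.
    by apply: cvgD; [exact: cvg_cst|exact: exprn_continuous].
  by move=> t; rewrite /= in_itv/= andbT; exact: remE.
rewrite RintegralB//; last first.
  apply/integrableP; split.
    apply/measurable_EFinP; apply: measurable_funTS; apply: continuous_measurable_fun => t.
    apply: cvgM; first exact: cvg_cst.
    apply: cvgV; first by rewrite gt_eqF.
    by apply: cvgD; [exact: cvg_cst|exact: exprn_continuous].
  apply: (@le_lt_trans _ _ ((pi / 2)%:E)); last exact: ltry.
  rewrite -(integral_lorentz x0) le_eqVlt; apply/orP; left; apply/eqP.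
  by apply: eq_integral => t _ /=; rewrite ger0_norm// divr_ge0// ltW.
rewrite {1}/Rintegral integral_lorentz//= addrAC subrr add0r normrN.
rewrite (le_trans (le_normr_Rintegral _ ir))//.
have <- : \int[mu]_(t in `[0, +oo[) (2 / x * expR (- M * t)) = 2 / (x * M).
  rewrite RintegralZl//; last exact: integrable_expRN.
  by rewrite /Rintegral integral_expRN//= invfM mulrA.
apply: le_Rintegral => //; first exact: integrable_abse ir.
by move=> t; rewrite /= in_itv/= andbT; exact: remE.
Qed.

(** If [x * M <= 2], the trivial bound [x * M] is enough; otherwise the distance to [pi / 2] is at
    most 1. The constant 4 is generous; what matters is uniformity in both variables. *)
Lemma sine_integral_bounded M x : 0 <= M -> `|sine_integral M x| <= 4.
Proof.
wlog x0 : x / 0 <= x.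
  move=> h M0; have [/h->//|/ltW x0] := leP 0 x.
  by rewrite -[x]opprK sine_integralN normrN h// oppr_ge0.
rewrite le_eqVlt => /predU1P[<-|M0].
  by rewrite (le_trans (sine_integral_le _ _))// mulr0.
have [xM|xM] := leP (x * M) 2.
  rewrite (le_trans (sine_integral_le _ (ltW M0)))// ger0_norm//.
  by rewrite (le_trans xM)// ler_nat.
have x0' : 0 < x.
  by rewrite lt_neqAle x0 andbT; apply/eqP => x0'; move: xM; rewrite -x0' mul0r ltrn0.
have := sine_integral_cvg_le M0 x0'.
have pi4 : pi / 2 <= 2 :> R by exact/ltW/pihalf_lt2.
have pi0 := pi_ge0 R.
have xM1 : 2 / (x * M) <= 1 by rewrite ler_pdivrMr ?mul1r ?(ltW xM)// mulr_gt0.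
by rewrite !ler_norml => /andP[h1 h2]; apply/andP; split; lra.
Qed.

Lemma cvg_sine_integral x (u : nat -> R) : u n @[n --> \oo] --> +oo ->
  sine_integral (u n) x @[n --> \oo] --> Num.sg x * (pi / 2).
Proof.
move=> uoo.
wlog x0 : x / 0 <= x.
  move=> h; have [/h//|/ltW x0] := leP 0 x.
  rewrite -[x]opprK sgrN mulNr; under eq_fun do rewrite sine_integralN.
  by apply: cvgN; apply: h; rewrite oppr_ge0.
move: x0; rewrite le_eqVlt => /predU1P[<-|x0].
  rewrite sgr0 mul0r; apply/cvgrPdist_le => /= e e0.
  have uN : \forall n \near \oo, 0 <= u n by move/cvgryPge : uoo; exact.
  apply: filterS uN => n un0; rewrite sub0r normrN.
  by rewrite (le_trans (sine_integral_le _ un0))// normr0 mul0r ltW.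
rewrite gtr0_sg// mul1r; apply/cvgrPdist_le => /= e e0.
have uN : \forall n \near \oo, Num.max 1 (2 / x / e) <= u n.
  by move/cvgryPge : uoo; exact.
apply: filterS uN => n; rewrite ge_max => /andP[un1 une].
have un0 : 0 < u n by exact: lt_le_trans un1.
rewrite distrC (le_trans (sine_integral_cvg_le un0 x0))// invfM mulrA.
by rewrite ler_pdivrMr// [leRHS]mulrC -ler_pdivrMr.
Qed.

End sine_integral.

(** * Inversion of the Laplace transform *)

Section inversion.
Context {R : realType}.
Notation mu := (@lebesgue_measure R).
Implicit Types (g u v y t x M : R).

Lemma expRN_le1 g t : 0 <= g -> 0 <= t -> expR (- g * t) <= 1.
Proof. by move=> g0 t0; rewrite -[leRHS]expR0 ler_expR mulNr oppr_le0 mulr_ge0. Qed.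

Lemma itv_fin (x y : R) : (mu `[x, y] < +oo)%E.
Proof. by rewrite lebesgue_measure_itv/=; case: ifP => // _; rewrite -EFinD ltry. Qed.

Lemma continuous_expRNM g : continuous (fun t : R => g * expR (- g * t)).
Proof.
by move=> t; apply: cvgM; [exact: cvg_cst|exact: (is_derive_continuous (is_derive_expRZ (- g) t))].
Qed.

Lemma continuous_sine_integral M : 0 <= M -> continuous (sine_integral M : R -> R).
Proof.
move=> M0 x.
have i z : mu.-integrable `]0, M] (EFin \o (fun u => sin (z * u) / u)).
  apply: (@integrable_bounded _ _ _ mu _ _ `|z|) => //.
  - exact: itv0M_fin.
  - by apply: measurable_funTS; exact: measurable_sinc.
  - by move=> u; rewrite /= in_itv/= => /andP[u0 _]; exact: norm_sinc_le.
apply/cvgrPdist_le => /= e e0.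
(* The function is [M]-Lipschitz; [M + 1] is the divisor because [M] may be 0. *)
have M1 : 0 < M + 1 by rewrite ltr_wpDl.
near=> z.
rewrite /sine_integral -RintegralB//.
apply: (@le_trans _ _ (`|x - z| * M)); last first.
  apply: (@le_trans _ _ (`|x - z| * (M + 1))); first by rewrite ler_wpM2l// lerDl.
  rewrite -ler_pdivlMr//; near: z.
  by apply: cvgr_dist_le; [exact: cvg_id|rewrite divr_gt0].
rewrite -[M in leRHS]fine_itv0M//; apply: norm_Rintegral_le => //.
- exact: itv0M_fin.
- by apply: measurable_funTS; apply: measurable_funB; exact: measurable_sinc.
- move=> u; rewrite /= in_itv/= => /andP[u0 _].
  rewrite -mulrBl normrM normrV ?unitfE ?gt_eqF// ler_pdivrMr ?normr_gt0 ?gt_eqF//.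
  by rewrite (le_trans (ler_norm_sinB _ _))// -mulrBl normrM.
Unshelve. all: by end_near. Qed.

(* The integral of [expR (- g * t) * cos (u * t)] over t in [0, v]; by Fubini, its
   expectation at v = V is the real part of (1 - E exp (- z V)) / z, z = g + iu. *)
Definition damped_cosine g u v : R :=
  (g + expR (- g * v) * (u * sin (u * v) - g * cos (u * v))) / (g ^+ 2 + u ^+ 2).

Lemma measurable_damped_cosine g : measurable_fun setT (fun z : R * R => damped_cosine g z.1 z.2).
Proof.
have m1 : measurable_fun setT (fun z : R * R => z.1) by exact: measurable_fst.
have m2 : measurable_fun setT (fun z : R * R => z.2) by exact: measurable_snd.
have m12 : measurable_fun setT (fun z : R * R => z.1 * z.2) by exact: measurable_funM.
apply: measurable_funM.
  apply: measurable_funD => //; apply: measurable_funM.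
    by apply: (measurableT_comp (continuous_measurable_fun (@continuous_expR R))); exact: measurable_funM.
  apply: measurable_funB; apply: measurable_funM => //.
    exact: (measurableT_comp (continuous_measurable_fun (@continuous_sin R))).
  exact: (measurableT_comp (continuous_measurable_fun (@continuous_cos R))).
apply: (measurableT_comp measurable_invr); apply: measurable_funD => //.
exact: measurable_funX.
Qed.

(** Integration by parts in [t], with [sin (t * u) / u] as antiderivative of the cosine. It brings
    out the Dirichlet kernel, whose integrals over [u] are bounded uniformly in the cut-off. *)
Lemma damped_cosineE g u v : 0 < u -> 0 <= v ->
  damped_cosine g u v = expR (- g * v) * (sin (v * u) / u) +
    \int[mu]_(t in `[0, v]) (g * expR (- g * t) * (sin (t * u) / u)).
Proof.
move=> u0 v0; have q0 : 0 < g ^+ 2 + u ^+ 2 by rewrite ltr_wpDl ?exprn_gt0 ?sqr_ge0.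
pose F t := damped_cosine g u t - expR (- g * t) * (sin (u * t) / u).
have dF t : is_derive t 1 F (g * expR (- g * t) * (sin (t * u) / u)).
  rewrite /F /damped_cosine; apply: is_derive_eq; rewrite /GRing.scale/=.
  by rewrite [t * u]mulrC; field; rewrite !gt_eqF.
have cf : continuous (fun t => g * expR (- g * t) * (sin (t * u) / u)).
  move=> t; apply: cvgM.
    by apply: cvgM; [exact: cvg_cst|exact: (is_derive_continuous (is_derive_expRZ (- g) t))].
  apply: cvgM; last exact: cvg_cst.
  by under eq_fun do rewrite mulrC; rewrite [t * u]mulrC; exact: (is_derive_continuous (is_derive_sinZ u t)).
rewrite (FTC v0 dF cf) /F /damped_cosine !mulr0 sin0 cos0 expR0 [v * u]mulrC.
by field; rewrite !gt_eqF.
Qed.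

(** The Dirichlet kernel at [t] integrated against [cos (u * y)], by the product-to-sum formula. As
    [M] grows it tends to [pi / 2] for [t > y] and to 0 for [0 <= t < y], when [y > 0]. *)
Definition dirichlet y M t : R :=
  (sine_integral M (t + y) + sine_integral M (t - y)) / 2.

Lemma dirichletE y M t :
  \int[mu]_(u in `]0, M]) (sin (t * u) / u * cos (u * y)) = dirichlet y M t.
Proof.
have i z : mu.-integrable `]0, M] (EFin \o (fun u => sin (z * u) / u)).
  apply: (@integrable_bounded _ _ _ mu _ _ `|z|) => //.
  - exact: itv0M_fin.
  - by apply: measurable_funTS; exact: measurable_sinc.
  - by move=> u; rewrite /= in_itv/= => /andP[u0 _]; exact: norm_sinc_le.
rewrite /dirichlet /sine_integral -RintegralD// -RintegralZr//; last first.
  by have := integrableD _ (i (t + y)) (i (t - y)); apply.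
apply: eq_Rintegral => u _; rewrite [(t + y) * u]mulrDl [(t - y) * u]mulrBl sinD sinB [y * u]mulrC.
by move: (u^-1) => iu; field.
Qed.

Lemma measurable_dirichlet y M : 0 <= M -> measurable_fun setT (dirichlet y M).
Proof.
move=> M0; have mS := continuous_measurable_fun (continuous_sine_integral M0).
apply: measurable_funM => //; apply: measurable_funD; apply: (measurableT_comp mS).
  exact: measurable_funD.
exact: measurable_funB.
Qed.

Lemma dirichlet_le y M t : 0 <= M -> `|dirichlet y M t| <= 4.
Proof.
move=> M0; rewrite normrM (_ : `|2^-1| = 2^-1 :> R); last by rewrite ger0_norm.
rewrite ler_pdivrMr// (le_trans (ler_normD _ _))//.
have := sine_integral_bounded (t + y) M0; have := sine_integral_bounded (t - y) M0; lra.
Qed.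

Lemma integral_damped_cosine g y M v : 0 < g -> 0 <= M -> 0 <= v ->
  \int[mu]_(u in `]0, M]) (damped_cosine g u v * cos (u * y)) =
  expR (- g * v) * dirichlet y M v +
  \int[mu]_(t in `[0, v]) (g * expR (- g * t) * dirichlet y M t).
Proof.
move=> g0 M0 v0.
pose h1 u := expR (- g * v) * (sin (v * u) / u * cos (u * y)).
pose f (z : R * R) := g * expR (- g * z.2) * (sin (z.2 * z.1) / z.1 * cos (z.1 * y)).
have mf : measurable_fun setT f.
  have m1 : measurable_fun setT (fun z : R * R => z.1) by exact: measurable_fst.
  have m2 : measurable_fun setT (fun z : R * R => z.2) by exact: measurable_snd.
  apply: measurable_funM; first exact: (measurableT_comp (continuous_measurable_fun (@continuous_expRNM g)) m2).
  apply: measurable_funM.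
    apply: measurable_funM; last exact: (measurableT_comp measurable_invr m1).
    by apply: (measurableT_comp (continuous_measurable_fun (@continuous_sin R))); exact: measurable_funM.
  by apply: (measurableT_comp (continuous_measurable_fun (@continuous_cos R))); exact: measurable_funM.
have fle u t : 0 < u -> 0 <= t <= v -> `|f (u, t)| <= g * v.
  move=> u0 /andP[t0 tv]; rewrite /f/= normrM ler_pM ?normr_ge0//.
    by rewrite normrM (ger0_norm (ltW g0)) ler_piMr ?(ltW g0)// ger0_norm// expRN_le1// ltW.
  rewrite normrM -[leRHS]mulr1 ler_pM ?normr_ge0 ?cos_max//.
  by rewrite (le_trans (norm_sinc_le _ u0))// ger0_norm.
have vfin := itv_fin 0 v.
have sub u : 0 < u -> mu.-integrable `[0, v] (EFin \o (fun t => f (u, t))).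
  move=> u0; apply: (@integrable_bounded _ _ _ mu _ _ (g * v)) => //.
    by apply: measurable_funTS; apply: measurableT_comp => //; exact: measurable_pair1.
  by move=> t; rewrite /= in_itv/=; exact: fle.
have mcos : measurable_fun setT (fun u : R => cos (u * y)).
  by apply: (measurableT_comp (continuous_measurable_fun (@continuous_cos R))); exact: measurable_funM.
have sinci t : mu.-integrable `]0, M] (EFin \o (fun u => sin (t * u) / u * cos (u * y))).
  apply: (@integrable_bounded _ _ _ mu _ _ `|t|) => //; first exact: itv0M_fin.
    by apply: measurable_funTS; apply: measurable_funM => //; exact: measurable_sinc.
  move=> u; rewrite /= in_itv/= => /andP[u0 _].
  by rewrite normrM -[leRHS]mulr1 ler_pM ?normr_ge0 ?cos_max// norm_sinc_le.
have h1i : mu.-integrable `]0, M] (EFin \o h1).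
  by have := integrableZl _ (expR (- g * v)) (sinci v); apply.
have h12E u : 0 < u ->
    damped_cosine g u v * cos (u * y) = h1 u + \int[mu]_(t in `[0, v]) f (u, t).
  move=> u0; rewrite damped_cosineE// mulrDl -mulrA; congr (_ + _).
  rewrite -RintegralZr//.
    by apply: eq_Rintegral => t _; rewrite /f/= !mulrA.
  apply: (@integrable_bounded _ _ _ mu _ _ (g * v)) => //.
    apply: measurable_funTS; apply: measurable_funM.
      exact: (continuous_measurable_fun (@continuous_expRNM g)).
    apply: measurable_funM => //; apply: continuous_measurable_fun => t.
    have -> : (fun x : R => sin (x * u)) = fun x => sin (u * x) by apply/funext => x; rewrite mulrC.
      exact: (is_derive_continuous (is_derive_sinZ u t)).
  move=> t; rewrite /= in_itv/= => /andP[t0 tv].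
  rewrite normrM ler_pM ?normr_ge0//.
    by rewrite normrM (ger0_norm (ltW g0)) ler_piMr ?(ltW g0)// ger0_norm// expRN_le1// ltW.
  by rewrite (le_trans (norm_sinc_le _ u0))// ger0_norm.
have h2i : mu.-integrable `]0, M] (EFin \o (fun u => \int[mu]_(t in `[0, v]) f (u, t))).
  apply: (@integrable_bounded _ _ _ mu _ _ (g * v * v)) => //; first exact: itv0M_fin.
  - apply: (@eq_measurable_fun _ _ _ _ _ (fun u => damped_cosine g u v * cos (u * y) - h1 u)).
      by move=> u; rewrite inE/= in_itv/= => /andP[u0 _]; rewrite h12E// addrAC subrr add0r.
    apply: measurable_funTS; apply: measurable_funB.
      apply: measurable_funM => //.
      have mp : measurable_fun setT (fun u : R => (u, v)) by exact: measurable_pair2.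
      exact: (measurableT_comp (measurable_damped_cosine g) mp).
    by apply: measurable_funM => //; apply: measurable_funM => //; exact: measurable_sinc.
  - move=> u; rewrite /= in_itv/= => /andP[u0 _].
    have -> : g * v * v = g * v * fine (mu `[0, v]).
      rewrite lebesgue_measure_itv/= lte_fin; congr (_ * _); move: v0; rewrite le_eqVlt => /predU1P[<-|->].
        by rewrite ltxx.
      by rewrite -EFinD/= subr0.
    apply: norm_Rintegral_le => //.
      by apply: measurable_funTS; apply: measurableT_comp => //; exact: measurable_pair1.
    by move=> t; rewrite /= in_itv/=; exact: fle.
transitivity (\int[mu]_(u in `]0, M]) (h1 u + \int[mu]_(t in `[0, v]) f (u, t))).
  apply: eq_Rintegral => u; rewrite inE/= in_itv/= => /andP[u0 _].
  exact: h12E.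
rewrite RintegralD//; congr (_ + _).
  by rewrite RintegralZl// dirichletE.
rewrite (@Rintegral_fubini_bounded _ _ _ _ _ mu mu _ _ _ (g * v))//; last 2 first.
- exact: itv0M_fin.
- by move=> u t; rewrite /= !in_itv/= => /andP[u0 _]; exact: fle.
by apply: eq_Rintegral => t _; rewrite /f/= RintegralZl ?dirichletE.
Qed.

(** Each of the two terms of [integral_damped_cosine] is at most 4: [dirichlet] is bounded by 4, and
    [g * expR (- g * t)] has total mass at most 1. Uniformity in [M] and [v] allows the limit under
    the expectation. *)
Lemma norm_integral_damped_cosine_le g y M v : 0 < g -> 0 <= M -> 0 <= v ->
  `|\int[mu]_(u in `]0, M]) (damped_cosine g u v * cos (u * y))| <= 8.
Proof.
move=> g0 M0 v0; rewrite integral_damped_cosine//.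
have cexp := @continuous_expRNM g.
have vfin := itv_fin 0 v.
have ege t : 0 <= g * expR (- g * t) by rewrite mulr_ge0 ?(ltW g0).
have ele t : 0 <= t -> g * expR (- g * t) <= g.
  move=> t0; by rewrite ler_piMr ?(ltW g0)// expRN_le1// ltW.
have E : \int[mu]_(t in `[0, v]) (g * expR (- g * t) * 4) = (1 - expR (- g * v)) * 4.
  rewrite RintegralZr//.
    rewrite (@FTC _ (fun t => - expR (- g * t)) _ _ _ v0 _ cexp).
      by rewrite mulr0 expR0 opprK addrC.
    by move=> t; apply: is_derive_eq; rewrite mulNr opprK.
  apply: (@integrable_bounded _ _ _ mu _ _ g) => //.
    by apply: measurable_funTS; exact: continuous_measurable_fun.
  by move=> t; rewrite /= in_itv/= => /andP[t0 _]; rewrite ger0_norm// ele.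
have mh : measurable_fun `[0, v]%classic (fun t => g * expR (- g * t) * dirichlet y M t).
  apply: measurable_funTS; apply: measurable_funM; last exact: measurable_dirichlet.
  exact: continuous_measurable_fun.
have hle t : `[0, v]%classic t -> `|g * expR (- g * t) * dirichlet y M t| <= g * expR (- g * t) * 4.
  by move=> _; rewrite normrM (ger0_norm (ege _)) ler_wpM2l// dirichlet_le.
have ih : mu.-integrable `[0, v] (EFin \o (fun t => g * expR (- g * t) * dirichlet y M t)).
  apply: (@integrable_bounded _ _ _ mu _ _ (g * 4)) => // t vt.
  rewrite (le_trans (hle _ vt))// ler_wpM2r//; move: vt; rewrite /= in_itv/= => /andP[t0 _].
  exact: ele.
have h1 : `|expR (- g * v) * dirichlet y M v| <= 4.
  by rewrite normrM -[leRHS]mul1r ler_pM ?dirichlet_le// ger0_norm// expRN_le1// ltW.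
have h2 : `|\int[mu]_(t in `[0, v]) (g * expR (- g * t) * dirichlet y M t)| <= 4.
  rewrite (le_trans (le_normr_Rintegral _ ih))//.
  apply: (@le_trans _ _ (\int[mu]_(t in `[0, v]) (g * expR (- g * t) * 4))).
    apply: le_Rintegral => //; first exact: integrable_abse ih.
    apply: (@integrable_bounded _ _ _ mu _ _ (g * 4)) => //.
      apply: measurable_funTS; apply: measurable_funM => //.
      exact: continuous_measurable_fun.
    move=> t; rewrite /= in_itv/= => /andP[t0 _]; rewrite normrM (ger0_norm (ege _)) ger0_norm//.
    by rewrite ler_wpM2r// ele.
  by rewrite E -[leRHS]mul1r ler_wpM2r// lerBlDr lerDl.
by rewrite (le_trans (ler_normD _ _))// (_ : 8 = 4 + 4) ?lerD// -natrD.
Qed.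

(** For [v > y] the boundary term tends to [pi / 2 * expR (- g * v)] and the integral, now over
    [y, v], to [pi / 2 * (expR (- g * y) - expR (- g * v))]: the terms in [v] cancel. For [v < y]
    both limits are 0. At [v = y] the limit would be half of the upper value, hence [v != y]. *)
Lemma cvg_integral_damped_cosine g y v (M : nat -> R) : 0 < g -> 0 < y ->
  0 <= v -> v != y -> (forall n, 0 <= M n) -> M n @[n --> \oo] --> +oo ->
  \int[mu]_(u in `]0, M n]) (damped_cosine g u v * cos (u * y)) @[n --> \oo] -->
  pi / 2 * expR (- g * y) * \1_`]y, +oo[ v.
Proof.
move=> g0 y0 v0 vy M0 Moo.
under eq_fun do rewrite integral_damped_cosine//.
have dcvg t : dirichlet y (M n) t @[n --> \oo] --> (Num.sg (t + y) + Num.sg (t - y)) * (pi / 4).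
  have -> : (Num.sg (t + y) + Num.sg (t - y)) * (pi / 4) =
    (Num.sg (t + y) * (pi / 2) + Num.sg (t - y) * (pi / 2)) / 2 by field.
  by apply: cvgM; [apply: cvgD; exact: cvg_sine_integral|exact: cvg_cst].
have cexp := @continuous_expRNM g.
have vfin := itv_fin 0 v.
pose h t := g * expR (- g * t) * ((Num.sg (t + y) + Num.sg (t - y)) * (pi / 4)).
have mh : measurable_fun setT h.
  apply: measurable_funM; first exact: continuous_measurable_fun.
  apply: (@measurable_fun_cvg _ _ _ setT (fun n => dirichlet y (M n))) => //.
  by move=> n; exact: measurable_dirichlet.
have sg1 t : `|Num.sg t| <= 1 :> R by rewrite normr_sg lern1 leq_b1.
have hb t : 0 <= t -> `|h t| <= g * 2.
  move=> t0; rewrite normrM ler_pM ?normr_ge0//.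
    by rewrite normrM (ger0_norm (ltW g0)) ler_piMr ?(ltW g0)// ger0_norm// expRN_le1// ltW.
  rewrite normrM [X in _ * X]ger0_norm; last by rewrite divr_ge0 ?pi_ge0.
  apply: (@le_trans _ _ (2 * (pi / 4))); last by have := pihalf_lt2 R; lra.
  rewrite ler_wpM2r ?divr_ge0 ?pi_ge0// (le_trans (ler_normD _ _))//.
  by rewrite -[2]/(1 + 1) lerD.
have hi (D : set R) : measurable D -> D `<=` `[0, v] -> mu.-integrable D (EFin \o h).
  move=> mD Dv; apply: (@integrable_bounded _ _ _ mu _ _ (g * 2)) => //.
  - by apply: le_lt_trans (itv_fin 0 v); apply: le_measure => //; rewrite inE.
  - exact: measurable_funTS.
  - by move=> t /Dv; rewrite /= in_itv/= => /andP[t0 _]; exact: hb.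
have -> : pi / 2 * expR (- g * y) * \1_`]y, +oo[ v =
    expR (- g * v) * ((Num.sg (v + y) + Num.sg (v - y)) * (pi / 4)) +
    \int[mu]_(t in `[0, v]) h t.
  rewrite (gtr0_sg (_ : 0 < v + y)) ?ltr_wpDl// indicE.
  have h0 t : 0 <= t < y -> h t = 0.
    move=> /andP[t0 ty]; rewrite /h (gtr0_sg (_ : 0 < t + y)) ?ltr_wpDl//.
    by rewrite ltr0_sg ?subr_lt0// subrr mul0r mulr0.
  have [yv|yv|/eqP] := ltgtP y v; last by rewrite eq_sym (negbTE vy).
    rewrite mem_set/= ?in_itv/= ?yv// gtr0_sg ?subr_gt0//.
    have -> : (`[0, v]%classic : set R) = `[0, y] `|` `]y, v].
      by rewrite -itv_bndbnd_setU// bnd_simp ltW.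
    rewrite Rintegral_setU//; last 2 first.
    - apply: hi; first exact: measurableU.
      by move=> t [] /=; rewrite !in_itv/= => /andP[]; [move=> -> /le_trans -> //; exact: ltW|move=> yt ->; rewrite (ltW (lt_trans y0 yt))].
    - by rewrite disj_set2E; apply/eqP; rewrite -subset0 => t [] /=; rewrite !in_itv/= => /andP[_ /le_lt_trans ty] /andP[/ty]; rewrite ltxx.
    rewrite -Rintegral_itv_bndo_bndc//; last first.
      by apply: hi => // t /=; rewrite !in_itv/= => /andP[-> /ltW/le_trans ->//]; exact: ltW.
    rewrite (@eq_Rintegral _ _ _ mu `[0, y[ (cst 0)); last first.
      by move=> t; rewrite inE/= in_itv/= => /h0.
    rewrite Rintegral_cst// mul0r add0r.
    have E t : y < t -> h t = pi / 2 * (g * expR (- g * t)).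
      move=> yt; rewrite /h !gtr0_sg ?subr_gt0 ?addr_gt0// ?(lt_trans y0)//.
      by field.
    rewrite (@eq_Rintegral _ _ _ mu `]y, v] (fun t => pi / 2 * (g * expR (- g * t)))); last first.
      by move=> t; rewrite inE/= in_itv/= => /andP[/E].
    rewrite Rintegral_itv_obnd_cbnd; last first.
      apply: (@integrable_bounded _ _ _ mu _ _ (pi / 2 * g)) => //.
      - by apply: le_lt_trans (itv_fin y v); apply: le_measure; rewrite ?inE//; apply: subset_itvr; rewrite bnd_simp.
      - by apply: measurable_funTS; apply: measurable_funM => //; exact: continuous_measurable_fun.
      - move=> t; rewrite /= in_itv/= => /andP[yt _].
        rewrite ger0_norm ?mulr_ge0 ?divr_ge0 ?pi_ge0 ?(ltW g0)// ler_wpM2l ?divr_ge0 ?pi_ge0//.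
        by rewrite ler_piMr ?(ltW g0)// expRN_le1 ?ltW// (lt_trans y0).
    have dF t : is_derive t 1 (fun t => - (pi / 2 * expR (- g * t))) (pi / 2 * (g * expR (- g * t))).
      by apply: is_derive_eq; rewrite /GRing.scale/=; ring.
    rewrite (FTC (ltW yv) dF).
    + by field.
    + by move=> t; apply: cvgM; [exact: cvg_cst|exact: cexp].
  rewrite memNset/=; last by rewrite in_itv/= andbT ltNge (ltW yv).
  rewrite ltr0_sg ?subr_lt0// subrr mul0r !mulr0 add0r.
  rewrite (@eq_Rintegral _ _ _ _ _ (cst 0)) ?Rintegral_cst ?mul0r//.
  by move=> t; rewrite inE/= in_itv/= => /andP[t0 tv]; apply: h0; rewrite t0 (le_lt_trans tv).
apply: cvgD; first by apply: cvgM; [exact: cvg_cst|exact: dcvg].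
apply: (@Rintegral_bounded_cvg _ _ _ mu _ _ _ (g * 4)) => //.
- move=> n; apply: measurable_funTS; apply: measurable_funM; last exact: measurable_dirichlet.
  exact: continuous_measurable_fun.
- exact: measurable_funTS.
- by apply: aeW => t _; apply: cvgM; [exact: cvg_cst|exact: dcvg].
- move=> n t; rewrite /= in_itv/= => /andP[t0 _].
  rewrite normrM ler_pM ?dirichlet_le// ger0_norm ?mulr_ge0 ?(ltW g0)//.
  by rewrite ler_piMr ?(ltW g0)// expRN_le1// ltW.
Qed.

End inversion.

Section laplace_inversion.
Context {d} {T : measurableType d} {R : realType} (P : probability T R).
Notation mu := (@lebesgue_measure R).
Variables (V : T -> R) (g y : R).
Hypotheses (mV : measurable_fun setT V) (V0 : forall w, 0 <= V w)
  (g0 : 0 < g) (y0 : 0 < y) (atom : P [set w | V w = y] = 0%E).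

Let m u := \int[P]_w damped_cosine g u (V w).

(** The numerator is at most [2 * g + |u|], and [g * (2 * g + |u|) <= 3 * (g ^+ 2 + u ^+ 2)]. A
    bound independent of [v] is what Fubini needs on ]0, M] times the probability space. *)
Lemma norm_damped_cosine_le u v : 0 <= v -> `|damped_cosine g u v| <= 3 / g.
Proof.
move=> v0; have q0 : 0 < g ^+ 2 + u ^+ 2 by rewrite ltr_pwDl ?exprn_gt0 ?sqr_ge0.
rewrite normrM [`|_^-1|]ger0_norm ?invr_ge0 ?(ltW q0)// ler_pdivrMr//.
rewrite (@le_trans _ _ (g + (`|u| + g)))//.
  rewrite (le_trans (ler_normD _ _))// (ger0_norm (ltW g0)) lerD2l normrM.
  rewrite -[leRHS]mul1r ler_pM//; first by rewrite ger0_norm// expRN_le1// ltW.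
  rewrite (le_trans (ler_normB _ _))// !normrM (ger0_norm (ltW g0)).
  by rewrite lerD// ler_piMr ?(ltW g0)// ?sin_max ?cos_max.
rewrite mulrAC ler_pdivlMr// -[u ^+ 2]real_normK ?num_real//.
by have := sqr_ge0 (g - `|u|); have := sqr_ge0 `|u|; nra.
Qed.

Lemma improper_integral_damped_cosine :
  improper_integral (fun u => m u * cos (u * y))
    (pi / 2 * expR (- g * y) * fine (P [set w | y < V w])).
Proof.
pose h (z : R * T) := damped_cosine g z.1 (V z.2) * cos (z.1 * y).
have mcos : measurable_fun setT (fun u : R => cos (u * y)).
  by apply: (measurableT_comp (continuous_measurable_fun (@continuous_cos R))); exact: measurable_funM.
have mdc : measurable_fun setT (fun z : R * T => damped_cosine g z.1 (V z.2)).
  have mp : measurable_fun setT (fun z : R * T => (z.1, V z.2)).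
    apply: measurable_fun_pair; first exact: measurable_fst.
    by apply: (measurableT_comp mV); exact: measurable_snd.
  exact: (measurableT_comp (@measurable_damped_cosine R g) mp).
have mh : measurable_fun setT h.
  by apply: measurable_funM => //; apply: (measurableT_comp mcos); exact: measurable_fst.
have hb u w : `|h (u, w)| <= 3 / g.
  by rewrite normrM -[leRHS]mulr1 ler_pM ?cos_max// norm_damped_cosine_le.
have swap M : 0 <= M -> \int[mu]_(u in `[0, M]) (m u * cos (u * y)) =
    \int[P]_w \int[mu]_(u in `]0, M]) (damped_cosine g u (V w) * cos (u * y)).
  move=> M0.
  have mE u : m u * cos (u * y) = \int[P]_w h (u, w).
    rewrite /h/= RintegralZr//; apply: (@integrable_bounded _ _ _ P _ _ (3 / g)) => //.
    - exact: probability_lty.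
    - have mp : measurable_fun setT (fun w : T => (u, w)) by exact: measurable_pair1.
      exact: (measurableT_comp mdc mp).
    - by move=> w _; exact: norm_damped_cosine_le.
  under eq_Rintegral do rewrite mE.
  rewrite -Rintegral_itv_obnd_cbnd; last first.
    apply: (@integrable_bounded _ _ _ mu _ _ (3 / g)) => //; first exact: itv0M_fin.
    - by apply: measurable_funTS; exact: (@measurable_Rintegral _ _ _ _ _ P h).
    - move=> u _.
      have -> : 3 / g = 3 / g * fine (P setT) by rewrite probability_setT/= mulr1.
      apply: norm_Rintegral_le => //; first exact: probability_lty.
      by apply: measurableT_comp => //; exact: measurable_pair1.
  rewrite (@Rintegral_fubini_bounded _ _ _ _ _ mu P _ _ _ (3 / g))//.
  - exact: itv0M_fin.
  - exact: probability_lty.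
apply/cvg_pinftyP => M Moo.
(* The exchange of integrals is available for [M >= 0], which the sequence satisfies only
   eventually; hence the shift by [N]. *)
have [N _ MN] : \forall n \near \oo, 0 <= M n by move/cvgryPge : Moo; exact.
rewrite -(cvg_shiftn N) /=; pose M' n := M (n + N)%N.
have M'0 n : 0 <= M' n by apply: MN; rewrite /= leq_addl.
have M'oo : M' n @[n --> \oo] --> +oo by rewrite /M' (cvg_shiftn N M).
have mW (A : set R) : measurable A -> measurable (V @^-1` A).
  by move=> mA; rewrite -[X in measurable X]setTI; exact: mV.
have -> : pi / 2 * expR (- g * y) * fine (P [set w | y < V w]) =
    \int[P]_w (pi / 2 * expR (- g * y) * \1_`]y, +oo[ (V w)).
  have i1 : P.-integrable setT (EFin \o (fun w => \1_`]y, +oo[ (V w) : R)).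
    apply: (@integrable_bounded _ _ _ P _ _ 1) => //; first exact: probability_lty.
      by apply: measurableT_comp => //; exact: measurable_indic.
    by move=> w _; rewrite indicE normr_nat lern1 leq_b1.
  rewrite RintegralZl//; congr (_ * fine _).
  have -> : [set w | y < V w] = V @^-1` `]y, +oo[ `&` setT.
    by rewrite setIT; apply/seteqP; split => w /=; rewrite in_itv/= andbT.
  by rewrite -integral_indic//; exact: mW.
rewrite (_ : (fun n => _) = fun n => \int[P]_w \int[mu]_(u in `]0, M' n])
    (damped_cosine g u (V w) * cos (u * y))); last first.
  by apply/funext => n; exact: swap (M'0 n).
apply: (@Rintegral_bounded_cvg _ _ _ P _ _ _ 8) => //.
- exact: probability_lty.
- move=> n; apply: (@eq_measurable_fun _ _ _ _ _ (fun w => \int[mu]_u ((fun z : T * R => h (z.2, z.1) * \1_`]0, M' n] z.2) (w, u)))).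
    move=> w _; rewrite [RHS]Rintegral_mkcond; apply: eq_Rintegral => u _.
    by rewrite patchE indicE /h/=; case: ifPn => _; rewrite ?mulr1 ?mulr0.
  pose hM (z : T * R) : R := h (z.2, z.1) * \1_`]0, M' n] z.2.
  suff mhM : measurable_fun setT hM by exact: (@measurable_Rintegral _ _ _ _ _ mu hM).
  apply: measurable_funM.
    have msw : measurable_fun setT (fun z : T * R => (z.2, z.1)).
      by apply: measurable_fun_pair; [exact: measurable_snd|exact: measurable_fst].
    exact: (measurableT_comp mh msw).
  by apply: measurableT_comp; [exact: measurable_indic|exact: measurable_snd].
- apply: measurable_funM => //; apply: measurableT_comp => //; exact: measurable_indic.
(* The exceptional set of the pointwise limit, null by [atom]. *)
- exists [set w | V w = y]; split => //.
    rewrite (_ : [set w | _] = V @^-1` [set y]); first exact: mW.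
    by apply/seteqP; split.
  move=> w /=; apply: contra_notP => /eqP vy _.
  exact: cvg_integral_damped_cosine.
- by move=> n w _; exact: norm_integral_damped_cosine_le.
Qed.

(** The integral recovers the mass strictly above [y]; as [y] carries no mass, the complement is the
    mass strictly below. *)
Lemma laplace_inversion :
  exists2 I : R, improper_integral (fun u => m u * cos (u * y)) I &
    P [set w | V w < y] = (1 - 2 * expR (g * y) / pi * I)%:E.
Proof.
eexists; first exact: improper_integral_damped_cosine.
have mW (A : set R) : measurable A -> measurable (V @^-1` A).
  by move=> mA; rewrite -[X in measurable X]setTI; exact: mV.
have mgt : measurable [set w | y < V w].
  rewrite (_ : [set w | _] = V @^-1` `]y, +oo[); first exact: mW.
  by apply/seteqP; split => w /=; rewrite in_itv/= andbT.
have meq : measurable [set w | V w = y].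
  by rewrite (_ : [set w | _] = V @^-1` [set y]); [exact: mW|apply/seteqP; split].
have -> : [set w | V w < y] = ~` ([set w | y < V w] `|` [set w | V w = y]).
  apply/seteqP; split => w /=.
    by move=> Vy [/(lt_trans Vy)|Vy']; [rewrite ltxx|move: Vy; rewrite Vy' ltxx].
  by case: (ltgtP (V w) y) => //= h H; exfalso; apply: H; [left|right].
have -> : P (~` ([set w | y < V w] `|` [set w | V w = y])) =
    (1 - (P [set w | (y < V w)%R] + P [set w | V w = y]))%E.
  rewrite probability_setC; last exact: measurableU.
  rewrite measureU// -subset0 => w [/= h h']; move: h; rewrite h' ltxx//.
rewrite atom adde0 -[P _]fineK ?fin_num_measure// -EFinB; congr (1 - _)%:E.
have e0 : expR (g * y) * expR (- g * y) = 1 by rewrite -expRD mulNr subrr expR0.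
have pi0 := pi_gt0 R.
have E (p q r : R) : r != 0 -> p = q ->
    p = 2 * expR (g * y) / r * (r / 2 * expR (- g * y) * q).
  move=> r0 ->; rewrite -[LHS]mul1r -[X in X * _ = _]e0.
  by move: (expR (g * y)) (expR (- g * y)) => b c; field.
by apply: E; rewrite // gt_eqF.
Qed.

End laplace_inversion.

(** * Palm identity and complex Laplace transform *)

(** The system says that [A + iB] has logarithmic derivative [- S + iC]. Multiplied by [expR rho]
    and rotated by the angle [- theta], it has derivative zero, so it keeps its initial value 1;
    [H1] and [H2] are the real and imaginary parts. *)
Lemma linear_system_solution {R : realType} (A B rho theta S C : R -> R) :
  (forall u : R, is_derive u 1 A (- (S u * A u + C u * B u))) ->
  (forall u : R, is_derive u 1 B (C u * A u - S u * B u)) ->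
  (forall u : R, is_derive u 1 rho (S u)) -> (forall u : R, is_derive u 1 theta (C u)) ->
  A 0 = expR (- rho 0) -> B 0 = 0 -> theta 0 = 0 ->
  forall u, A u = expR (- rho u) * cos (theta u) /\
            B u = expR (- rho u) * sin (theta u).
Proof.
move=> dA dB dr dt A0 B0 t0 u.
have de (v : R) : is_derive v 1 (fun v => expR (rho v)) (expR (rho v) * S v).
  exact: (@is_derive1_comp R expR rho v _ _ (is_derive_expR _) (dr v)).
have ds (v : R) : is_derive v 1 (fun v => sin (theta v)) (cos (theta v) * C v).
  exact: (@is_derive1_comp R sin theta v _ _ (is_derive_sin _) (dt v)).
have dc (v : R) : is_derive v 1 (fun v => cos (theta v)) (- sin (theta v) * C v).
  exact: (@is_derive1_comp R cos theta v _ _ (is_derive_cos _) (dt v)).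
pose H1 v := expR (rho v) * (A v * cos (theta v) + B v * sin (theta v)).
pose H2 v := expR (rho v) * (B v * cos (theta v) - A v * sin (theta v)).
have H1E : H1 u = 1.
  have dH (v : R) : is_derive v 1 H1 0.
    by rewrite /H1; apply: is_derive_eq; rewrite /GRing.scale/=; ring.
  rewrite (is_derive_0_is_cst u 0 dH).
  by rewrite /H1 A0 B0 t0 cos0 mul0r addr0 mulr1 -expRD subrr expR0.
have H2E : H2 u = 0.
  have dH (v : R) : is_derive v 1 H2 0.
    by rewrite /H2; apply: is_derive_eq; rewrite /GRing.scale/=; ring.
  rewrite (is_derive_0_is_cst u 0 dH).
  by rewrite /H2 B0 t0 sin0 mul0r mulr0 subr0 mulr0.
have e1 : expR (- rho u) * expR (rho u) = 1 by rewrite -expRD addNr expR0.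
have cs := cos2Dsin2 (theta u).
split.
  transitivity (expR (- rho u) * (H1 u * cos (theta u) - H2 u * sin (theta u))).
    rewrite -[LHS]mul1r -[in LHS]e1 -[LHS]mulr1 -cs /H1 /H2; ring.
  by rewrite H1E H2E mul1r mul0r subr0.
transitivity (expR (- rho u) * (H1 u * sin (theta u) + H2 u * cos (theta u))).
  rewrite -[LHS]mul1r -[in LHS]e1 -[LHS]mulr1 -cs /H1 /H2; ring.
by rewrite H1E H2E mul1r mul0r addr0.
Qed.

Section infinitely_divisible.
Context {R : realType} {d d'} {T : measurableType d} {Y : measurableType d'}.
Variables (P : probability T R) (m : {sigma_finite_measure set Y -> \bar R}).
Variables (D : set Y) (x : Y -> R) (V : T -> R) (c : R).
Hypotheses (mD : measurable D) (mx : measurable_fun setT x)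
  (x0 : forall y, 0 < x y) (ix : m.-integrable D (EFin \o x))
  (mV : measurable_fun setT V) (V0 : forall w, 0 <= V w) (c0 : 0 <= c).
Hypothesis laplace_V : forall t, 0 < t ->
  \int[P]_w expR (- V w * t) =
  expR (- (c * \int[m]_(y in D) (1 - expR (- x y * t)))).

(** From [1 + z <= expR z]. It is the dominating bound for everything that carries the factor [V],
    since [V] itself need not be integrable. *)
Lemma mulr_expRN_le (v t : R) : 0 < t -> 0 <= v -> v * expR (- v * t) <= t^-1.
Proof.
move=> t0 v0; rewrite mulNr expRN ler_pdivrMr ?expR_gt0// -ler_pdivrMl ?invr_gt0// invrK.
by rewrite mulrC (le_trans _ (expR_ge1Dx _))// lerDr.
Qed.

Let mexpV t : measurable_fun setT (fun w => expR (- V w * t)).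
Proof.
apply: (measurableT_comp (continuous_measurable_fun (@continuous_expR R))).
by apply: measurable_funM => //; exact: measurableT_comp.
Qed.

Let mexpx t : measurable_fun setT (fun y => expR (- x y * t)).
Proof.
apply: (measurableT_comp (continuous_measurable_fun (@continuous_expR R))).
by apply: measurable_funM => //; exact: measurableT_comp.
Qed.

Let expV_le1 t w : 0 <= t -> expR (- V w * t) <= 1.
Proof. by move=> t0; exact: expRN_le1. Qed.

Let expx_le1 t y : 0 <= t -> expR (- x y * t) <= 1.
Proof. by move=> t0; apply: expRN_le1 => //; exact/ltW. Qed.

Let integrable_x (f : Y -> R) (M : R) : measurable_fun setT f ->
  (forall y, `|f y| <= M * x y) -> m.-integrable D (EFin \o f).
Proof.
move=> mf fM; apply: (@integrable_dominated _ _ _ m D f (fun y => M * x y)) => //.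
  by have := integrableZl mD M ix; apply.
exact: measurable_funTS.
Qed.

Let xexp t : R := \int[m]_(y in D) (x y * expR (- x y * t)).

(** Both sides of [laplace_V] are differentiated at [t] under the integral sign and the two
    derivatives are equated. *)
Lemma laplace_derivative t : 0 < t ->
  \int[P]_w (V w * expR (- V w * t)) = c * xexp t * \int[P]_w expR (- V w * t).
Proof.
(* Staying above [t / 2] makes the bound [(t / 2)^-1] on the differentiated integrand uniform. *)
move=> t0; have t2 : t / 2 < t < 2 * t by apply/andP; split; lra.
have d1 : is_derive t 1 (fun t => \int[P]_w expR (- V w * t))
    (\int[P]_w (- V w * expR (- V w * t))).
  apply: (@is_derive_Rintegral _ _ _ P setT (fun t w => expR (- V w * t))
    (fun t w => - V w * expR (- V w * t)) (cst (t / 2)^-1) t (t / 2) (2 * t)) => //.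
  - move=> s /andP[ts _]; apply: (@integrable_bounded _ _ _ P _ _ 1) => //.
      exact: probability_lty.
    by move=> w _; rewrite ger0_norm// expV_le1//; lra.
  - by move=> w /=; rewrite invr_ge0; lra.
  - by apply: integrable_cst_fin => //; exact: probability_lty.
  - move=> s w /andP[ts _] _; rewrite normrM normrN !ger0_norm//.
    apply: le_trans (mulr_expRN_le _ (V0 w)); last by lra.
    rewrite ler_wpM2l// ler_expR !mulNr lerN2 ler_wpM2l//; exact: ltW.
have d2 : is_derive t 1 (fun t => \int[m]_(y in D) (1 - expR (- x y * t))) (xexp t).
  apply: (@is_derive_Rintegral _ _ _ m D (fun t y => 1 - expR (- x y * t))
    (fun t y => x y * expR (- x y * t)) x t (t / 2) (2 * t)) => //.
  - move=> s /andP[ts _]; apply: (@integrable_x _ s).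
      by apply: measurable_funB.
    move=> y; rewrite ger0_norm ?subr_ge0 ?expx_le1//; last by lra.
    by rewrite lerBlDr -lerBlDl (le_trans _ (expR_ge1Dx _))// mulNr mulrC.
  - by move=> s y _ _; apply: is_derive_eq; rewrite /GRing.scale/=; ring.
  - by move=> y; exact: ltW.
  - move=> s y /andP[ts _] _; rewrite ger0_norm ?mulr_ge0 ?(ltW (x0 y))//.
    by rewrite ler_piMr ?(ltW (x0 y))// expx_le1//; lra.
have d3 : is_derive t 1 (fun t => expR (- (c * \int[m]_(y in D) (1 - expR (- x y * t)))))
    (expR (- (c * \int[m]_(y in D) (1 - expR (- x y * t)))) * - (c * xexp t)).
  apply: (@is_derive1_comp R expR (fun t => - (c * \int[m]_(y in D) (1 - expR (- x y * t))))
    t _ _ (is_derive_expR _)).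
have d4 : is_derive t 1 (fun t => \int[P]_w expR (- V w * t))
    (expR (- (c * \int[m]_(y in D) (1 - expR (- x y * t)))) * - (c * xexp t)).
  (* [laplace_V] holds for positive arguments, hence in a neighbourhood of [t]. *)
  apply: near_eq_is_derive d3.
  near=> s; apply/esym/laplace_V; near: s; exact: lt_nbhsr.
have := @derive_val _ _ _ _ _ _ _ d1; rewrite (@derive_val _ _ _ _ _ _ _ d4) -laplace_V//.
rewrite (_ : (fun w => - V w * _) = fun w => -1 * (V w * expR (- V w * t))); last first.
  by apply/funext => w; rewrite mulN1r mulNr.
rewrite RintegralZl//; last first.
  apply: (@integrable_bounded _ _ _ P _ _ t^-1) => //; first exact: probability_lty.
    exact: measurable_funM.
  by move=> w _; rewrite ger0_norm ?mulr_ge0// mulr_expRN_le.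
by rewrite mulN1r mulrN => /oppr_inj <-; rewrite mulrC.
Unshelve. all: by end_near. Qed.

Section palm.
Variables (s : R) (s0 : 0 < s).

(** Densities of the two sides of the Palm identity. The tilt by [expR (- s * v)] makes the
    size-biased law of [V] finite, so that the uniqueness of moments applies. *)
Let wV w := V w * expR (- V w * s).
Let wx (z : Y * T) := c * x z.1 * \1_D z.1 * expR (- (V z.2 + x z.1) * s).

Let wV0 w : 0 <= wV w. Proof. by rewrite mulr_ge0. Qed.
Let wx0 z : 0 <= wx z.
Proof. by rewrite mulr_ge0// mulr_ge0// mulr_ge0// ltW. Qed.

Let mwV : measurable_fun setT wV. Proof. exact: measurable_funM. Qed.

Let mx1 : measurable_fun setT (fun z : Y * T => x z.1).
Proof. by apply: measurableT_comp => //; exact: measurable_fst. Qed.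

Let mV2 : measurable_fun setT (fun z : Y * T => V z.2).
Proof. by apply: measurableT_comp => //; exact: measurable_snd. Qed.

Let mD1 : measurable_fun setT (fun z : Y * T => \1_D z.1 : R).
Proof. by apply: measurableT_comp; [exact: measurable_indic|exact: measurable_fst]. Qed.

Let mVx t : measurable_fun setT (fun z : Y * T => expR (- (V z.2 + x z.1) * t)).
Proof.
apply: (measurableT_comp (continuous_measurable_fun (@continuous_expR R))).
apply: measurable_funM => //; apply: measurableT_comp => //.
exact: measurable_funD.
Qed.

Let mwx : measurable_fun setT wx.
Proof.
by apply: measurable_funM => //; apply: measurable_funM => //; exact: measurable_funM.
Qed.

Let pV := mdensity P wV0 mwV.
Let px := mdensity (m \x P)%E wx0 mwx.

Let integral_wx (phi : R -> R) : measurable_fun setT phi ->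
  (forall v, 0 <= phi v) ->
  (\int[px]_z (phi (V z.2 + x z.1))%:E =
   \int[m]_(y in D) ((c * (x y * expR (- x y * s)))%:E *
     \int[P]_w (expR (- V w * s) * phi (V w + x y))%:E))%E.
Proof.
move=> mphi phi0.
have mphiz : measurable_fun setT (fun z : Y * T => phi (V z.2 + x z.1)).
  by apply: (measurableT_comp mphi); exact: measurable_funD.
rewrite ge0_integral_mdensity//; last 2 first.
- by move=> z; rewrite lee_fin.
- exact/measurable_EFinP.
rewrite fubini_tonelli1//; last 2 first.
- by apply/measurable_EFinP; exact: measurable_funM.
- by move=> z; rewrite lee_fin mulr_ge0.
rewrite [RHS]integral_mkcond; apply: eq_integral => y _.
rewrite patchE /fubini_F/= /wx/=; case: ifPn => yD; last first.
  by rewrite integral0_eq// => w _; rewrite [\1_D _]indicE (negbTE yD) mulr0 mul0r mule0.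
have mpy : measurable_fun setT (fun w => phi (V w + x y)).
  by apply: (measurableT_comp mphi); exact: measurable_funD.
rewrite -ge0_integralZl//; last 3 first.
- by apply/measurable_EFinP; exact: measurable_funM.
- by move=> w _; rewrite lee_fin mulr_ge0.
- by rewrite lee_fin mulr_ge0// mulr_ge0// ltW.
apply: eq_integral => w _; rewrite indicE yD mulr1 -!EFinM opprD mulrDl expRD; congr EFin.
by ring.
Qed.

Let xexpE t : 0 <= t ->
  (\int[m]_(y in D) (x y * expR (- x y * t))%:E = (xexp t)%:E)%E.
Proof.
move=> t0; rewrite /xexp /Rintegral fineK//; apply: integrable_fin_num => //.
apply: (@integrable_x _ 1).
  by apply: measurable_funM.
by move=> y; rewrite mul1r ger0_norm ?mulr_ge0 ?(ltW (x0 y))// ler_piMr ?(ltW (x0 y))// expx_le1.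
Qed.

Let Ve t : 0 < t -> (\int[P]_w (V w * expR (- V w * t))%:E =
   (c * xexp t)%:E * \int[P]_w (expR (- V w * t))%:E)%E.
Proof.
move=> t0.
have i1 : P.-integrable setT (EFin \o (fun w => V w * expR (- V w * t))).
  apply: (@integrable_bounded _ _ _ P _ _ t^-1) => //; first exact: probability_lty.
    exact: measurable_funM.
  by move=> w _; rewrite ger0_norm ?mulr_ge0// mulr_expRN_le.
have i2 : P.-integrable setT (EFin \o (fun w => expR (- V w * t))).
  apply: (@integrable_bounded _ _ _ P _ _ 1) => //; first exact: probability_lty.
  by move=> w _; rewrite ger0_norm// expV_le1// ltW.
have E1 := fineK (integrable_fin_num measurableT i1).
have E2 := fineK (integrable_fin_num measurableT i2).
by rewrite -E1 -E2 -EFinM; congr EFin; exact: laplace_derivative.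
Qed.

(** The tilt and the [n]-th power combine into an exponential at [s *+ n.+1]; the identity is
    [laplace_derivative] at that point. *)
Let moment n : (\int[pV]_w (expR (- V w * s) ^+ n)%:E =
  \int[px]_z (expR (- (V z.2 + x z.1) * s) ^+ n)%:E)%E.
Proof.
have t0 : 0 < s *+ n.+1 by rewrite pmulrn_lgt0.
have expE v : expR (- v * s) * expR (- v * s) ^+ n = expR (- v * (s *+ n.+1)).
  by rewrite -exprS -expRM_natl mulr_natl mulrnAr.
transitivity (\int[P]_w (V w * expR (- V w * (s *+ n.+1)))%:E)%E.
  rewrite ge0_integral_mdensity//; last first.
    by apply/measurable_EFinP; exact: measurable_funX.
  by apply: eq_integral => w _; rewrite -EFinM mulrC /wV -mulrA expE.
rewrite Ve// (@integral_wx (fun v => expR (- v * s) ^+ n)); last 2 first.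
- apply: measurable_funX.
  apply: (measurableT_comp (continuous_measurable_fun (@continuous_expR R))).
  by apply: measurable_funM => //; exact: measurableT_comp.
- by move=> v; rewrite exprn_ge0.
have Ew y : (\int[P]_w (expR (- V w * s) * expR (- (V w + x y) * s) ^+ n)%:E =
    (expR (- x y * s) ^+ n)%:E * \int[P]_w (expR (- V w * (s *+ n.+1)))%:E)%E.
  rewrite -ge0_integralZl ?lee_fin ?exprn_ge0//; last exact/measurable_EFinP.
  by apply: eq_integral => w _; rewrite -EFinM -expE opprD mulrDl expRD exprMn; congr EFin; ring.
under [RHS]eq_integral do rewrite Ew muleA -EFinM -mulrA -mulrA expE.
rewrite EFinM -muleA -xexpE ?(ltW t0)//.
rewrite [RHS](_ : _ = \int[m]_(y in D) ((c%:E * \int[P]_w (expR (- V w * (s *+ n.+1)))%:E) *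
   (x y * expR (- x y * (s *+ n.+1)))%:E))%E; last first.
  by apply: eq_integral => y _; rewrite EFinM -!muleA; congr (_ * _)%E; rewrite muleC.
rewrite ge0_integralZl//.
- by rewrite -muleA; congr (_ * _)%E; rewrite muleC.
- by apply/measurable_EFinP; apply: measurable_funTS; exact: measurable_funM.
- by move=> y _; rewrite lee_fin mulr_ge0// ltW.
- rewrite mule_ge0 ?lee_fin//; apply: integral_ge0 => w _; by rewrite lee_fin.
Qed.

(** By [moment] and [moments_unique], [expR (- V * s)] has the same law under the size-biased
    measure as [expR (- (V + x) * s)] under the product measure. This is the size-bias identity of
    an infinitely divisible law: biasing by [V] adds an independent jump. *)
Lemma palm_ge0 (phi : R -> R) : measurable_fun setT phi -> (forall v, 0 <= phi v) ->
  (\int[P]_w (V w * expR (- V w * s) * phi (V w))%:E =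
   \int[m]_(y in D) ((c * (x y * expR (- x y * s)))%:E *
     \int[P]_w (expR (- V w * s) * phi (V w + x y))%:E))%E.
Proof.
(* [psi] recovers [v] from [expR (- v * s)], so any [phi] is a function of that exponential. *)
move=> mphi phi0; pose psi (t : R) := - ln t / s.
have psiE v : psi (expR (- v * s)) = v.
  by rewrite /psi expRK mulNr opprK mulfK// gt_eqF.
have mpsi : measurable_fun setT (fun t => (phi (psi t))%:E).
  apply/measurable_EFinP; apply: (measurableT_comp mphi).
  by apply: measurable_funM => //; apply: measurableT_comp => //; exact: measurable_ln.
have m0 : (pV setT < +oo)%E.
  apply: (@le_lt_trans _ _ (\int[P]_w (cst (s^-1)%:E) w)%E).
    apply: ge0_le_integral => //.
    - by move=> w _; rewrite lee_fin.
    - exact/measurable_EFinP.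
    - by move=> w _; rewrite lee_fin mulr_expRN_le.
  rewrite integral_cst//; apply: lte_mul_pinfty; [by rewrite lee_fin invr_ge0 ltW|by []|exact: probability_lty].
have pVx : (px setT = pV setT)%E.
  have : (\int[pV]_w cst 1%:E w = \int[px]_z cst 1%:E z)%E by exact: moment 0.
  by rewrite !integral_cst// !mul1e.
have finV : fin_num_fun pV by apply: lty_fin_num_fun.
have mx0 : (px setT < +oo)%E by rewrite pVx.
have finx : fin_num_fun px by apply: lty_fin_num_fun.
pose fV : {finite_measure set T -> \bar R} :=
  HB.pack (mdensity P wV0 mwV) (Measure_isFinite.Build _ _ _ (mdensity P wV0 mwV) finV).
pose fx : {finite_measure set (Y * T)%type -> \bar R} :=
  HB.pack (mdensity (m \x P)%E wx0 mwx) (Measure_isFinite.Build _ _ _ (mdensity (m \x P)%E wx0 mwx) finx).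
pose e1 w := expR (- V w * s).
pose e2 (z : Y * T) := expR (- (V z.2 + x z.1) * s).
have me1 : measurable_fun setT e1 by exact: (mexpV s).
have me2 : measurable_fun setT e2 by exact: (mVx s).
have uniq A : measurable A -> pV (e1 @^-1` A) = px (e2 @^-1` A).
  apply: (@moments_unique _ _ _ _ _ fV fx e1 e2) => //.
  - by move=> w; rewrite expR_ge0/= expV_le1// ltW.
  - by move=> z; rewrite expR_ge0/= expRN_le1 ?(ltW s0)// addr_ge0// ltW.
pose p1 : {measure set R -> \bar R} := pushforward pV e1.
pose p2 : {measure set R -> \bar R} := pushforward px e2.
transitivity (\int[p1 me1]_t (phi (psi t))%:E)%E.
  rewrite (ge0_integral_image pV me1)//; last by move=> t; rewrite lee_fin.
  rewrite ge0_integral_mdensity//; last 2 first.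
  - by move=> w; rewrite lee_fin.
  - exact: (measurableT_comp mpsi me1).
  by apply: eq_integral => w _; rewrite /e1 psiE -EFinM mulrC.
transitivity (\int[p2 me2]_t (phi (psi t))%:E)%E.
  by apply: eq_measure_integral => A mA _; exact: uniq.
rewrite (ge0_integral_image px me2)//; last by move=> t; rewrite lee_fin.
rewrite -integral_wx//; apply: eq_integral => z _; rewrite /e2 psiE//.
Qed.

Let I1 (phi : R -> R) := \int[P]_w (V w * expR (- V w * s) * phi (V w)).
Let I0 (phi : R -> R) r := \int[P]_w (expR (- V w * s) * phi (V w + r)).
Let I2 (phi : R -> R) := \int[m]_(y in D) (c * (x y * expR (- x y * s)) * I0 phi (x y)).

Let i0 (phi : R -> R) M r : measurable_fun setT phi -> (forall v, `|phi v| <= M) ->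
  P.-integrable setT (EFin \o (fun w => expR (- V w * s) * phi (V w + r))).
Proof.
move=> mphi phiM; apply: (@integrable_bounded _ _ _ P _ _ M) => //.
- exact: probability_lty.
- by apply: measurable_funM => //; apply: (measurableT_comp mphi); exact: measurable_funD.
- move=> w _; rewrite normrM -[leRHS]mul1r ler_pM// ger0_norm//.
  by rewrite expV_le1// ltW.
Qed.

Let i1 (phi : R -> R) M : measurable_fun setT phi -> (forall v, `|phi v| <= M) ->
  P.-integrable setT (EFin \o (fun w => V w * expR (- V w * s) * phi (V w))).
Proof.
move=> mphi phiM; apply: (@integrable_bounded _ _ _ P _ _ (s^-1 * M)) => //.
- exact: probability_lty.
- by apply: measurable_funM; [exact: measurable_funM|exact: (measurableT_comp mphi)].
- move=> w _; rewrite normrM ler_pM// ger0_norm ?mulr_ge0//.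
  by rewrite mulr_expRN_le.
Qed.

Let mI0 (phi : R -> R) : measurable_fun setT phi ->
  measurable_fun setT (fun y => I0 phi (x y)).
Proof.
move=> mphi; apply: (@measurable_Rintegral _ _ _ _ _ P
  (fun z : Y * T => expR (- V z.2 * s) * phi (V z.2 + x z.1))).
apply: measurable_funM; last by apply: (measurableT_comp mphi); exact: measurable_funD.
by apply: (measurableT_comp (mexpV s)); exact: measurable_snd.
Qed.

Let I0_le (phi : R -> R) M r : measurable_fun setT phi -> (forall v, `|phi v| <= M) ->
  `|I0 phi r| <= M.
Proof.
move=> mphi phiM.
have -> : M = M * fine (P setT) by rewrite probability_setT mulr1.
apply: norm_Rintegral_le => //; first exact: probability_lty.
- by apply: measurable_funM => //; apply: (measurableT_comp mphi); exact: measurable_funD.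
- move=> w _; rewrite normrM -[leRHS]mul1r ler_pM// ger0_norm//.
  by rewrite expV_le1// ltW.
Qed.

Let i2 (phi : R -> R) M : measurable_fun setT phi -> (forall v, `|phi v| <= M) ->
  m.-integrable D (EFin \o (fun y => c * (x y * expR (- x y * s)) * I0 phi (x y))).
Proof.
move=> mphi phiM; apply: (@integrable_x _ (c * M)).
  apply: measurable_funM; last exact: mI0.
  by apply: measurable_funM => //; exact: measurable_funM.
move=> y; rewrite normrM mulrAC ler_pM ?(I0_le _ mphi phiM)//.
rewrite ger0_norm ?mulr_ge0 ?(ltW (x0 y))// ler_wpM2l// ler_piMr ?(ltW (x0 y))//.
by rewrite expx_le1// ltW.
Qed.

Let palm_pos (phi : R -> R) M : measurable_fun setT phi ->
  (forall v, 0 <= phi v <= M) -> I1 phi = I2 phi.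
Proof.
move=> mphi phiM.
have phi0 v : 0 <= phi v by have /andP[] := phiM v.
have phiM' v : `|phi v| <= M by rewrite ger0_norm//; have /andP[] := phiM v.
rewrite /I1 /I2 /Rintegral; congr fine; rewrite palm_ge0//.
apply: eq_integral => y _; rewrite [RHS]EFinM; congr (_ * _)%E.
by rewrite /I0 /Rintegral fineK//; exact: integrable_fin_num (i0 _ mphi phiM').
Qed.

(** A signed [phi] is shifted to [phi + 1], which is nonnegative, and the identity for the constant
    1 is subtracted; all terms are integrable thanks to the tilt. *)
Lemma palm_bounded (phi : R -> R) : measurable_fun setT phi ->
  (forall v, `|phi v| <= 1) ->
  \int[P]_w (V w * expR (- V w * s) * phi (V w)) =
  c * \int[m]_(y in D) (x y * expR (- x y * s) *
    \int[P]_w (expR (- V w * s) * phi (V w + x y))).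
Proof.
move=> mphi phi1.
have mphi' : measurable_fun setT (fun v => phi v + 1) by exact: measurable_funD.
have mcst : measurable_fun setT (cst 1 : R -> R) by [].
have cst1 (v : R) : `|cst 1 v| <= 1 :> R by rewrite normr1.
have D1 : I1 (fun v => phi v + 1) = I1 phi + I1 (cst 1).
  rewrite /I1 -RintegralD//.
  - by apply: eq_Rintegral => w _; rewrite mulrDr.
  - exact: i1 phi1.
  - exact: i1 cst1.
have D0 r : I0 (fun v => phi v + 1) r = I0 phi r + I0 (cst 1) r.
  rewrite /I0 -RintegralD//.
  - by apply: eq_Rintegral => w _; rewrite mulrDr.
  - exact: i0 phi1.
  - exact: i0 cst1.
have D2 : I2 (fun v => phi v + 1) = I2 phi + I2 (cst 1).
  rewrite /I2 -RintegralD//.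
  - by apply: eq_Rintegral => y _; rewrite D0 mulrDr.
  - exact: i2 phi1.
  - exact: i2 cst1.
have E1 : I1 (fun v => phi v + 1) = I2 (fun v => phi v + 1).
  apply: (@palm_pos _ (1 + 1)) => // v; have := phi1 v; rewrite ler_norml => /andP[h1 h2].
  by rewrite -lerBlDr sub0r h1 lerD2r h2.
have E2 : I1 (cst 1) = I2 (cst 1).
  by apply: (@palm_pos _ 1) => // v; rewrite ler01 lexx.
have : I1 phi = I2 phi by move: E1; rewrite D1 D2 E2 => /addIr.
rewrite /I1 => ->; rewrite /I2 -RintegralZl//.
  by apply: eq_Rintegral => y _; rewrite -mulrA.
apply: (@integrable_x _ 1).
  by apply: measurable_funM; [exact: measurable_funM|exact: mI0].
move=> y; rewrite normrM mulrC ler_pM ?(I0_le _ mphi phi1)//.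
rewrite ger0_norm ?mulr_ge0 ?(ltW (x0 y))// ler_piMr ?(ltW (x0 y))//.
by rewrite expx_le1// ltW.
Qed.

(** With [laplace_im], the real and imaginary parts of the integral of [1 - exp (- (s + iu) x)]
    against [m], that is, of the Laplace exponent at [s + iu]. *)
Definition laplace_re u : R := \int[m]_(y in D) (1 - expR (- x y * s) * cos (x y * u)).
Definition laplace_im u : R := \int[m]_(y in D) (expR (- x y * s) * sin (x y * u)).

Let mcos u : measurable_fun setT (fun v : R => cos (v * u)).
Proof.
by apply: (measurableT_comp (continuous_measurable_fun (@continuous_cos R))); exact: measurable_funM.
Qed.

Let msin u : measurable_fun setT (fun v : R => sin (v * u)).
Proof.
by apply: (measurableT_comp (continuous_measurable_fun (@continuous_sin R))); exact: measurable_funM.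
Qed.

Let S u : R := \int[m]_(y in D) (x y * expR (- x y * s) * sin (x y * u)).
Let C u : R := \int[m]_(y in D) (x y * expR (- x y * s) * cos (x y * u)).

Let xe_le (y : Y) (f : R) : `|f| <= 1 -> `|x y * expR (- x y * s) * f| <= x y.
Proof.
move=> f1; rewrite normrM -[leRHS]mulr1 ler_pM//.
rewrite ger0_norm ?mulr_ge0 ?(ltW (x0 y))// ler_piMr ?(ltW (x0 y))//.
by rewrite expx_le1// ltW.
Qed.

Let norm_re_le u y : `|1 - expR (- x y * s) * cos (x y * u)| <= (s + `|u|) * x y.
Proof.
have dF (v : R) : is_derive v 1 (fun v => 1 - expR (- s * v) * cos (u * v))
    (expR (- s * v) * (s * cos (u * v) + u * sin (u * v))).
  by apply: is_derive_eq; rewrite /GRing.scale/=; ring.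
have := @lipschitz_bound R _ _ (s + `|u|) (x y) dF.
rewrite !mulr0 expR0 cos0 mulr1 subrr subr0 !mulNr [s * x y]mulrC [u * x y]mulrC.
apply; last exact: ltW.
move=> v v0; rewrite normrM -[leRHS]mul1r ler_pM//.
  by rewrite ger0_norm// expRN_le1// ltW.
rewrite (le_trans (ler_normD _ _))// !normrM (ger0_norm (ltW s0)).
by rewrite lerD// ler_piMr// ?(ltW s0)// ?cos_max ?sin_max.
Qed.

Let norm_im_le u y : `|expR (- x y * s) * sin (x y * u)| <= `|u| * x y.
Proof.
rewrite normrM -[leRHS]mul1r ler_pM//.
  by rewrite ger0_norm// expx_le1// ltW.
by rewrite (le_trans (ler_norm_sin _))// normrM mulrC (ger0_norm (ltW (x0 y))).
Qed.

Let msx u : measurable_fun setT (fun y => sin (x y * u)).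
Proof. exact: (measurableT_comp (msin u)). Qed.
Let mcx u : measurable_fun setT (fun y => cos (x y * u)).
Proof. exact: (measurableT_comp (mcos u)). Qed.

Let around (u : R) : u - 1 < u < u + 1.
Proof. by apply/andP; split; rewrite ?ltrBlDr ltrDl. Qed.

Let d_re (u : R) : is_derive u 1 laplace_re (S u).
Proof.
apply: (@is_derive_Rintegral _ _ _ m D (fun u y => 1 - expR (- x y * s) * cos (x y * u))
  (fun u y => x y * expR (- x y * s) * sin (x y * u)) x u (u - 1) (u + 1)) => //.
- move=> v _; apply: (@integrable_x _ (s + `|v|)) => //.
  by apply: measurable_funB => //; exact: measurable_funM.
- by move=> v y _ _; apply: is_derive_eq; rewrite /GRing.scale/=; ring.
- by move=> y; exact: ltW.
- by move=> v y _ _; apply: xe_le; exact: sin_max.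
Qed.

Let d_im (u : R) : is_derive u 1 laplace_im (C u).
Proof.
apply: (@is_derive_Rintegral _ _ _ m D (fun u y => expR (- x y * s) * sin (x y * u))
  (fun u y => x y * expR (- x y * s) * cos (x y * u)) x u (u - 1) (u + 1)) => //.
- move=> v _; apply: (@integrable_x _ `|v|) => //.
  exact: measurable_funM.
- by move=> v y _ _; apply: is_derive_eq; rewrite /GRing.scale/=; ring.
- by move=> y; exact: ltW.
- by move=> v y _ _; apply: xe_le; exact: cos_max.
Qed.

Let A u : R := \int[P]_w (expR (- V w * s) * cos (V w * u)).
Let B u : R := \int[P]_w (expR (- V w * s) * sin (V w * u)).

Let iA u : P.-integrable setT (EFin \o (fun w => expR (- V w * s) * cos (V w * u))).
Proof. by have := i0 0 (mcos u) (fun v => cos_max _); under eq_fun do rewrite addr0. Qed.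

Let iB u : P.-integrable setT (EFin \o (fun w => expR (- V w * s) * sin (V w * u))).
Proof. by have := i0 0 (msin u) (fun v => sin_max _); under eq_fun do rewrite addr0. Qed.

Let bound_V w : V w * expR (- V w * s) <= s^-1.
Proof. exact: mulr_expRN_le. Qed.

(** The derivative of the cosine brings down a factor [V], which [palm_bounded] with the sine
    removes at the price of a jump [x]. The addition formula for [sin ((V + x) * u)] then separates
    [V] from [x], and the system closes in [A] and [B]. *)
Let d_A (u : R) : is_derive u 1 A (- (c * S u * A u + c * C u * B u)).
Proof.
have -> : - (c * S u * A u + c * C u * B u) =
    \int[P]_w (- (V w * expR (- V w * s) * sin (V w * u))).
  have E := palm_bounded (msin u) (fun v => sin_max _).
  rewrite (_ : (fun w => - _) = fun w => -1 * (V w * expR (- V w * s) * sin (V w * u))); last first.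
    by apply/funext => w; rewrite mulN1r.
  rewrite RintegralZl//; last by apply: (i1 (msin u) (M := 1)) => v; exact: sin_max.
  rewrite mulN1r; congr (- _); rewrite E -!mulrA -mulrDr; congr (c * _).
  rewrite mulrC [C u * _]mulrC /S /C -!RintegralZl//; last 2 first.
  - apply: (@integrable_x _ 1); first by apply: measurable_funM => //; exact: measurable_funM.
    by move=> y; rewrite mul1r xe_le// cos_max.
  - apply: (@integrable_x _ 1); first by apply: measurable_funM => //; exact: measurable_funM.
    by move=> y; rewrite mul1r xe_le// sin_max.
  rewrite -RintegralD//; last 2 first.
  - apply: (@integrable_x _ `|A u|).
      by apply: measurable_funM => //; apply: measurable_funM => //; exact: measurable_funM.
    by move=> y; rewrite normrM ler_wpM2l// xe_le// sin_max.
  - apply: (@integrable_x _ `|B u|).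
      by apply: measurable_funM => //; apply: measurable_funM => //; exact: measurable_funM.
    by move=> y; rewrite normrM ler_wpM2l// xe_le// cos_max.
  apply: eq_Rintegral => y _.
  have -> : \int[P]_w (expR (- V w * s) * sin ((V w + x y) * u)) =
      cos (x y * u) * B u + sin (x y * u) * A u.
    rewrite /A /B -!RintegralZl// -RintegralD//; last 2 first.
    + by have := integrableZl measurableT (cos (x y * u)) (iB u); apply.
    + by have := integrableZl measurableT (sin (x y * u)) (iA u); apply.
    by apply: eq_Rintegral => w _; rewrite mulrDl sinD; ring.
  ring.
apply: (@is_derive_Rintegral _ _ _ P setT (fun u w => expR (- V w * s) * cos (V w * u))
  (fun u w => - (V w * expR (- V w * s) * sin (V w * u))) (cst s^-1) u (u - 1) (u + 1)) => //.
- by move=> v w _ _; apply: is_derive_eq; rewrite /GRing.scale/=; ring.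
- by move=> w /=; rewrite invr_ge0 ltW.
- by apply: integrable_cst_fin => //; exact: probability_lty.
- move=> v w _ _; rewrite normrN normrM -[leRHS]mulr1 ler_pM ?sin_max//.
  by rewrite ger0_norm ?mulr_ge0.
Qed.

Let d_B (u : R) : is_derive u 1 B (c * C u * A u - c * S u * B u).
Proof.
have -> : c * C u * A u - c * S u * B u =
    \int[P]_w (V w * expR (- V w * s) * cos (V w * u)).
  rewrite (palm_bounded (mcos u) (fun v => cos_max _)) -!mulrA -mulrBr; congr (c * _).
  rewrite mulrC [S u * _]mulrC /S /C -!RintegralZl//; last 2 first.
  - apply: (@integrable_x _ 1); first by apply: measurable_funM => //; exact: measurable_funM.
    by move=> y; rewrite mul1r xe_le// sin_max.
  - apply: (@integrable_x _ 1); first by apply: measurable_funM => //; exact: measurable_funM.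
    by move=> y; rewrite mul1r xe_le// cos_max.
  rewrite -RintegralB//; last 2 first.
  - apply: (@integrable_x _ `|A u|).
      by apply: measurable_funM => //; apply: measurable_funM => //; exact: measurable_funM.
    by move=> y; rewrite normrM ler_wpM2l// xe_le// cos_max.
  - apply: (@integrable_x _ `|B u|).
      by apply: measurable_funM => //; apply: measurable_funM => //; exact: measurable_funM.
    by move=> y; rewrite normrM ler_wpM2l// xe_le// sin_max.
  apply: eq_Rintegral => y _.
  have -> : \int[P]_w (expR (- V w * s) * cos ((V w + x y) * u)) =
      cos (x y * u) * A u - sin (x y * u) * B u.
    rewrite /A /B -!RintegralZl// -RintegralB//; last 2 first.
    + by have := integrableZl measurableT (cos (x y * u)) (iA u); apply.
    + by have := integrableZl measurableT (sin (x y * u)) (iB u); apply.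
    by apply: eq_Rintegral => w _; rewrite mulrDl cosD; ring.
  ring.
apply: (@is_derive_Rintegral _ _ _ P setT (fun u w => expR (- V w * s) * sin (V w * u))
  (fun u w => V w * expR (- V w * s) * cos (V w * u)) (cst s^-1) u (u - 1) (u + 1)) => //.
- by move=> v w _ _; apply: is_derive_eq; rewrite /GRing.scale/=; ring.
- by move=> w /=; rewrite invr_ge0 ltW.
- by apply: integrable_cst_fin => //; exact: probability_lty.
- move=> v w _ _; rewrite normrM -[leRHS]mulr1 ler_pM ?cos_max//.
  by rewrite ger0_norm ?mulr_ge0.
Qed.

(** The real and imaginary parts solve the linear system with [rho = c * laplace_re] and
    [theta = c * laplace_im]; the initial value at [u = 0] is [laplace_V] at [s]. *)
Lemma laplace_complex u :
  \int[P]_w (expR (- V w * s) * cos (V w * u)) =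
    expR (- (c * laplace_re u)) * cos (c * laplace_im u) /\
  \int[P]_w (expR (- V w * s) * sin (V w * u)) =
    expR (- (c * laplace_re u)) * sin (c * laplace_im u).
Proof.
apply: (@linear_system_solution _ A B (fun u => c * laplace_re u)
  (fun u => c * laplace_im u) (fun u => c * S u) (fun u => c * C u)) => //.
- by move=> v; have h := d_re v; apply: is_derive_eq; rewrite /GRing.scale/=; ring.
- by move=> v; have h := d_im v; apply: is_derive_eq; rewrite /GRing.scale/=; ring.
- rewrite /A /laplace_re; under eq_Rintegral do rewrite mulr0 cos0 mulr1.
  by rewrite laplace_V//; under [in RHS]eq_Rintegral do rewrite mulr0 cos0 mulr1.
- rewrite /B; under eq_Rintegral do rewrite mulr0 sin0 mulr0.
  by rewrite Rintegral_cst// mul0r.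
- rewrite /laplace_im; under eq_Rintegral do rewrite mulr0 sin0 mulr0.
  by rewrite Rintegral_cst// mul0r mulr0.
Qed.

(** Palm identity for the indicator of [r]: on the right the jump must equal [r - V w], an event of
    measure 0 for each [w]; on the left stands [r * expR (- r * s)] times the probability of the
    atom, and [r > 0]. *)
Lemma no_atom r : (forall v, m (D `&` [set y | x y = v]) = 0%E) -> 0 < r ->
  P [set w | V w = r] = 0%E.
Proof.
move=> m0 r0; pose phi (v : R) : R := \1_[set r] v.
have mphi : measurable_fun setT phi by exact: measurable_indic.
have phi0 v : 0 <= phi v by [].
have mr : measurable [set w | V w = r].
  rewrite (_ : [set w | _] = V @^-1` [set r]); last by apply/seteqP; split.
  by rewrite -[X in measurable X]setTI; exact: mV.
have mphiz : measurable_fun setT (fun z : Y * T => phi (V z.2 + x z.1)).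
  by apply: (measurableT_comp mphi); exact: measurable_funD.
have := palm_ge0 mphi phi0; rewrite -integral_wx// ge0_integral_mdensity//; last 2 first.
- by move=> z; rewrite lee_fin.
- exact/measurable_EFinP.
rewrite fubini_tonelli2//; last 2 first.
- by apply/measurable_EFinP; exact: measurable_funM.
- by move=> z; rewrite lee_fin mulr_ge0.
rewrite [RHS]integral0_eq; last first.
  move=> w _; rewrite /fubini_G/=.
  rewrite (@ae_eq_integral _ _ _ m setT (cst 0%E)) ?integral0//.
  - have mp : measurable_fun setT (fun y : Y => (y, w)) by exact: measurable_pair2.
    apply: emeasurable_funM; apply/measurable_EFinP.
      exact: (measurableT_comp mphiz mp).
    exact: (measurableT_comp mwx mp).
  - exists (D `&` [set y | x y = r - V w]); split => //.
      apply: measurableI => //.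
      rewrite (_ : [set y | _] = x @^-1` [set r - V w]); last by apply/seteqP; split.
      by rewrite -[X in measurable X]setTI; exact: mx.
      exact: m0.
    move=> y /=; apply: contra_notP => h _; rewrite -EFinM; congr EFin.
    rewrite /wx/= /phi !indicE.
    have [yD|yD] := boolP (y \in D); last by rewrite mulr0 mul0r mulr0.
    rewrite memNset ?mul0r// => /= Vx; apply: h; split; first exact/set_mem.
    by rewrite -Vx addrAC subrr add0r.
have -> : (\int[P]_w (V w * expR (- V w * s) * phi (V w))%:E =
   \int[P]_(w in [set w | V w = r]) (cst (r * expR (- r * s))%:E) w)%E.
  rewrite [RHS]integral_mkcond; apply: eq_integral => w _; rewrite patchE /phi indicE.
  case: ifPn => [/set_mem /= ->|/negP Vr]; first by rewrite mem_set// mulr1.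
  by rewrite memNset ?mulr0// => /= h; apply: Vr; rewrite inE.
rewrite integral_cst// => /eqP; rewrite mule_eq0 => /orP[|/eqP//].
by rewrite eqe gt_eqF// mulr_gt0// expR_gt0.
Qed.

End palm.

End infinitely_divisible.

(** * Power-law jumps *)

Section power_intensity.
Context {R : realType}.
Notation mu := (@lebesgue_measure R).
Variables (p : R) (p1 : 1 < p).

Let p0 : 0 < p. Proof. by rewrite (lt_trans _ p1). Qed.

(* Only the values on [1, +oo[ matter; the maximum makes it positive everywhere. *)
Definition power_jump (y : R) : R := Num.max 1 y `^ (- p).

Lemma power_jumpE y : 1 <= y -> power_jump y = y `^ (- p).
Proof. by move=> y1; rewrite /power_jump max_r. Qed.

Lemma power_jump_gt0 y : 0 < power_jump y.
Proof. by rewrite powR_gt0// lt_max ltr01. Qed.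

Lemma power_jump_le1 y : 1 <= y -> power_jump y <= 1.
Proof.
move=> y1; have y0 : 0 < y by rewrite (lt_le_trans _ y1).
rewrite power_jumpE// -ler_ln ?posrE ?powR_gt0// ln_powR ln1 mulNr oppr_le0.
by rewrite mulr_ge0 ?ln_ge0// ltW.
Qed.

Lemma measurable_power_jump : measurable_fun setT power_jump.
Proof.
apply: (measurableT_comp (measurable_powR _)).
exact: measurable_maxr.
Qed.

Lemma cvg_powRN q : 0 < q -> y `^ (- q) @[y --> +oo] --> (0 : R).
Proof.
move=> q0; have lnoo : ln y @[y --> +oo] --> (+oo : set_system R).
  apply/cvgryPge => A; near=> y.
  have yA : expR A <= y by near: y; exact: nbhs_pinfty_ge.
  by rewrite -(expRK A) ler_ln// posrE ?expR_gt0// (lt_le_trans _ yA)// expR_gt0.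
have h := @cvg_comp _ _ _ (@ln R) (fun t => expR (- q * t)) _ _ _ lnoo (cvg_expRN q0).
apply: cvg_trans h; apply: near_eq_cvg; near=> y.
have y0 : 0 < y by near: y; exact: nbhs_pinfty_gt.
by rewrite /= /powR gt_eqF.
Unshelve. all: by end_near. Qed.

Lemma integral_power_jump :
  (\int[mu]_(y in `[1%R, +oo[) (power_jump y)%:E = ((p - 1)^-1)%:E)%E.
Proof.
have q0 : 0 < p - 1 by rewrite subr_gt0.
transitivity (\int[mu]_(y in `[1%R, +oo[) (y `^ (- p))%:E)%E.
  by apply: eq_integral => y; rewrite inE/= in_itv/= andbT => /power_jumpE ->.
have dF (y : R) : 1 <= y -> is_derive y 1 (fun y => - (p - 1)^-1 * y `^ (- (p - 1))) (y `^ (- p)).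
  move=> y1; have y0 : 0 < y by rewrite (lt_le_trans _ y1).
  have h := is_derive1_powR (- (p - 1)) y0; apply: is_derive_eq.
  rewrite /GRing.scale/= (_ : - (p - 1) - 1 = - p); last by ring.
  by field; rewrite gt_eqF.
apply: (etrans (FTC_infinity (l := 0) _ dF _ _)).
- by move=> y _; rewrite powR_ge0.
- move=> y y1; have y0 : 0 < y by rewrite (lt_le_trans _ y1).
  exact: (is_derive_continuous (is_derive1_powR (- p) y0)).
- rewrite -[X in _ --> X](mulr0 (- (p - 1)^-1)); apply: cvgMr; exact: cvg_powRN.
- by rewrite powR1 mulr1 sub0r opprK.
Qed.

Lemma integrable_power_jump : mu.-integrable `[1, +oo[ (EFin \o power_jump).
Proof.
apply/integrableP; split.
  by apply/measurable_EFinP; apply: measurable_funTS; exact: measurable_power_jump.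
apply: (@le_lt_trans _ _ (((p - 1)^-1)%:E)); last exact: ltry.
rewrite -integral_power_jump le_eqVlt; apply/orP; left; apply/eqP.
by apply: eq_integral => y _ /=; rewrite ger0_norm// ltW// power_jump_gt0.
Qed.

Lemma power_jump_ge y r : 1 <= y -> 0 < r -> (r <= power_jump y) = (y <= r `^ (- p^-1)).
Proof.
move=> y1 r0; have y0 : 0 < y by rewrite (lt_le_trans _ y1).
rewrite power_jumpE// -ler_ln ?posrE ?powR_gt0// ln_powR.
rewrite -[RHS]ler_ln ?posrE ?powR_gt0// ln_powR.
by rewrite mulNr lerNr mulNr [p^-1 * _]mulrC -mulNr ler_pdivlMr// mulrC.
Qed.

Lemma power_jump_atom v : mu (`[1, +oo[ `&` [set y | power_jump y = v]) = 0%E.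
Proof.
have [v0|v0] := leP v 0.
  rewrite (_ : _ `&` _ = set0) ?measure0// -subset0 => y [_ /= yv].
  by have := power_jump_gt0 y; rewrite yv ltNge v0.
apply/eqP; rewrite eq_le measure_ge0 andbT.
rewrite -(lebesgue_measure_set1 (v `^ (- p^-1))); apply: le_measure; rewrite ?inE//.
  apply: measurableI => //.
  rewrite (_ : [set y | _] = power_jump @^-1` [set v]); last by apply/seteqP; split.
  by rewrite -[X in measurable X]setTI; exact: measurable_power_jump.
move=> y [/=]; rewrite in_itv/= andbT => y1; have y0 : 0 < y by rewrite (lt_le_trans _ y1).
rewrite power_jumpE// => <-; rewrite -powRrM mulrNN divff ?powRr1 ?ltW//.
by rewrite gt_eqF.
Qed.

Lemma lebesgue_power_jump_ge r : 0 < r <= 1 ->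
  mu (`[1, +oo[ `&` [set y | r <= power_jump y]) = (r `^ (- p^-1) - 1)%:E.
Proof.
move=> /andP[r0 r1].
have rp : 1 <= r `^ (- p^-1).
  by rewrite -(power_jump_ge (lexx 1) r0) power_jumpE// powR1.
rewrite (_ : _ `&` _ = `[1, r `^ (- p^-1)]%classic).
  rewrite lebesgue_measure_itv/= lte_fin; move: rp; rewrite le_eqVlt => /predU1P[<-|->].
    by rewrite ltxx subrr.
  by rewrite EFinB.
apply/seteqP; split => y /=; rewrite !in_itv/= ?andbT.
  by move=> [y1]; rewrite power_jump_ge// y1.
by move=> /andP[y1 yr]; split=> //; rewrite power_jump_ge.
Qed.

(** Indicator of the region below the graph of [power_jump]; integrating it in either variable first
    gives the two sides of the layer-cake formula. *)
Let k (z : R * R) : R := \1_[set z : R * R | z.2 <= power_jump z.1] z.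

Let mkset : measurable [set z : R * R | z.2 <= power_jump z.1].
Proof.
rewrite -[X in measurable X]setTI; apply: measurable_fun_le => //.
by apply: (measurableT_comp measurable_power_jump); exact: measurable_fst.
Qed.

Let mk : measurable_fun setT k.
Proof. exact: measurable_indic. Qed.

Let k_le1 z : `|k z| <= 1. Proof. by rewrite /k indicE normr_nat lern1 leq_b1. Qed.

Let integral_k y : 1 <= y -> (\int[mu]_(r in `]0%R, 1%R]) (k (y, r))%:E = (power_jump y)%:E)%E.
Proof.
move=> y1; have x1 := power_jump_le1 y1.
rewrite (_ : (fun r => _) = (fun r => (\1_`]-oo, power_jump y] r)%:E)); last first.
  by apply/funext => r; rewrite /k !indicE; congr (_%:R%:E); apply/idP/idP; rewrite !inE/= in_itv.
rewrite integral_indic// setIC (_ : _ `&` _ = `]0, power_jump y]%classic).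
  transitivity (mu `]0, power_jump y]) => //.
  by rewrite lebesgue_measure_itv/= lte_fin power_jump_gt0 oppr0 adde0.
apply/seteqP; split => r /=; rewrite !in_itv/=; first by move=> [/andP[-> _] ->].
by move=> /andP[-> rx]; rewrite (le_trans rx).
Qed.

Let integral_k2 r : 0 < r <= 1 ->
  (\int[mu]_(y in `[1%R, +oo[) (k (y, r))%:E = (r `^ (- p^-1) - 1)%:E)%E.
Proof.
move=> r01; rewrite -lebesgue_power_jump_ge// setIC.
rewrite (_ : (fun y => _) = (fun y => (\1_[set y | r <= power_jump y] y)%:E)); last first.
  by apply/funext => y; rewrite /k !indicE; congr (_%:R%:E); apply/idP/idP; rewrite !inE.
rewrite integral_indic//.
rewrite -[X in measurable X]setTI; apply: measurable_fun_le => //.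
exact: measurable_power_jump.
Qed.

Lemma integrable_powRN01 : mu.-integrable `]0, 1] (EFin \o (fun r => r `^ (- p^-1))).
Proof.
have i1 : mu.-integrable `]0, 1] (EFin \o (fun r => r `^ (- p^-1) - 1)).
  apply/integrableP; split.
    apply/measurable_EFinP; apply: measurable_funTS.
    by apply: measurable_funB => //; exact: measurable_powR.
  apply: (@le_lt_trans _ _ (((p - 1)^-1)%:E)); last exact: ltry.
  rewrite -integral_power_jump le_eqVlt; apply/orP; left; apply/eqP.
  transitivity (\int[mu]_(r in `]0%R, 1%R]) \int[mu]_(y in `[1%R, +oo[) (k (y, r))%:E)%E.
    apply: eq_integral => r; rewrite inE/= in_itv/= => r01; rewrite integral_k2//= ger0_norm//.
    rewrite -lee_fin -integral_k2//; apply: integral_ge0 => y _; rewrite lee_fin//.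
  transitivity (\int[mu]_(y in `[1%R, +oo[) \int[mu]_(r in `]0%R, 1%R]) (k (y, r))%:E)%E; last first.
    by apply: eq_integral => y; rewrite inE/= in_itv/= andbT => /integral_k ->.
  pose K (z : R * R) : \bar R := (k z * (\1_`[1, +oo[ z.1 * \1_`]0, 1] z.2))%:E.
  have mK : measurable_fun setT K.
    apply/measurable_EFinP; apply: measurable_funM => //; apply: measurable_funM.
      by apply: measurableT_comp; [exact: measurable_indic|exact: measurable_fst].
    by apply: measurableT_comp; [exact: measurable_indic|exact: measurable_snd].
  have K0 z : (0 <= K z)%E by rewrite lee_fin !mulr_ge0.
  transitivity (\int[mu]_r \int[mu]_y K (y, r))%E.
    rewrite integral_mkcond; apply: eq_integral => r _; rewrite patchE.
    case: ifPn => rD.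
      rewrite integral_mkcond; apply: eq_integral => y _; rewrite patchE /K/= !indicE rD mulr1.
      by case: ifPn => _; rewrite ?mulr1 ?mulr0.
    by rewrite integral0_eq// => y _; rewrite /K/= [\1_`]0, 1] _]indicE (negbTE rD) !mulr0.
  apply: etrans (esym (@fubini_tonelli _ _ _ _ _ mu mu K mK K0)) _; rewrite /fubini_F.
  rewrite [RHS]integral_mkcond; apply: eq_integral => y _; rewrite patchE.
  case: ifPn => yD.
    rewrite [RHS]integral_mkcond; apply: eq_integral => r _; rewrite patchE /K/= !indicE yD mul1r.
    by case: ifPn => _; rewrite ?mulr1 ?mulr0.
  by rewrite integral0_eq// => r _; rewrite /K/= [\1_`[1, +oo[ _]indicE (negbTE yD) mul0r mulr0.
have i2 : mu.-integrable `]0, 1] (EFin \o (cst 1 : R -> R)).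
  by apply: integrable_cst_fin => //; exact: itv0M_fin.
have := integrableD _ i1 i2; rewrite (_ : (_ \+ _)%E = EFin \o (fun r => r `^ (- p^-1))).
  by apply.
by apply/funext => r /=; rewrite -EFinD subrK.
Qed.

(* Layer-cake formula: the jumps [>= r] have measure [r `^ (- p^-1) - 1]. *)
Lemma integral_power_jump_derivative (F f : R -> R) (M : R) : F 0 = 0 ->
  (forall r : R, is_derive r 1 F (f r)) -> continuous f ->
  (forall r, 0 <= r -> `|f r| <= M) ->
  \int[mu]_(y in `[1, +oo[) F (power_jump y) =
  \int[mu]_(r in `]0, 1]) (r `^ (- p^-1) * f r) - F 1.
Proof.
move=> F0 dF cf fM.
have mf : measurable_fun setT f by exact: continuous_measurable_fun.
have if1 : mu.-integrable `]0, 1] (EFin \o f).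
  apply: (@integrable_bounded _ _ _ mu _ _ M) => //; first exact: itv0M_fin.
    exact: measurable_funTS.
  by move=> r; rewrite /= in_itv/= => /andP[r0 _]; apply: fM; exact: ltW.
have ifr : mu.-integrable `]0, 1] (EFin \o (fun r => r `^ (- p^-1) * f r)).
  apply: (@integrable_dominated _ _ _ mu _ _ (fun r => M * r `^ (- p^-1))) => //.
  - by have := integrableZl _ M integrable_powRN01; apply.
  - by apply: measurable_funTS; apply: measurable_funM => //; exact: measurable_powR.
  - move=> r; rewrite /= in_itv/= => /andP[r0 _].
    by rewrite normrM ger0_norm ?powR_ge0// mulrC ler_wpM2r ?powR_ge0// fM// ltW.
have F1 a : 0 <= a -> \int[mu]_(r in `]0, a]) f r = F a.
  move=> a0; rewrite Rintegral_itv_obnd_cbnd ?(FTC a0 dF cf) ?F0 ?subr0//.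
  apply: (@integrable_bounded _ _ _ mu _ _ M) => //; first exact: itv0M_fin.
    exact: measurable_funTS.
  by move=> r; rewrite /= in_itv/= => /andP[r0 _]; apply: fM; exact: ltW.
transitivity (\int[mu]_(y in `[1, +oo[) \int[mu]_(r in `]0, 1]) (f r * k (y, r))).
  apply: eq_Rintegral => y; rewrite inE/= in_itv/= andbT => y1.
  rewrite -(F1 _ (ltW (power_jump_gt0 y))) [LHS]Rintegral_mkcond [RHS]Rintegral_mkcond.
  apply: eq_Rintegral => r _; rewrite !patchE /k indicE.
  have x1 := power_jump_le1 y1.
  case: ifPn => ry; case: ifPn => r1.
  - rewrite mem_set ?mulr1//; move: ry; rewrite inE/= in_itv/= => /andP[_ rx].
    exact: rx.
  - move: ry r1; rewrite inE notin_setE/= !in_itv/= => /andP[-> rx] /negP.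
    by rewrite (le_trans rx).
  - rewrite memNset ?mulr0// => /= rx; move: ry r1.
    by rewrite inE notin_setE/= !in_itv/= rx => /negP + /andP[r0]; rewrite r0.
  - by [].
apply: etrans (@Rintegral_fubini _ _ _ _ _ mu mu `[1, +oo[ `]0, 1]
    (fun z => f z.2 * k z) _ _ _ _) _ => //.
- by apply: measurable_funM => //; apply: (measurableT_comp mf); exact: measurable_snd.
(* Absolute integrability: for each [y] the inner integral is at most [M * power_jump y], and the
   jumps are integrable. *)
- apply: (@le_lt_trans _ _ (\int[mu]_(y in `[1%R, +oo[) (M%:E * (power_jump y)%:E))%E).
    apply: ge0_le_integral => //.
    + by move=> y _; apply: integral_ge0 => r _; rewrite lee_fin.
    + apply: measurable_funTS.
      rewrite (_ : (fun y => _) = fun y => \int[mu]_r (`|f r * k (y, r)| * \1_`]0, 1] r)%:E)%E; last first.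
        apply/funext => y; rewrite integral_mkcond; apply: eq_integral => r _.
        by rewrite patchE indicE; case: ifPn => _; rewrite ?mulr1 ?mulr0.
      pose h (z : R * R) : \bar R := (`|f z.2 * k z| * \1_`]0, 1] z.2)%:E.
      have mh : measurable_fun setT h.
        apply/measurable_EFinP; apply: measurable_funM.
          apply: measurableT_comp => //; apply: measurable_funM => //.
          by apply: (measurableT_comp mf); exact: measurable_snd.
        by apply: measurableT_comp; [exact: measurable_indic|exact: measurable_snd].
      have h0 z : (0 <= h z)%E by rewrite lee_fin mulr_ge0.
      exact: (@measurable_fun_fubini_tonelli_F _ _ _ _ _ mu h mh h0).
    + apply: measurable_funTS; apply: measurable_funeM.
      by apply/measurable_EFinP; exact: measurable_power_jump.
    + move=> y; rewrite /= in_itv/= andbT => y1; rewrite -integral_k// -ge0_integralZl//; last 3 first.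
      * apply/measurable_EFinP; apply: measurable_funTS; apply: (measurableT_comp mk).
        exact: measurable_pair1.
      * by move=> r _; rewrite lee_fin.
      * by rewrite lee_fin (le_trans _ (fM 0 (lexx 0))).
      apply: ge0_le_integral => //.
      * apply/measurable_EFinP; apply: measurable_funTS; apply: measurableT_comp => //.
        by apply: measurable_funM => //; apply: (measurableT_comp mk); exact: measurable_pair1.
      * apply: measurable_funTS; apply: measurable_funeM.
        by apply/measurable_EFinP; apply: (measurableT_comp mk); exact: measurable_pair1.
      * move=> r; rewrite /= in_itv/= -EFinM lee_fin normrM => /andP[r0 _].
        by rewrite [X in _ * X]ger0_norm// ler_wpM2r// fM// ltW.
  rewrite ge0_integralZl//; last 3 first.
  - by apply/measurable_EFinP; apply: measurable_funTS; exact: measurable_power_jump.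
  - by move=> y _; rewrite lee_fin ltW// power_jump_gt0.
  - by rewrite lee_fin (le_trans _ (fM 0 (lexx 0))).
  by rewrite integral_power_jump -EFinM ltry.
(* The [- 1] in the measure of the jumps [>= r], integrated against [f] over ]0, 1], produces
   [- F 1]. *)
- rewrite -(F1 1 ler01) -RintegralB//; apply: eq_Rintegral => r.
  rewrite inE/= in_itv/= => r01.
  have ik : mu.-integrable `[1, +oo[ (EFin \o (fun y => k (y, r))).
    apply/integrableP; split.
      apply/measurable_EFinP; apply: measurable_funTS; apply: (measurableT_comp mk).
      exact: measurable_pair2.
    apply: (@le_lt_trans _ _ ((r `^ (- p^-1) - 1)%:E)); last exact: ltry.
    rewrite -integral_k2// le_eqVlt; apply/orP; left; apply/eqP.
    by apply: eq_integral => y _ /=; rewrite ger0_norm.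
  rewrite RintegralZl//.
  by rewrite {1}/Rintegral integral_k2//=; ring.
Qed.

End power_intensity.

(** * The function phi_beta *)

Section complex_laplace.
Context {R : realType}.
Notation mu := (@lebesgue_measure R).
Local Open Scope complex_scope.
Implicit Types (g u r q : R).

Lemma complex_eqP (z z' : R[i]) : complex.Re z = complex.Re z' ->
  complex.Im z = complex.Im z' -> z = z'.
Proof. by case: z z' => a b [a' b'] /= -> ->. Qed.

Lemma Re_mulc (z z' : R[i]) : complex.Re (z * z') =
  complex.Re z * complex.Re z' - complex.Im z * complex.Im z'.
Proof. by case: z z' => a b [a' b']. Qed.

Lemma Im_mulc (z z' : R[i]) : complex.Im (z * z') =
  complex.Re z * complex.Im z' + complex.Im z * complex.Re z'.
Proof. by case: z z' => a b [a' b']. Qed.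

Lemma Re_cexp (z : R[i]) : complex.Re (cexp z) = expR (complex.Re z) * cos (complex.Im z).
Proof. by rewrite /cexp Re_mulc/= mul0r subr0. Qed.

Lemma Im_cexp (z : R[i]) : complex.Im (cexp z) = expR (complex.Re z) * sin (complex.Im z).
Proof. by rewrite /cexp Im_mulc/= mul0r addr0. Qed.

Lemma cexpD (z z' : R[i]) : cexp (z + z') = cexp z * cexp z'.
Proof.
apply: complex_eqP; rewrite ?Re_mulc ?Im_mulc ?Re_cexp ?Im_cexp; case: z z' => a b [a' b'] /=.
  by rewrite expRD cosD; ring.
by rewrite expRD sinD; ring.
Qed.

Lemma cpowD (z : R[i]) (q q' : R) : cpow z (q + q') = cpow z q * cpow z q'.
Proof.
rewrite /cpow -cexpD; congr cexp.
by case: (clog z) => a b; apply: complex_eqP => /=; ring.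
Qed.

Lemma cpow0 (z : R[i]) : cpow z 0 = 1.
Proof.
case: (clog z) (erefl (cpow z 0)) => a b _; rewrite /cpow.
apply: complex_eqP; rewrite ?Re_cexp ?Im_cexp/= !mul0r ?subr0 ?addr0 expR0.
  by rewrite cos0 mulr1.
by rewrite sin0 mulr0.
Qed.

Lemma clog_scale r g u : 0 < r -> 0 < g ->
  clog (r%:C * (g +i* u)) = (ln r)%:C + clog (g +i* u).
Proof.
move=> r0 g0.
have zr : r%:C * (g +i* u) = (r * g) +i* (r * u).
  by apply: complex_eqP; rewrite /= ?mul0r ?subr0 ?addr0.
have n0 : 0 < Num.sqrt (g ^+ 2 + u ^+ 2) by rewrite sqrtr_gt0 ltr_pwDl ?exprn_gt0 ?sqr_ge0.
have nE : Num.sqrt ((r * g) ^+ 2 + (r * u) ^+ 2) = r * Num.sqrt (g ^+ 2 + u ^+ 2).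
  by rewrite !exprMn -mulrDr sqrtrM ?sqr_ge0// sqrtr_sqr ger0_norm// ltW.
rewrite zr /clog /carg/= nE; apply: complex_eqP => /=.
  by rewrite lnM ?posrE.
rewrite add0r pmulr_rge0// invfM mulrACA divff ?mul1r// gt_eqF//.
Qed.

(** A positive factor does not change the argument, so along the segment from 0 to [z] the branch is
    constant and only the real power of [r] varies. *)
Lemma cpow_scale r g u q : 0 < r -> 0 < g ->
  cpow (r%:C * (g +i* u)) q = (r `^ q)%:C * cpow (g +i* u) q.
Proof.
move=> r0 g0; rewrite /cpow clog_scale// mulrDr cexpD; congr (_ * _).
by apply: complex_eqP; rewrite ?Re_cexp ?Im_cexp/= !mul0r !mulr0 subr0 addr0 ?cos0 ?sin0 ?mulr1 ?mulr0// /powR gt_eqF.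
Qed.

Variables (p : R) (p1 : 1 < p).

Let delta := p^-1.
Let Ic g u := \int[mu]_(r in `]0, 1]) (r `^ (- delta) * (expR (- g * r) * cos (u * r))).
Let Is g u := \int[mu]_(r in `]0, 1]) (r `^ (- delta) * (expR (- g * r) * sin (u * r))).

Let integrable_w (f : R -> R) : measurable_fun setT f -> (forall r, 0 <= r -> `|f r| <= 1) ->
  mu.-integrable `]0, 1] (EFin \o (fun r => r `^ (- delta) * f r)).
Proof.
move=> mf f1; apply: (@integrable_dominated _ _ _ mu _ _ (fun r => r `^ (- delta))) => //.
- exact: integrable_powRN01.
- by apply: measurable_funTS; apply: measurable_funM => //; exact: measurable_powR.
- move=> r; rewrite /= in_itv/= => /andP[r0 _]; rewrite normrM ger0_norm ?powR_ge0//.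
  by rewrite ler_piMr ?powR_ge0// f1// ltW.
Qed.

Let me_cos g u : measurable_fun setT (fun r => expR (- g * r) * cos (u * r)).
Proof.
apply: measurable_funM; apply: continuous_measurable_fun => r.
  exact: (is_derive_continuous (is_derive_expRZ (- g) r)).
exact: (is_derive_continuous (is_derive_cosZ u r)).
Qed.

Let me_sin g u : measurable_fun setT (fun r => expR (- g * r) * sin (u * r)).
Proof.
apply: measurable_funM; apply: continuous_measurable_fun => r.
  exact: (is_derive_continuous (is_derive_expRZ (- g) r)).
exact: (is_derive_continuous (is_derive_sinZ u r)).
Qed.

Let ec_le1 g u r : 0 < g -> 0 <= r -> `|expR (- g * r) * cos (u * r)| <= 1.
Proof.
move=> g0 r0; rewrite normrM -[leRHS]mulr1 ler_pM ?cos_max// ger0_norm//.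
by rewrite expRN_le1// ltW.
Qed.

Let es_le1 g u r : 0 < g -> 0 <= r -> `|expR (- g * r) * sin (u * r)| <= 1.
Proof.
move=> g0 r0; rewrite normrM -[leRHS]mulr1 ler_pM ?sin_max// ger0_norm//.
by rewrite expRN_le1// ltW.
Qed.

(** Along the segment the factor [cpow z (- delta)] comes out of the integral and cancels
    [cpow z delta]; the factor [z] of the parametrization remains. The endpoint [r = 0], where the
    power is meaningless, is dropped as a null set. *)
Lemma segment_integralE g u : 0 < g ->
  cpow (g +i* u) delta *
    segment_integral (fun t => cpow t (- delta) * cexp (- t)) (g +i* u) =
  (g +i* u) * (Ic g u +i* - Is g u).
Proof.
move=> g0; set z := g +i* u; rewrite /segment_integral.
have ic := integrable_w (me_cos g u) (fun r => @ec_le1 g u r g0).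
have is_ := integrable_w (me_sin g u) (fun r => @es_le1 g u r g0).
set w := cpow z (- delta).
have gE r : 0 < r -> cpow (r%:C * z) (- delta) * cexp (- (r%:C * z)) =
    w * ((r `^ (- delta) * (expR (- g * r) * cos (u * r))) +i*
         - (r `^ (- delta) * (expR (- g * r) * sin (u * r)))).
  have e1 : r * g - 0 * u = g * r by ring.
  have e2 : r * u + 0 * g = u * r by ring.
  move=> r0; rewrite cpow_scale// mulrAC mulrC; congr (_ * _).
  apply: complex_eqP; rewrite ?Re_mulc ?Im_mulc ?Re_cexp ?Im_cexp/=.
    by rewrite e1 e2 cosN -mulNr; ring.
  by rewrite e1 e2 sinN -mulNr; ring.
have intl (h : R -> R) (b c : R) : (forall r, 0 < r -> h r =
     b * (r `^ (- delta) * (expR (- g * r) * cos (u * r))) +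
     c * (r `^ (- delta) * (expR (- g * r) * sin (u * r)))) ->
   \int[mu]_(r in `[0, 1]) h r = b * Ic g u + c * Is g u.
  move=> hE.
  have ib := integrableZl (measurable_itv _ : measurable (`]0%R, 1%R]%classic : set (measurableTypeR R))) b ic.
  have icc := integrableZl (measurable_itv _ : measurable (`]0%R, 1%R]%classic : set (measurableTypeR R))) c is_.
  have ih : mu.-integrable `]0, 1] (EFin \o h).
    have := integrableD _ ib icc; move=> /(_ (measurable_itv _)); apply: eq_integrable => //.
    by move=> r; rewrite inE/= in_itv/= => /andP[r0 _]; rewrite /= hE.
  rewrite -Rintegral_itv_obnd_cbnd// /Ic /Is -!RintegralZl// -RintegralD//.
  by apply: eq_Rintegral => r; rewrite inE/= in_itv/= => /andP[r0 _]; rewrite hE.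
rewrite (intl _ (complex.Re w) (complex.Im w)); last first.
  by move=> r r0; rewrite gE// Re_mulc/=; ring.
rewrite (intl _ (complex.Im w) (- complex.Re w)); last first.
  by move=> r r0; rewrite gE// Im_mulc/=; ring.
have -> : (complex.Re w * Ic g u + complex.Im w * Is g u) +i*
    (complex.Im w * Ic g u + - complex.Re w * Is g u) = w * (Ic g u +i* - Is g u).
  by apply: complex_eqP; rewrite ?Re_mulc ?Im_mulc/=; ring.
rewrite mulrCA; congr (_ * _); rewrite mulrA -cpowD subrr cpow0 mul1r//.
Qed.

Let D : set R := `[1, +oo[.

(** Layer cake for [F r = 1 - expR (- g * r) * cos (u * r)]: the derivative of [F] yields the
    combination of [Ic] and [Is], and [F 1] the last term. *)
Let reE g u : 0 < g -> laplace_re mu D (power_jump p) g u =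
  g * Ic g u + u * Is g u - (1 - expR (- g) * cos u).
Proof.
move=> g0.
have dF (r : R) : is_derive r 1 (fun r => 1 - expR (- g * r) * cos (u * r))
    (g * (expR (- g * r) * cos (u * r)) + u * (expR (- g * r) * sin (u * r))).
  by apply: is_derive_eq; rewrite /GRing.scale/=; ring.
have cf : continuous (fun r => g * (expR (- g * r) * cos (u * r)) + u * (expR (- g * r) * sin (u * r))).
  have ce (r : R) := is_derive_continuous (is_derive_expRZ (- g) r).
  have cc (r : R) := is_derive_continuous (is_derive_cosZ u r).
  have cs (r : R) := is_derive_continuous (is_derive_sinZ u r).
  move=> r; apply: cvgD; apply: cvgM; try exact: cvg_cst.
    by apply: cvgM; [exact: ce|exact: cc].
  by apply: cvgM; [exact: ce|exact: cs].
have fM r : 0 <= r -> `|g * (expR (- g * r) * cos (u * r)) + u * (expR (- g * r) * sin (u * r))| <= g + `|u|.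
  move=> r0; rewrite (le_trans (ler_normD _ _))// normrM [X in _ + X]normrM (ger0_norm (ltW g0)).
  by rewrite lerD// ler_piMr ?(ltW g0)// ?ec_le1 ?es_le1.
have F0 : 1 - expR (- g * 0) * cos (u * 0) = 0 :> R.
  by rewrite !mulr0 expR0 cos0 mulr1 subrr.
have := integral_power_jump_derivative p1 F0 dF cf fM; rewrite !mulr1 => E.
rewrite /laplace_re.
transitivity (\int[mu]_(y in D) (1 - expR (- g * power_jump p y) * cos (u * power_jump p y))).
  apply: eq_Rintegral.
  by move=> y _; rewrite !mulNr ![power_jump p y * _]mulrC.
rewrite E; congr (_ - _); rewrite /Ic /Is -!RintegralZl//; last 2 first.
- exact: integrable_w (me_sin g u) (fun r => @es_le1 g u r g0).
- exact: integrable_w (me_cos g u) (fun r => @ec_le1 g u r g0).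
rewrite -RintegralD//; last 2 first.
- by have := integrableZl _ g (integrable_w (me_cos g u) (fun r => @ec_le1 g u r g0)); apply.
- by have := integrableZl _ u (integrable_w (me_sin g u) (fun r => @es_le1 g u r g0)); apply.
by apply: eq_Rintegral => r _; ring.
Qed.

Let imE g u : 0 < g -> laplace_im mu D (power_jump p) g u =
  u * Ic g u - g * Is g u - expR (- g) * sin u.
Proof.
move=> g0.
have dF (r : R) : is_derive r 1 (fun r => expR (- g * r) * sin (u * r))
    (u * (expR (- g * r) * cos (u * r)) - g * (expR (- g * r) * sin (u * r))).
  by apply: is_derive_eq; rewrite /GRing.scale/=; ring.
have cf : continuous (fun r => u * (expR (- g * r) * cos (u * r)) - g * (expR (- g * r) * sin (u * r))).
  have ce (r : R) := is_derive_continuous (is_derive_expRZ (- g) r).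
  have cc (r : R) := is_derive_continuous (is_derive_cosZ u r).
  have cs (r : R) := is_derive_continuous (is_derive_sinZ u r).
  move=> r; apply: cvgB; apply: cvgM; try exact: cvg_cst.
    by apply: cvgM; [exact: ce|exact: cc].
  by apply: cvgM; [exact: ce|exact: cs].
have fM r : 0 <= r -> `|u * (expR (- g * r) * cos (u * r)) - g * (expR (- g * r) * sin (u * r))| <= `|u| + g.
  move=> r0; rewrite (le_trans (ler_normB _ _))// normrM [X in _ + X]normrM (ger0_norm (ltW g0)).
  by rewrite lerD// ler_piMr ?(ltW g0)// ?ec_le1 ?es_le1.
have F0 : expR (- g * 0) * sin (u * 0) = 0 :> R.
  by rewrite !mulr0 sin0 mulr0.
have := integral_power_jump_derivative p1 F0 dF cf fM; rewrite !mulr1 => E.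
rewrite /laplace_im.
transitivity (\int[mu]_(y in D) (expR (- g * power_jump p y) * sin (u * power_jump p y))).
  apply: eq_Rintegral.
  by move=> y _; rewrite !mulNr ![power_jump p y * _]mulrC.
rewrite E; congr (_ - _); rewrite /Ic /Is -!RintegralZl//; last 2 first.
- exact: integrable_w (me_sin g u) (fun r => @es_le1 g u r g0).
- exact: integrable_w (me_cos g u) (fun r => @ec_le1 g u r g0).
rewrite -RintegralB//; last 2 first.
- by have := integrableZl _ u (integrable_w (me_cos g u) (fun r => @ec_le1 g u r g0)); apply.
- by have := integrableZl _ g (integrable_w (me_sin g u) (fun r => @es_le1 g u r g0)); apply.
by apply: eq_Rintegral => r _; ring.
Qed.

Lemma phiE beta g u : beta = 2 * p -> 0 < g -> phi beta (g +i* u) - 1 =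
  laplace_re mu D (power_jump p) g u +i* laplace_im mu D (power_jump p) g u.
Proof.
move=> betaE g0; have dE : 2 / beta = delta.
  by rewrite betaE /delta; field; rewrite gt_eqF// (lt_trans _ p1).
rewrite /phi dE segment_integralE// reE// imE//.
have -> : cexp (- (g +i* u)) = (expR (- g) * cos u) +i* - (expR (- g) * sin u).
  by apply: complex_eqP; rewrite ?Re_cexp ?Im_cexp/= ?cosN// sinN mulrN.
by apply: complex_eqP => /=; ring.
Qed.

(** Separates real and imaginary parts after [phiE]; the result has the shape of [damped_cosine]
    with the exponential cosine and sine replaced by their means. *)
Lemma Re_Lbar a beta s g u : beta = 2 * p -> 0 < g ->
  let c := a * s `^ (2 / beta) in
  let E := expR (- (c * laplace_re mu D (power_jump p) g u)) in
  let t := c * laplace_im mu D (power_jump p) g u in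
  complex.Re (Lbar a beta s (g +i* u)) =
  (g + u * (E * sin t) - g * (E * cos t)) / (g ^+ 2 + u ^+ 2).
Proof.
move=> betaE g0 c E t; rewrite /Lbar phiE//.
set w := cexp _; have -> : w = (E * cos t) +i* - (E * sin t).
  rewrite /w; apply: complex_eqP; rewrite ?Re_cexp ?Im_cexp/= !mul0r !mulr0 !subr0 !addr0 /E /t /c.
    by rewrite cosN; congr (expR _ * cos _); ring.
  by rewrite sinN mulrN; congr (- (expR _ * sin _)); ring.
rewrite (_ : (1 : R[i]) / (g +i* u) = (g / (g ^+ 2 + u ^+ 2)) +i* - (u / (g ^+ 2 + u ^+ 2))); last first.
  by apply: complex_eqP; rewrite /= ?mul1r ?mul0r ?subr0 ?addr0.
rewrite /=; have q0 : 0 < g ^+ 2 + u ^+ 2 by rewrite ltr_pwDl ?exprn_gt0 ?sqr_ge0.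
by field; rewrite gt_eqF.
Qed.

End complex_laplace.

(** * Inversion formula for power-law jumps *)

Section conditional_inversion.
Context {R : realType} {d} {T : measurableType d} (P : probability T R).
Notation mu := (@lebesgue_measure R).
Local Open Scope complex_scope.

Lemma interference_inversion (a beta s g y : R) (V : T -> R) :
  2 < beta -> 0 <= a * s `^ (2 / beta) -> measurable_fun setT V -> (forall w, 0 <= V w) ->
  (forall t, 0 < t -> \int[P]_w expR (- V w * t) = expR (- (a * s `^ (2 / beta) *
     \int[mu]_(x in `[1, +oo[) (1 - expR (- power_jump (beta / 2) x * t))))) ->
  0 < y -> 0 < g ->
  exists2 I : R,
    improper_integral
      (fun u => complex.Re (Lbar a beta s (g +i* u)) * cos (u * y)) I &
    P [set w | V w < y] = (1 - 2 * expR (g * y) / pi * I)%:E.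
Proof.
move=> beta2 c0 mV V0 LV y0 g0.
have p1 : 1 < beta / 2 by rewrite ltr_pdivlMr// mul1r.
have betaE : beta = 2 * (beta / 2) by field.
have mx : measurable_fun setT (power_jump (beta / 2)) by exact: measurable_power_jump.
have ix := integrable_power_jump p1.
have atom : P [set w | V w = y] = 0%E.
  apply: (no_atom (m := mu) _ mx _ ix mV V0 c0 LV ltr01 _ y0) => //.
  - by move=> x; exact: power_jump_gt0.
  - by move=> v; exact: power_jump_atom.
have [I hI PI] := laplace_inversion mV V0 g0 y0 atom.
exists I => //; apply: cvg_trans hI; apply: near_eq_cvg; apply: nearW => M.
apply: eq_Rintegral => u _; congr (_ * _).
have [] := laplace_complex (m := mu) _ mx _ ix mV V0 c0 LV g0 u => //.
  by move=> x; exact: power_jump_gt0.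
move=> EA EB; rewrite (Re_Lbar p1 a s u betaE g0) -EA -EB.
have q0 : 0 < g ^+ 2 + u ^+ 2 by rewrite ltr_pwDl ?exprn_gt0 ?sqr_ge0.
have mE : measurable_fun setT (fun w => expR (- V w * g)).
  apply: (measurableT_comp (continuous_measurable_fun (@continuous_expR R))).
  by apply: measurable_funM => //; exact: measurableT_comp.
have mVu : measurable_fun setT (fun w => V w * u) by exact: measurable_funM.
have E1 w : `|expR (- V w * g)| <= 1 by rewrite ger0_norm// expRN_le1// ltW.
have iA : P.-integrable setT (EFin \o (fun w => expR (- V w * g) * cos (V w * u))).
  apply: (@integrable_bounded _ _ _ P _ _ 1) => //; first exact: probability_lty.
    apply: measurable_funM => //.
    exact: (measurableT_comp (continuous_measurable_fun (@continuous_cos R))).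
  by move=> w _; rewrite normrM -[leRHS]mulr1 ler_pM ?cos_max.
have iB : P.-integrable setT (EFin \o (fun w => expR (- V w * g) * sin (V w * u))).
  apply: (@integrable_bounded _ _ _ P _ _ 1) => //; first exact: probability_lty.
    apply: measurable_funM => //.
    exact: (measurableT_comp (continuous_measurable_fun (@continuous_sin R))).
  by move=> w _; rewrite normrM -[leRHS]mulr1 ler_pM ?sin_max.
set q := g ^+ 2 + u ^+ 2.
have iA' := integrableZl measurableT (- g / q) iA.
have iB' := integrableZl measurableT (u / q) iB.
have iAB := integrableD measurableT iB' iA'.
transitivity (\int[P]_w (g / q + (u / q * (expR (- V w * g) * sin (V w * u)) +
    - g / q * (expR (- V w * g) * cos (V w * u))))).
  apply: eq_Rintegral => w _; rewrite /damped_cosine -/q.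
  by rewrite (_ : - g * V w = - V w * g) ?[u * V w]mulrC; [ring|ring].
rewrite RintegralD//; last by apply: integrable_cst_fin => //; exact: probability_lty.
have Eg : \int[P]_w (g / q) = g / q.
  rewrite /Rintegral (_ : (fun w => (g / q)%:E) = cst (g / q)%:E)//.
  rewrite integral_cst//; have PT : P setT = 1%E by exact: probability_setT.
  by have -> : ((g / q)%:E * P setT = (g / q)%:E)%E by rewrite PT mule1.
by rewrite RintegralD// Eg !RintegralZl//; ring.
Qed.

End conditional_inversion.

(** * Conditional laws *)

(** Adapted to survival functions known only at [b > 0]. The rays from [n.+1%:R^-1] increase to ]0,
    +oo[, which gives equality of the total masses; finiteness then allows passing to complements
    and lower rays. *)
Lemma measure_unique_pos_ray {R : realType} (m1 m2 : {measure set R -> \bar R}) :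
  (m1 setT < +oo)%E ->
  m1 `]-oo, 0]%classic = 0%E -> m2 `]-oo, 0]%classic = 0%E ->
  (forall b, 0 < b -> m1 `[b, +oo[%classic = m2 `[b, +oo[%classic) ->
  forall A, measurable A -> m1 A = m2 A.
Proof.
move=> m1oo m10 m20 m12.
have posE : (`]0, +oo[%classic : set R) = \bigcup_n `[n.+1%:R^-1, +oo[%classic.
  apply/seteqP; split => x /=; rewrite in_itv/= andbT; last first.
    by move=> [n _]; rewrite /= in_itv/= andbT; apply: lt_le_trans; rewrite invr_gt0.
  move=> x0; exists (Num.truncn x^-1) => //=; rewrite in_itv/= andbT.
  by rewrite -[leRHS]invrK lef_pV2 ?posrE ?invr_gt0// ltW// truncnS_gt.
have ndF : nondecreasing_seq (fun n : nat => (`[n.+1%:R^-1, +oo[%classic : set R)).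
  move=> m n mn; apply/subsetPset => x /=; rewrite !in_itv/= !andbT; apply: le_trans.
  by rewrite lef_pV2 ?posrE// ler_nat.
have pos : m1 `]0, +oo[%classic = m2 `]0, +oo[%classic.
  have mU : measurable (\bigcup_n `[n.+1%:R^-1, +oo[%classic : set R) by rewrite -posE.
  have c1 := nondecreasing_cvg_mu (mu := m1) (fun n => measurable_itv `[n.+1%:R^-1, +oo[) mU ndF.
  have c2 := nondecreasing_cvg_mu (mu := m2) (fun n => measurable_itv `[n.+1%:R^-1, +oo[) mU ndF.
  rewrite posE; apply: (cvg_unique (@ereal_hausdorff R) c1).
  rewrite (_ : m1 \o _ = m2 \o (fun n : nat => (`[n.+1%:R^-1, +oo[%classic : set R)))//.
  by apply/funext => n /=; rewrite m12// invr_gt0.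
have total (m : {measure set R -> \bar R}) : m `]-oo, 0]%classic = 0%E -> m setT = m `]0, +oo[%classic.
  move=> m0; have -> : (setT : set R) = `]-oo, 0] `|` `]0, +oo[.
    by apply/seteqP; split => x //= _; rewrite !in_itv/= andbT; apply/orP; rewrite leNgt orNb.
  rewrite -[RHS]add0e -m0; apply: measureU => //.
  by rewrite -subset0 => x /= []; rewrite !in_itv/= andbT leNgt => /negP.
have T12 : m1 setT = m2 setT by rewrite !total.
apply: measure_unique_ray => b; last first.
  by apply: le_lt_trans m1oo; apply: le_measure; rewrite ?inE.
have [b0|b0] := leP b 0.
  have sub : `]-oo, b[ `<=` (`]-oo, 0]%classic : set R).
    by move=> x /=; rewrite !in_itv/= => /ltW/le_trans; apply.
  by rewrite !(subset_measure0 _ _ sub).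
have split (m : {measure set R -> \bar R}) : m setT = (m `]-oo, b[%classic + m `[b, +oo[%classic)%E.
  have -> : (setT : set R) = `]-oo, b[ `|` `[b, +oo[.
    by apply/seteqP; split => x //= _; rewrite !in_itv/= andbT; apply/orP; rewrite ltNge orNb.
  rewrite measureU// -subset0 => x /= []; rewrite !in_itv/= andbT ltNge.
  by move=> /negP.
have fin : m1 `[b, +oo[%classic \is a fin_num.
  by rewrite ge0_fin_numE//; apply: le_lt_trans m1oo; apply: le_measure; rewrite ?inE.
have := T12; rewrite (split m1) (split m2) -m12// => h.
by rewrite -[LHS](addeK _ fin) h addeK.
Qed.

(** * Kernel of the laws of a parametrized variable *)

Section law_kernel.
Context {d d'} {T : measurableType d} {T' : measurableType d'} {R : realType}.
Variables (P : probability T R) (Z : R * T -> T').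
Hypothesis mZ : measurable_fun setT Z.

Let mZs s : measurable_fun setT (fun w => Z (s, w)).
Proof.
have mp : measurable_fun setT (fun w : T => (s, w)) by exact: measurable_pair1.
exact: (measurableT_comp mZ mp).
Qed.

Definition law_kernel (s : R) : {measure set T' -> \bar R} :=
  distribution P (mfun_Sub (mem_set (mZs s)) : {mfun T >-> T'}).

Lemma law_kernelE s A : law_kernel s A = P [set w | A (Z (s, w))].
Proof. by []. Qed.

Let measurable_law_kernel A : measurable A -> measurable_fun setT (law_kernel ^~ A).
Proof.
move=> mA; have mZA : measurable (Z @^-1` A).
  by rewrite -[X in measurable X]setTI; exact: mZ.
apply: (@eq_measurable_fun _ _ _ _ _ (fun s => P (xsection (Z @^-1` A) s))).
  by move=> s _; rewrite law_kernelE; congr (P _); apply/seteqP; split => w /=; rewrite /xsection/= inE.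
exact: measurable_fun_xsection.
Qed.

HB.instance Definition _ := isKernel.Build _ _ _ _ _ law_kernel measurable_law_kernel.

Let law_kernelT s : law_kernel s setT = 1%E.
Proof. by rewrite law_kernelE -[RHS](@probability_setT _ _ _ P); congr (P _); apply/seteqP. Qed.

HB.instance Definition _ := Kernel_isProbability.Build _ _ _ _ _ law_kernel law_kernelT.

End law_kernel.

Section conditional_uniqueness.
Context {d} {T : measurableType d} {R : realType}.
Variables (P : probability T R) (f : T -> \bar R) (L : {mfun T >-> R}).

Let ray (y : R) : set (\bar R) := [set t | (t < y%:E)%E].

Let mray y : measurable (ray y).
Proof.
rewrite (_ : ray y = `]-oo, y%:E[%classic); first exact: emeasurable_itv.
by apply/seteqP; split => t; rewrite /ray/= in_itv/=.
Qed.

Let ray_bigcup y : ray y = \bigcup_n ray (y - n.+1%:R^-1).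
Proof.
apply/seteqP; split => t; rewrite /ray/=; last first.
  by move=> [n _ /= /lt_trans]; apply; rewrite lte_fin ltrBlDr ltrDl invr_gt0.
case: t => [t||]; rewrite ?lte_fin//; last by move=> _; exists 0%N => //=; rewrite ltNyr.
rewrite -subr_gt0 => ty; exists (Num.truncn (y - t)^-1) => //=; rewrite lte_fin.
by rewrite ltrBrDr -ltrBrDl -[ltRHS]invrK ltf_pV2 ?posrE ?invr_gt0// truncnS_gt.
Qed.

Let ray_nd y : nondecreasing_seq (fun n => ray (y - n.+1%:R^-1)).
Proof.
move=> m n mn; apply/subsetPset => t; rewrite /ray/= => /lt_le_trans; apply.
by rewrite lee_fin lerD2l lerN2 lef_pV2 ?posrE// ler_nat.
Qed.

(** An open ray is the increasing limit of the rays ending at [y - n.+1%:R^-1], and a rational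
    threshold fits between each of these ends and [y]. *)
Let ray_le (m1 m2 : {measure set (\bar R) -> \bar R}) y :
  (forall q : rat, m1 (ray (ratr q)) = m2 (ray (ratr q))) -> (m1 (ray y) <= m2 (ray y))%E.
Proof.
move=> m12; have c1 := nondecreasing_cvg_mu (mu := m1) (fun n => mray (y - n.+1%:R^-1))
  (bigcupT_measurable _ (fun n => mray (y - n.+1%:R^-1))) (@ray_nd y).
rewrite ray_bigcup -(cvg_lim _ c1)//; apply: lime_le.
  by apply/cvg_ex; eexists; exact: c1.
apply: nearW => n /=; rewrite -ray_bigcup.
have lt_y : y - n.+1%:R^-1 < y by rewrite ltrBlDr ltrDl invr_gt0.
have [q] := rat_in_itvoo lt_y.
rewrite in_itv/= => /andP[q1 q2]; apply: (@le_trans _ _ (m1 (ray (ratr q)))).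
  by apply: le_measure; rewrite ?inE// /ray => t /= /lt_trans; apply; rewrite lte_fin.
rewrite m12; apply: le_measure; rewrite ?inE// /ray => t /= /lt_trans; apply.
by rewrite lte_fin.
Qed.

(** For one threshold the two kernels have equal integrals over every Borel set, hence agree almost
    everywhere. Doing this for rational thresholds costs a single null set, and [ray_le] in both
    directions then covers every real [y]. *)
Lemma rcd_ae_unique (k1 k2 : R.-pker R ~> \bar R) :
  regular_conditional_distribution P f L k1 ->
  regular_conditional_distribution P f L k2 ->
  {ae distribution P L, forall s, forall y : R,
    k1 s [set t | (t < y%:E)%E] = k2 s [set t | (t < y%:E)%E]}.
Proof.
(* Enumeration of the rationals; a code that decodes to nothing is sent to 0. *)
move=> K1 K2; pose q (n : nat) : rat := odflt 0 (unpickle n).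
have mk (k : R.-pker R ~> \bar R) y : measurable_fun setT (k ^~ (ray y)).
  exact: measurable_kernel.
have aeq n : {ae distribution P L, forall s, k1 s (ray (ratr (q n))) = k2 s (ray (ratr (q n)))}.
  have := @integral_ae_eq _ _ _ (distribution P L) setT measurableT
    (k2 ^~ (ray (ratr (q n)))) (k1 ^~ (ray (ratr (q n)))).
  have i1 : (distribution P L).-integrable setT (k1 ^~ (ray (ratr (q n)))).
    apply: (@le_integrable _ _ _ (distribution P L) setT measurableT _ (cst 1%E)) => //.
    - move=> s _ /=; rewrite gee0_abs// normr1; have PT : k1 s setT = 1%E by exact: prob_kernel.
      by rewrite -[X in (_ <= X)%E]PT; apply: le_measure; rewrite ?inE.
    - exact: finite_measure_integrable_cst.
  move=> /(_ i1 (mk _ _)) h.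
  have {}h := h (fun E _ mE => etrans (esym (K1 _ _ (mray _) mE)) (K2 _ _ (mray _) mE)).
  by apply: filterS h => s /(_ I).
have := ae_foralln aeq; apply: filterS => s h y; apply/eqP; rewrite eq_le.
have hq (r : rat) : k1 s (ray (ratr r)) = k2 s (ray (ratr r)).
  by have := h (pickle r); rewrite /q pickleK.
by apply/andP; split; apply: ray_le => r; rewrite hq.
Qed.

End conditional_uniqueness.

(** * Laplace transform of the tail of the losses *)

Section tail.
Context {R : realType}.
Notation mu := (@lebesgue_measure R).
Variables (a p : R) (a0 : 0 < a) (p1 : 1 < p).

Let p0 : 0 < p. Proof. by rewrite (lt_trans _ p1). Qed.
Let delta := p^-1.
Let delta0 : 0 < delta. Proof. by rewrite invr_gt0. Qed.

(** The same map as [loss_scale], with [a] the rate and [p = beta / 2]. *)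
Definition scale (v : R) : R := (v / a) `^ p.

Lemma scale_gt0 v : 0 < v -> 0 < scale v.
Proof. by move=> v0; rewrite powR_gt0// divr_gt0. Qed.

Lemma scaleK s : 0 < s -> scale (a * s `^ delta) = s.
Proof.
move=> s0; rewrite /scale mulrAC divff ?gt_eqF// mul1r -powRrM mulVf ?gt_eqF//.
by rewrite powRr1// ltW.
Qed.

Definition laplace_kernel (t v : R) : R := 1 - expR (- (t / scale v)).

(** For [t > 0] this is [phi (2 * p)] at the real point [t], minus 1. *)
Definition jump_exponent (t : R) : R :=
  \int[mu]_(y in `[1, +oo[) (1 - expR (- power_jump p y * t)).

Lemma laplace_kernel_01 t v : 0 <= t -> 0 <= laplace_kernel t v <= 1.
Proof.
move=> t0; rewrite /laplace_kernel; apply/andP; split; last by rewrite lerBlDr lerDl expR_ge0.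
by rewrite subr_ge0 -[leRHS]expR0 ler_expR oppr_le0 divr_ge0// powR_ge0.
Qed.

Lemma continuous_laplace_kernel t v : 0 < v -> {for v, continuous (laplace_kernel t)}.
Proof.
move=> v0; have va : 0 < v / a by rewrite divr_gt0.
have cs : {for v, continuous scale}.
  have dq : is_derive v 1 (fun v : R => v / a) a^-1.
    by apply: is_derive_eq; rewrite /GRing.scale/= mulr0 add0r mulr1.
  exact: (is_derive_continuous (@is_derive1_comp R (fun x => x `^ p) (fun v => v / a)
    v _ _ (is_derive1_powR p va) dq)).
apply: cvgB; first exact: cvg_cst.
apply: (@continuous_comp _ _ _ (fun v => - (t / scale v)) expR); last exact: continuous_expR.
apply: cvgN; apply: cvgM; first exact: cvg_cst.
by apply: cvgV; [rewrite gt_eqF// scale_gt0|exact: cs].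
Qed.

Lemma measurable_laplace_kernel t : measurable_fun setT (laplace_kernel t).
Proof.
apply: measurable_funB => //; apply: (measurableT_comp (continuous_measurable_fun (@continuous_expR R))).
apply: measurableT_comp => //; apply: measurable_funM => //.
apply: (measurableT_comp measurable_invr); apply: (measurableT_comp (measurable_powR _)).
exact: measurable_funM.
Qed.

Lemma jump_exponent_bound t : 0 <= t -> forall y,
  `|1 - expR (- power_jump p y * t)| <= t * power_jump p y.
Proof.
move=> t0 y; have x0 := power_jump_gt0 p y.
rewrite ger0_norm; last by rewrite subr_ge0 expRN_le1// ltW.
by rewrite lerBlDr -lerBlDl (le_trans _ (expR_ge1Dx _))// mulNr mulrC.
Qed.

Lemma integrable_jump_exponent t : 0 <= t ->
  mu.-integrable `[1, +oo[ (EFin \o (fun y => 1 - expR (- power_jump p y * t))).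
Proof.
move=> t0; apply: (@integrable_dominated _ _ _ mu _ _ (fun y => t * power_jump p y)) => //.
- by have := integrableZl _ t (integrable_power_jump p1); apply.
- apply: measurable_funTS; apply: measurable_funB => //.
  apply: (measurableT_comp (continuous_measurable_fun (@continuous_expR R))).
  apply: measurable_funM => //; apply: measurableT_comp => //; exact: measurable_power_jump.
- by move=> y _; exact: jump_exponent_bound.
Qed.

Lemma jump_exponent_le t : 0 <= t -> jump_exponent t <= t / (p - 1).
Proof.
move=> t0; have -> : t / (p - 1) = \int[mu]_(y in `[1, +oo[) (t * power_jump p y).
  by rewrite RintegralZl//; [rewrite /Rintegral integral_power_jump|exact: integrable_power_jump].
apply: le_Rintegral => //.
- exact: integrable_jump_exponent.
- by have := integrableZl _ t (integrable_power_jump p1); apply.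
- by move=> y _; rewrite (le_trans (ler_norm _))// jump_exponent_bound.
Qed.

(** Substitution [v = a * s]^ delta * y[, for which]scale v = s * y [^ p]: the integral scales to
    [1, +oo[ and becomes the jump exponent at [t / s]. *)
Lemma integral_laplace_kernel s t : 0 < s -> 0 <= t ->
  (\int[mu]_(v in `[(a * s `^ delta)%R, +oo[) (laplace_kernel t v)%:E =
   (a * s `^ delta * jump_exponent (t / s))%:E)%E.
Proof.
move=> s0 t0; set v0 := a * s `^ delta.
have v00 : 0 < v0 by rewrite mulr_gt0// powR_gt0.
pose F (y : R) := v0 * y.
have dF (y : R) : is_derive y 1 F v0.
  by rewrite /F; apply: is_derive_eq; rewrite /GRing.scale/= mulr1.
have F'E : F^`()%classic = cst v0.
  by apply/funext => y; rewrite derive1E; exact: derive_val.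
have cF : continuous F by move=> y; exact: is_derive_continuous.
transitivity (\int[mu]_(v in `[F 1%R, +oo[) (laplace_kernel t v)%:E)%E.
  by rewrite /F mulr1.
rewrite (@increasing_ge0_integration_by_substitutiony _ F (laplace_kernel t) 1)//; first last.
- by move=> v _; have /andP[] := laplace_kernel_01 v t0.
- apply: continuous_in_subspaceT => v; rewrite inE/= in_itv/= andbT /F mulr1 => vv.
  by apply: continuous_laplace_kernel; exact: lt_le_trans vv.
- by apply: gt0_cvgMry.
- split; first by move=> y _; exact: ex_derive.
  by apply: cvg_at_right_filter; exact: cF.
- by rewrite F'E; apply/cvg_ex; exists v0; exact: cvg_cst.
- by rewrite F'E; apply/cvg_ex; exists v0; exact: cvg_cst.
- by rewrite F'E => y _; exact: cvg_cst.
- by move=> x y _ _ xy; rewrite /F ltr_pM2l.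
have ts0 : 0 <= t / s by rewrite divr_ge0// ltW.
rewrite /jump_exponent -RintegralZl//; last exact: integrable_jump_exponent.
rewrite /Rintegral fineK; last first.
  apply: integrable_fin_num => //.
  by have := integrableZl _ v0 (integrable_jump_exponent ts0); apply.
apply: eq_integral => y; rewrite inE/= in_itv/= andbT => y1; congr EFin.
have y0 : 0 < y by rewrite (lt_le_trans _ y1).
rewrite F'E fctE mulrC; congr (_ * (1 - expR _)).
have fE : F y / a = s `^ delta * y by rewrite /F /v0; field; rewrite gt_eqF.
rewrite /scale fE powRM ?powR_ge0 ?(ltW y0)// -powRrM mulVf ?gt_eqF// powRr1 ?(ltW s0)//.
by rewrite power_jumpE// powRN invfM mulrA mulNr mulrC.
Qed.

Lemma integrable_laplace_kernel v t : 0 < v -> 0 <= t ->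
  mu.-integrable `[v, +oo[ (EFin \o laplace_kernel t).
Proof.
move=> v0 t0; have va : 0 < v / a by rewrite divr_gt0.
(* Every [v > 0] is a lower bound of the form treated by [integral_laplace_kernel], with
   [s = scale v]. *)
have vE : v = a * scale v `^ delta.
  by rewrite /scale -powRrM mulfV ?gt_eqF// powRr1 ?(ltW va)// mulrC divfK ?gt_eqF.
apply/integrableP; split.
  by apply/measurable_EFinP; apply: measurable_funTS; exact: measurable_laplace_kernel.
rewrite vE; apply: (@le_lt_trans _ _ ((a * scale v `^ delta * jump_exponent (t / scale v))%:E)).
  rewrite -(integral_laplace_kernel (scale_gt0 v0) t0) le_eqVlt; apply/orP; left; apply/eqP.
  apply: eq_integral => x _ /=; rewrite ger0_norm//.
  by have /andP[] := laplace_kernel_01 x t0.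
exact: ltry.
Qed.

Definition laplace_tail (t v : R) : R := \int[mu]_(x in `[v, +oo[) laplace_kernel t x.

Lemma laplace_tailE s t : 0 < s -> 0 <= t ->
  laplace_tail t (a * s `^ delta) = a * s `^ delta * jump_exponent (t / s).
Proof. by move=> s0 t0; rewrite /laplace_tail /Rintegral integral_laplace_kernel. Qed.

Lemma laplace_tail_ge0 t v : 0 <= t -> 0 <= laplace_tail t v.
Proof. by move=> t0; apply: Rintegral_ge0 => x _; have /andP[] := laplace_kernel_01 x t0. Qed.

(** From the fixed point [v / 2] on, the tail is a constant minus an integral with variable upper
    end, to which the fundamental theorem of calculus applies. *)
Lemma is_derive_laplace_tail (t v : R) : 0 <= t -> 0 < v ->
  is_derive v 1 (laplace_tail t) (- laplace_kernel t v).
Proof.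
move=> t0 v0; pose u := v / 2.
have u0 : 0 < u by rewrite divr_gt0.
have uv : u < v by rewrite /u; lra.
pose G x := \int[mu]_(y in `[u, x]) laplace_kernel t y.
have iu := integrable_laplace_kernel u0 t0.
have ic : mu.-integrable `[u, v + 1] (EFin \o laplace_kernel t).
  apply: integrableS iu => //; apply: subset_itvl; rewrite bnd_simp//.
have v1 : v < v + 1 by rewrite ltrDl.
have [||dG G'] := @continuous_FTC1 R (laplace_kernel t) (BLeft u) v (v + 1) v1 ic.
- by rewrite lte_fin.
- exact: continuous_laplace_kernel.
have dG' : is_derive v 1 G (laplace_kernel t v).
  by apply: DeriveDef; [exact: dG|rewrite -derive1E; exact: G'].
have dc : is_derive v 1 (fun x => laplace_tail t u - G x) (- laplace_kernel t v).
  apply: is_derive_eq. by rewrite add0r mul1r.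
apply: near_eq_is_derive dc; near=> x.
have ux : u < x by near: x; exact: lt_nbhsr.
have x0 : 0 < x by exact: lt_trans ux.
have split : (`[u, +oo[%classic : set R) = `[u, x] `|` `]x, +oo[.
  by rewrite -itv_bndbnd_setU// bnd_simp// ltW.
rewrite {1}/laplace_tail split Rintegral_setU//; last 2 first.
- by rewrite -split.
- rewrite disj_set2E; apply/eqP; rewrite -subset0 => y [] /=; rewrite !in_itv/= andbT.
  by move=> /andP[_ /le_lt_trans yx] /yx; rewrite ltxx.
rewrite -/(G x) addrAC subrr add0r Rintegral_itv_obnd_cbnd//.
apply: integrableS (integrable_laplace_kernel x0 t0) => //.
by apply: subset_itvr; rewrite bnd_simp.
Unshelve. all: by end_near. Qed.

Definition survival_laplace (t s : R) : R :=
  expR (- (a * s `^ delta + laplace_tail t (a * s `^ delta))).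

Definition intensity (s : R) : R := a * (delta * s `^ (delta - 1)).

(** The two parts of the exponent contribute [intensity s] and [- laplace_kernel * intensity s],
    whose sum is [intensity s * expR (- (t / s))]: a loss at [s] adds the power [1 / s]. *)
Lemma is_derive_survival_laplace (t s : R) : 0 <= t -> 0 < s ->
  is_derive s 1 (survival_laplace t)
    (- (intensity s * expR (- (t / s)) * survival_laplace t s)).
Proof.
move=> t0 s0; have v0 : 0 < a * s `^ delta by rewrite mulr_gt0// powR_gt0.
have d1 : is_derive s 1 (fun s => a * s `^ delta) (intensity s).
  have h := is_derive1_powR delta s0.
  by apply: is_derive_eq.
have d2 : is_derive s 1 (fun s => laplace_tail t (a * s `^ delta))
    (- laplace_kernel t (a * s `^ delta) * intensity s).
  exact: (@is_derive1_comp R (laplace_tail t) (fun s => a * s `^ delta) s _ _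
    (is_derive_laplace_tail t0 v0) d1).
have d3 : is_derive s 1 (fun s => - (a * s `^ delta + laplace_tail t (a * s `^ delta)))
    (- (intensity s + - laplace_kernel t (a * s `^ delta) * intensity s)).
  by apply: is_derive_eq.
have d4 := @is_derive1_comp R expR _ s _ _ (is_derive_expR _) d3.
apply: is_derive_eq d4 _; rewrite /laplace_kernel scaleK// /survival_laplace.
by ring.
Qed.

Lemma cvg_survival_laplace t : 0 <= t -> survival_laplace t s @[s --> +oo] --> (0 : R).
Proof.
move=> t0; apply: (@squeeze_cvgr _ _ _ _ (cst 0) (fun s => a^-1 * s `^ (- delta))).
- near=> s; have s0 : 0 < s by near: s; exact: nbhs_pinfty_gt.
  have v0 : 0 < a * s `^ delta by rewrite mulr_gt0// powR_gt0.
  rewrite expR_ge0/= /survival_laplace expRN powRN -invfM lef_pV2 ?posrE ?expR_gt0//.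
  rewrite (le_trans _ (expR_ge1Dx _))// addrCA lerDl addr_ge0//.
  exact: laplace_tail_ge0.
- exact: cvg_cst.
- rewrite -[X in _ --> X](mulr0 a^-1); apply: cvgMr; exact: cvg_powRN.
Unshelve. all: by end_near. Qed.

(** Fundamental theorem of calculus with limit 0 at +oo. It disintegrates the transform on [b <= L]
    over the value [s] of [L]. *)
Lemma integral_survival_laplace (t b : R) : 0 <= t -> 0 < b ->
  (\int[mu]_(s in `[b, +oo[) (intensity s * expR (- (t / s)) * survival_laplace t s)%:E =
   (survival_laplace t b)%:E)%E.
Proof.
move=> t0 b0.
have pos s : b <= s -> 0 < s by exact: lt_le_trans.
have dF (s : R) : b <= s -> is_derive s 1 (fun s => - survival_laplace t s)
    (intensity s * expR (- (t / s)) * survival_laplace t s).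
  move=> bs; have h := is_derive_survival_laplace t0 (pos _ bs).
  by apply: is_derive_eq; rewrite opprK.
apply: (etrans (FTC_infinity (l := 0) _ dF _ _)).
- by move=> s _; rewrite !mulr_ge0 ?expR_ge0 ?powR_ge0// ltW.
- move=> s bs; have s0 := pos _ bs; apply: cvgM; last first.
    exact: (is_derive_continuous (is_derive_survival_laplace t0 s0)).
  apply: cvgM.
    apply: cvgM; first exact: cvg_cst.
    apply: cvgM; first exact: cvg_cst.
    exact: (is_derive_continuous (is_derive1_powR (delta - 1) s0)).
  have ce : {for s, continuous (fun s : R => expR (- (t / s)))}.
    apply: (@continuous_comp _ _ _ (fun s : R => - (t / s)) expR); last exact: continuous_expR.
    apply: cvgN; apply: cvgM; first exact: cvg_cst.
    by apply: cvgV; [rewrite gt_eqF|exact: cvg_id].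
  exact: ce.
- by rewrite -[X in _ --> X]oppr0; apply: cvgN; exact: cvg_survival_laplace.
- by rewrite sub0r opprK.
Qed.

End tail.

(** * Conditioning on the smallest loss *)

Lemma ge0_integral_mfrestr {d} {T : measurableType d} {R : realType}
    (m : {measure set T -> \bar R}) (D : set T) (mD : measurable D)
    (moo : (m D < +oo)%E) (h : T -> \bar R) :
  (forall x, 0 <= h x)%E -> measurable_fun setT h ->
  (\int[mfrestr mD moo]_x h x = \int[m]_(x in D) h x)%E.
Proof.
move=> h0 mh; have mI : measurable_fun setT (\1_D : T -> R) by [].
have I0 (x : T) : 0 <= (\1_D x : R) by [].
transitivity (\int[mdensity m I0 mI]_x h x)%E.
  apply: eq_measure_integral => A mA _.
  by rewrite [RHS](integral_indic _ mA mD)/= setIC.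
rewrite ge0_integral_mdensity// [RHS]integral_mkcond; apply: eq_integral => x _.
by rewrite epatch_indic.
Qed.

Section poisson_losses.
Context {d} {T : measurableType d} {R : realType}.
Notation mu := (@lebesgue_measure R).
Variables (P : probability T R) (a p : R) (a0 : 0 < a) (p1 : 1 < p).
Variables (l : nat -> T -> R) (L : {mfun T >-> R}).
Hypotheses (ml : forall i, measurable_fun setT (l i)) (l0 : forall i w, 0 <= l i w).
Hypothesis LE : forall w, L w = inf (range (l ^~ w)).
(** The probabilistic input of the section: the losses are the image under [scale] of a Poisson
    process of unit rate on [0, +oo[. *)
Hypothesis laplace_losses : forall h : R -> \bar R, (forall r, 0 <= h r)%E ->
  measurable_fun setT h ->
  (\int[P]_w (expNe (\sum_(0 <= i <oo) h (l i w)))%:E =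
   (expNe (\int[mu]_(v in `[0%R, +oo[) (1 - expNe (h (scale a p v)))%:E))%:E)%E.

Let p0 : 0 < p. Proof. by rewrite (lt_trans _ p1). Qed.
Let delta := p^-1.
Let delta0 : 0 < delta. Proof. by rewrite invr_gt0. Qed.
Let tot w : \bar R := (\sum_(0 <= i <oo) ((l i w)%:E)^-1)%E.

Let has_lb w : has_lbound (range (l ^~ w)).
Proof. by exists 0 => _ [i _ <-]. Qed.

Let loss_inf_le w i : L w <= l i w.
Proof. by rewrite LE; apply: ge_inf => //; exists i. Qed.

Let loss_inf_lt w s : L w < s -> exists i, l i w < s.
Proof.
rewrite LE => /inf_lt[]; first by exists (l 0%N w), 0%N.
by move=> _ [i _ <-]; exists i.
Qed.

Let inve_ge0 (r : R) : 0 <= r -> (0 <= (r%:E)^-1)%E.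
Proof. by rewrite inver; case: ifPn => // _ r0; rewrite lee_fin invr_ge0. Qed.

Let term_le_series (g : nat -> \bar R) i : (forall i, 0 <= g i)%E ->
  (g i <= \sum_(0 <= k <oo) g k)%E.
Proof.
move=> g0; rewrite (@nneseriesD1 _ g i)//.
by rewrite leeDl// nneseries_ge0.
Qed.

Lemma integral_tail (h : R -> \bar R) (t s : R) : 0 <= t -> 0 < s ->
  measurable_fun setT h ->
  (forall r, s <= r -> h r = (t / r)%:E) ->
  (forall r, 0 <= r -> r < s -> h r = h 0) ->
  (0 <= h 0%R)%E ->
  (\int[mu]_(v in `[0%R, +oo[) (1 - expNe (h (scale a p v)))%:E =
   (a * s `^ delta * (1 - expNe (h 0%R)) + laplace_tail a p t (a * s `^ delta))%:E)%E.
Proof.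
move=> t0 s0 mh hge hlt h0; set v0 := a * s `^ delta.
have v00 : 0 < v0 by rewrite mulr_gt0// powR_gt0.
have scale_ge v : v0 <= v -> s <= scale a p v.
  move=> vv; rewrite -[leLHS](scaleK a0 p1 s0) /scale -/delta -/v0 ge0_ler_powR ?(ltW p0)//.
  - by rewrite nnegrE divr_ge0// ltW.
  - by rewrite nnegrE divr_ge0 ?(le_trans _ vv)// ltW.
  - by rewrite ler_pM2r ?invr_gt0.
have scale_lt v : 0 <= v -> v < v0 -> scale a p v < s.
  move=> vge vv; rewrite -[ltRHS](scaleK a0 p1 s0) /scale -/delta -/v0 gt0_ltr_powR//.
  - by rewrite nnegrE divr_ge0// ltW.
  - by rewrite nnegrE divr_ge0// ltW.
  - by rewrite ltr_pM2r ?invr_gt0.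
have ms : measurable_fun setT (scale a p).
  apply: (measurableT_comp (measurable_powR _)); exact: measurable_funM.
have mF : measurable_fun setT (fun v => (1 - expNe (h (scale a p v)))%:E).
  apply/measurable_EFinP; apply: measurable_funB => //.
  by apply: (measurableT_comp measurable_expNe); exact: (measurableT_comp mh ms).
have hs v : (0 <= v)%R -> (0 <= h (scale a p v))%E.
  move=> vge; have [/scale_ge sv|vv] := leP v0 v.
    by rewrite hge// lee_fin divr_ge0// (le_trans _ sv)// ltW.
  by rewrite hlt// ?powR_ge0// scale_lt.
have F0 v : 0 <= v -> (0 <= (1 - expNe (h (scale a p v)))%:E)%E.
  by move=> /hs /expNe_01/andP[_ e1]; rewrite lee_fin subr_ge0.
have -> : (`[0, +oo[%classic : set R) = `[0, v0[ `|` `[v0, +oo[.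
  by rewrite -itv_bndbnd_setU// bnd_simp ltW.
rewrite ge0_integral_setU//=; last 3 first.
- exact: measurable_funTS.
- move=> v [] /=; rewrite in_itv/= => /andP[v1 v2]; apply: F0 => //.
  by rewrite (le_trans _ v1)// ltW.
- rewrite disj_set2E; apply/eqP; rewrite -subset0 => v [] /=; rewrite !in_itv/= andbT.
  by move=> /andP[_ /lt_le_trans vv] /vv; rewrite ltxx.
rewrite EFinD; congr (_ + _)%E.
  transitivity (\int[mu]_(v in `[0%R, v0[) (cst (1 - expNe (h 0))%:E v))%E.
    apply: eq_integral => v; rewrite inE/= in_itv/= => /andP[v1 v2].
    by rewrite hlt ?powR_ge0// scale_lt.
  have mv : mu `[0%R, v0[%classic = v0%:E.
    by rewrite lebesgue_measure_itv/= lte_fin v00 sube0.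
  by rewrite integral_cst//= [X in (_ * X)%E]mv -EFinM mulrC.
rewrite laplace_tailE// -(integral_laplace_kernel a0 p1)//.
apply: eq_integral => v; rewrite inE/= in_itv/= andbT => vv.
by rewrite hge ?scale_ge// expNe_EFin.
Qed.

Lemma laplace_loss_inf (t s : R) : 0 <= t -> 0 < s ->
  (\int[P]_(w in [set w | (s <= L w)%R]) (expNe (t%:E * tot w))%:E =
   (survival_laplace a p t s)%:E)%E.
Proof.
move=> t0 s0; pose h r : \bar R := if r < s then +oo%E else (t / r)%:E.
have h0 r : (0 <= h r)%E.
  by rewrite /h; case: ltP => // sr; rewrite lee_fin divr_ge0// (le_trans _ sr)// ltW.
have mh : measurable_fun setT h.
  apply: measurable_fun_ifT => //; first exact: measurable_fun_ltr.
  by apply/measurable_EFinP; apply: measurable_funM => //; exact: measurable_invr.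
transitivity (\int[P]_w (expNe (\sum_(0 <= i <oo) h (l i w)))%:E)%E.
  rewrite integral_mkcond; apply: eq_integral => w _; rewrite patchE; case: ifPn.
    rewrite inE/= => sL; congr (expNe _)%:E; rewrite /tot -nneseriesZl//; last first.
      by move=> i _; exact: inve_ge0.
    apply: eq_eseriesr => i _; have sl : s <= l i w by exact: le_trans (loss_inf_le w i).
    by rewrite /h ltNge sl/= inver gt_eqF ?(lt_le_trans s0)// -EFinM.
  rewrite notin_setE/= => /negP; rewrite -ltNge => /loss_inf_lt[i li].
  suff -> : (\sum_(0 <= i <oo) h (l i w) = +oo)%E by [].
  apply/eqP; rewrite -leye_eq; apply: le_trans (term_le_series i _) => //.
  by rewrite /h li.
rewrite laplace_losses// (integral_tail t0 s0 mh); first last.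
- exact: h0.
- by move=> r _ rs; rewrite /h rs s0.
- by move=> r sr; rewrite /h ltNge sr.
by rewrite /h s0 expNe_EFin/survival_laplace subr0 mulr1.
Qed.

Let laplace_tail0 v : laplace_tail a p 0 v = 0.
Proof.
rewrite /laplace_tail (_ : laplace_kernel a p 0 = cst 0) ?Rintegral_cst0//.
  by rewrite /Rintegral integral0.
by apply/funext => x; rewrite /laplace_kernel mul0r oppr0 expR0 subrr.
Qed.

Let loss_density s := intensity a p s * expR (- (a * s `^ delta)).

Let loss_density_ge0 s : 0 <= loss_density s.
Proof. by rewrite !mulr_ge0 ?expR_ge0 ?powR_ge0 ?(ltW delta0) ?(ltW a0). Qed.

Let measurable_loss_density : measurable_fun setT loss_density.
Proof.
apply: measurable_funM.
  by do 2![apply: measurable_funM => //]; exact: measurable_powR.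
apply: (measurableT_comp (continuous_measurable_fun (@continuous_expR R))).
apply: measurableT_comp => //; apply: measurable_funM => //; exact: measurable_powR.
Qed.

Let measurable_ge (s : R) : measurable [set w | s <= L w].
Proof.
rewrite (_ : [set w | _] = L @^-1` `[s, +oo[).
  by rewrite -[X in measurable X]setTI; exact: measurable_funP.
by apply/seteqP; split => w; rewrite /= in_itv/= andbT.
Qed.

Lemma prob_loss_inf_ge s : 0 < s -> P [set w | s <= L w] = (expR (- (a * s `^ delta)))%:E.
Proof.
move=> s0; have := @laplace_loss_inf 0 s (lexx _) s0.
rewrite /survival_laplace laplace_tail0 addr0 => <-.
rewrite -[LHS]mul1e -integral_cst//; apply: eq_integral => w _.
by rewrite mul0e expNe_EFin oppr0 expR0.
Qed.

(** The event lies in [L < scale a p e], of probability [1 - expR (- e) <= e], for every [e > 0].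
    Losses therefore do not accumulate at 0. *)
Lemma prob_loss_inf_le0 : P [set w | L w <= 0] = 0%E.
Proof.
have mle : measurable [set w | L w <= 0].
  rewrite (_ : [set w | _] = L @^-1` `]-oo, 0]).
    by rewrite -[X in measurable X]setTI; exact: measurable_funP.
  by apply/seteqP; split => w; rewrite /= in_itv.
apply/eqP; rewrite eq_le measure_ge0 andbT; apply/lee_addgt0Pr => e e0.
have s0 : 0 < scale a p e := scale_gt0 p a0 e0.
have sE : a * scale a p e `^ delta = e.
  rewrite /scale -powRrM mulfV ?gt_eqF// powRr1 ?divr_ge0 ?ltW//.
  by rewrite mulrC divfK ?gt_eqF.
rewrite add0e; apply: (@le_trans _ _ (P (~` [set w | scale a p e <= L w]))).
  apply: le_measure; rewrite ?inE//; first exact: measurableC.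
  by move=> w /= Lw; apply/negP; rewrite -ltNge (le_lt_trans Lw).
rewrite probability_setC// prob_loss_inf_ge// sE -EFinB lee_fin.
by rewrite lerBlDr -lerBlDl (le_trans _ (expR_ge1Dx _)).
Qed.

(** Cut off at 0, since the real powers have default values on the negative axis. *)
Let pos_density s := \1_(`]0, +oo[%classic) s * loss_density s.

Let pos_density_ge0 s : 0 <= pos_density s. Proof. exact: mulr_ge0. Qed.

Let measurable_pos_density : measurable_fun setT pos_density.
Proof. exact: measurable_funM. Qed.

Let pos_integral (h : R -> \bar R) (A : set R) : measurable A ->
  (\int[mu]_(s in A) (h s * (pos_density s)%:E) =
   \int[mu]_(s in A `&` `]0%R, +oo[) (h s * (loss_density s)%:E))%E.
Proof.
move=> mA; rewrite integral_mkcondr; apply: eq_integral => s _.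
rewrite patchE /pos_density indicE; case: ifPn => _; first by rewrite mul1r.
by rewrite mul0r mule0.
Qed.

Let mid : measurable_fun setT (fun s : R => s). Proof. by []. Qed.

(** The case [t = 0] of [integral_survival_laplace] gives the mass of every ray from [b > 0], and
    the nonpositive axis has mass 0. *)
Lemma loss_inf_law A : measurable A ->
  distribution P L A = (\int[mu]_(s in A) (pos_density s)%:E)%E.
Proof.
move=> mA; pose p2 : {measure set R -> \bar R} :=
  pushforward (mdensity mu pos_density_ge0 measurable_pos_density) (fun s : R => s).
apply: (@measure_unique_pos_ray _ (distribution P L) (p2 mid)) => //.
- exact: probability_lty.
- transitivity (P [set w | L w <= 0]); last exact: prob_loss_inf_le0.
  by rewrite /= /distribution /pushforward; congr (P _); apply/seteqP; split => w; rewrite /= in_itv.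
- rewrite /p2/= /pushforward /mdensity/=; apply: integral0_eq => s; rewrite /= in_itv/= => sle.
  by rewrite /pos_density indicE memNset ?mul0r//= in_itv/= andbT ltNge sle.
- move=> b b0; rewrite /p2/= /distribution /pushforward.
  transitivity (P [set w | b <= L w]).
    by congr (P _); apply/seteqP; split => w; rewrite /= in_itv/= andbT.
  rewrite prob_loss_inf_ge//; have := integral_survival_laplace a0 p1 (lexx 0) b0.
  rewrite {2}/survival_laplace laplace_tail0 addr0 => <-; rewrite /mdensity.
  apply: eq_integral => s; rewrite inE/= in_itv/= andbT => bs.
  rewrite /pos_density indicE mem_set/= ?in_itv/= ?andbT ?(lt_le_trans b0)// mul1r.
  by rewrite mul0r oppr0 expR0 mulr1 /survival_laplace laplace_tail0 addr0.
Qed.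

Lemma integral_loss_inf (h : R -> \bar R) (A : set R) : measurable A ->
  (forall s, 0 <= h s)%E -> measurable_fun setT h ->
  (\int[distribution P L]_(s in A) h s =
   \int[mu]_(s in A `&` `]0%R, +oo[) (h s * (loss_density s)%:E))%E.
Proof.
move=> mA h0 mh; pose p2 : {measure set R -> \bar R} :=
  pushforward (mdensity mu pos_density_ge0 measurable_pos_density) (fun s : R => s).
transitivity (\int[p2 mid]_(s in A) h s)%E.
  by apply: eq_measure_integral => B mB _; exact: loss_inf_law.
have h0A s : (0 <= (h \_ A) s)%E by rewrite patchE; case: ifPn.
have mhA : measurable_fun setT (h \_ A).
  by apply/(measurable_restrictT _ mA); exact: measurable_funTS.
rewrite -pos_integral// integral_mkcond [RHS]integral_mkcond.
rewrite (ge0_integral_image (mdensity mu pos_density_ge0 measurable_pos_density) mid)//.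
rewrite ge0_integral_mdensity//.
by apply: eq_integral => s _; rewrite !patchE; case: ifPn => // _; rewrite mul0e.
Qed.

(** The value 0 for [r <= 0] keeps it nonnegative everywhere, so that the kernel built from it is
    defined on the whole line. *)
Let other (r x : R) : \bar R := if (0 < r) && (r <= x) then (r / x)%:E else 0%E.

Let other_ge0 r x : (0 <= other r x)%E.
Proof.
rewrite /other; case: ifPn => // /andP[r0 rx].
by rewrite lee_fin divr_ge0 ?ltW// (lt_le_trans r0).
Qed.

Let measurable_other {d'} {T' : measurableType d'} (f g : T' -> R) :
  measurable_fun setT f -> measurable_fun setT g ->
  measurable_fun setT (fun z => other (f z) (g z)).
Proof.
move=> mf mg; apply: measurable_fun_ifT => //.
  by apply: measurable_and; [exact: measurable_fun_ltr|exact: measurable_fun_ler].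
apply/measurable_EFinP; apply: measurable_funM => //.
by apply: measurableT_comp => //; exact: measurable_invr.
Qed.

(* [interference (s, w)] is [s] times the power received from the points with
   loss at least [s]; given [L = s], the interference factor has its law. *)
Definition interference (z : R * T) : \bar R :=
  (\sum_(0 <= i <oo) other z.1 (l i z.2))%E.

Lemma interference_ge0 z : (0 <= interference z)%E.
Proof. by apply: nneseries_ge0 => i _ _; exact: other_ge0. Qed.

Lemma measurable_interference : measurable_fun setT interference.
Proof.
apply: ge0_emeasurable_sum => // i _; apply: measurable_other => //.
exact: measurableT_comp.
Qed.

Let measurable_interference_pair s : measurable_fun setT (fun w => interference (s, w)).
Proof.
have mp : measurable_fun setT (fun w : T => (s, w)) by exact: measurable_pair1.
exact: (measurableT_comp measurable_interference mp).
Qed.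

(** [integral_tail] with weight 0 below [s]. The parameter is [t * s] because each term [s / x]
    carries the factor [s]. *)
Lemma laplace_interference (t s : R) : 0 <= t -> 0 < s ->
  (\int[P]_w (expNe (t%:E * interference (s, w)))%:E =
   (expR (- laplace_tail a p (t * s) (a * s `^ delta)))%:E)%E.
Proof.
move=> t0 s0; pose h x := (t%:E * other s x)%E.
have h0 r : (0 <= h r)%E by rewrite mule_ge0.
have mh : measurable_fun setT h.
  by apply: measurable_funeM; exact: measurable_other.
transitivity (\int[P]_w (expNe (\sum_(0 <= i <oo) h (l i w)))%:E)%E.
  by apply: eq_integral => w _; rewrite /interference -nneseriesZl.
have ts0 : 0 <= t * s by rewrite mulr_ge0// ltW.
rewrite laplace_losses// (integral_tail ts0 s0 mh)//.
- by rewrite {1}/h /other (leNgt s 0) s0 andbF mule0 !expNe_EFin oppr0 expR0 subrr mulr0 add0r.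
- by move=> r sr; rewrite /h /other s0 sr -EFinM mulrA.
- move=> r r0 rs; rewrite /h /other (leNgt s 0) s0 andbF.
  by rewrite leNgt rs andbF.
Qed.

(** Candidate for the total power given [L = s]: [1 / s] from the strongest point, the rest from an
    unconditioned process beyond [s]. The absolute value keeps it nonnegative when [s < 0]. *)
Let total (z : R * T) : \bar R := (`|z.1|^-1%:E * (1 + interference z))%E.

Let total_ge0 z : (0 <= total z)%E.
Proof. by rewrite mule_ge0 ?lee_fin ?invr_ge0// adde_ge0// interference_ge0. Qed.

Let measurable_total : measurable_fun setT total.
Proof.
apply: emeasurable_funM; last first.
  by apply: emeasurable_funD => //; exact: measurable_interference.
apply/measurable_EFinP; apply: (measurableT_comp measurable_invr).
by apply: measurableT_comp => //; exact: measurable_fst.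
Qed.

Lemma laplace_total (t s : R) : 0 <= t -> 0 < s ->
  (\int[P]_w (expNe (t%:E * total (s, w)))%:E =
   (expR (- (t / s)) * expR (- laplace_tail a p t (a * s `^ delta)))%:E)%E.
Proof.
move=> t0 s0; have ts0 : 0 <= t / s by rewrite divr_ge0// ltW.
have := laplace_interference ts0 s0; rewrite divfK ?gt_eqF// => E.
rewrite EFinM -E -ge0_integralZl//; last 2 first.
- apply/measurable_EFinP; apply: (measurableT_comp measurable_expNe).
  exact: measurable_funeM.
- move=> w _; have /expNe_01/andP[] : (0 <= (t / s)%:E * interference (s, w))%E.
    by rewrite mule_ge0// interference_ge0.
  by rewrite lee_fin.
apply: eq_integral => w _; rewrite /total/= gtr0_norm//.
have i0 := interference_ge0 (s, w).
by rewrite muleA -EFinM ge0_muleDr ?mule1 ?expNeD ?mule_ge0// expNe_EFin EFinM.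
Qed.

Let measurable_tot : measurable_fun setT tot.
Proof.
apply: ge0_emeasurable_sum => [i w _ _|i _]; first exact: inve_ge0.
rewrite (_ : (fun w => _) = fun w => if l i w == 0 then +oo%E else (l i w)^-1%:E).
  apply: measurable_fun_ifT => //; first exact: measurable_fun_eqr.
  by apply/measurable_EFinP; apply: measurableT_comp => //; exact: measurable_invr.
by apply/funext => w; rewrite inver.
Qed.

Let tot_ge0 w : (0 <= tot w)%E.
Proof. by apply: nneseries_ge0 => i _ _; exact: inve_ge0. Qed.

(** [laplace_unique] compares [tot] under [P] restricted to [b <= L] with [total] under the law of
    [L] times [P], restricted to [b <= s]. Both transforms equal [survival_laplace] at [b], the
    second one by [integral_survival_laplace]. *)
Let joint_ray (A : set (\bar R)) b : measurable A -> 0 < b ->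
  P ((tot @^-1` A) `&` [set w | b <= L w]) =
  (\int[distribution P L]_(s in `[b, +oo[) law_kernel P measurable_total s A)%E.
Proof.
move=> mA b0; pose nu : probability R R := distribution P L.
pose E := [set z : R * T | b <= z.1].
have mE : measurable E.
  rewrite (_ : E = `[b, +oo[%classic `*` setT); first exact: measurableX.
  by apply/seteqP; split => z; rewrite /E/= in_itv/= andbT// => -[].
have m1oo : (P [set w | (b <= L w)%R] < +oo)%E.
  by rewrite (le_lt_trans (probability_le1 _ _))// ltry.
have m2oo : ((nu \x P)%E E < +oo)%E.
  by rewrite (le_lt_trans (probability_le1 _ _))// ltry.
have -> : P ((tot @^-1` A) `&` [set w | b <= L w]) =
    mfrestr (measurable_ge b) m1oo (tot @^-1` A) by [].
rewrite (@laplace_unique _ _ _ _ _ (mfrestr (measurable_ge b) m1oo) (mfrestr mE m2oo)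
  tot total)//; last first.
  move=> n; have mg : measurable_fun setT (fun z => (expNe (n%:R%:E * total z))%:E).
    apply/measurable_EFinP; apply: (measurableT_comp measurable_expNe).
    exact: measurable_funeM.
  have g0 z : (0 <= (expNe (n%:R%:E * total z))%:E)%E.
    have /expNe_01/andP[] : (0 <= n%:R%:E * total z)%E by rewrite mule_ge0.
    by rewrite lee_fin.
  rewrite !ge0_integral_mfrestr//; last 2 first.
  - move=> w; have /expNe_01/andP[] : (0 <= n%:R%:E * tot w)%E by rewrite mule_ge0.
    by rewrite lee_fin.
  - apply/measurable_EFinP; apply: (measurableT_comp measurable_expNe).
    exact: measurable_funeM.
  rewrite laplace_loss_inf//.
  rewrite integral_mkcond fubini_tonelli1; last 2 first.
  - by apply/(measurable_restrictT _ mE); exact: measurable_funTS.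
  - by move=> z; rewrite patchE; case: ifPn.
  pose G s := (\int[P]_w (expNe (n%:R%:E * total (s, w)))%:E)%E.
  transitivity (\int[nu]_(s in `[b, +oo[) G s)%E; last first.
    rewrite [LHS]integral_mkcond; apply: eq_integral => s _; rewrite /fubini_F patchE.
    case: ifPn => [|] sb.
      by apply: eq_integral => w _; rewrite patchE mem_set//; move: sb; rewrite inE/= in_itv/= andbT.
    rewrite integral0_eq// => w _; rewrite patchE memNset// => /= bs.
    by move/negP: sb; apply; rewrite inE/= in_itv/= andbT.
  rewrite integral_loss_inf//; last 2 first.
  - by move=> s; exact: integral_ge0.
  - exact: (@measurable_fun_fubini_tonelli_F _ _ _ _ _ P
      (fun z => (expNe (n%:R%:E * total z))%:E)).
  rewrite -(integral_survival_laplace a0 p1)//.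
  rewrite (_ : `[b, +oo[ `&` `]0, +oo[ = `[b, +oo[%classic); last first.
    by apply/setIidPl => s /=; rewrite !in_itv/= !andbT; exact: lt_le_trans.
  apply: eq_integral => s; rewrite inE/= in_itv/= andbT => bs.
  have s0 : 0 < s by exact: lt_le_trans bs.
  rewrite /G laplace_total// -EFinM; congr EFin.
  by rewrite /loss_density /survival_laplace opprD expRD; ring.
transitivity ((nu \x P)%E ((total @^-1` A) `&` E)) => //.
rewrite /product_measure1/= [RHS]integral_mkcond; apply: eq_integral => s _.
rewrite patchE law_kernelE; case: ifPn => [|] sb.
  congr (P _); apply/seteqP; split => w /=; rewrite /xsection/= inE/=; first by case.
  by split => //; move: sb; rewrite inE/= in_itv/= andbT.
rewrite (_ : xsection _ _ = set0) ?measure0// -subset0 => w; rewrite /xsection/= inE/=.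
by move=> [_ bs]; move/negP: sb; apply; rewrite inE/= in_itv/= andbT.
Qed.

(** For fixed [A] both sides are finite measures in [B]; they agree on the rays of [joint_ray] and
    vanish on the nonpositive axis. *)
Lemma conditional_total : regular_conditional_distribution P tot L
  (law_kernel P measurable_total).
Proof.
move=> A B mA mB; set k := law_kernel P measurable_total.
have mC : measurable (tot @^-1` A).
  by rewrite -[X in measurable X]setTI; exact: measurable_tot.
have kfin s : k s A \is a fin_num.
  by rewrite ge0_fin_numE// (le_lt_trans (probability_le1 _ _))// ltry.
have mk : measurable_fun setT (fun s => fine (k s A)).
  by apply: measurableT_comp => //; exact: measurable_kernel.
have k0 s : 0 <= fine (k s A) by exact: fine_ge0.
pose m1 : {measure set R -> \bar R} := pushforward (mrestr P mC) L.
pose m2 : {measure set R -> \bar R} := mdensity (distribution P L) k0 mk.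
have m2E C : m2 C = (\int[distribution P L]_(s in C) k s A)%E.
  by apply: eq_integral => s _; rewrite fineK.
have L0 : distribution P L `]-oo, 0]%classic = 0%E.
  transitivity (P [set w | L w <= 0]); last exact: prob_loss_inf_le0.
  by rewrite /= /distribution /pushforward; congr (P _); apply/seteqP; split => w; rewrite /= in_itv.
rewrite setIC -m2E; apply: (@measure_unique_pos_ray _ (m1 (measurable_funP L)) m2) => //.
- rewrite /m1/= /pushforward/mrestr/= preimage_setT setTI.
  by rewrite (le_lt_trans (probability_le1 _ mC))// ltry.
- apply/eqP; rewrite eq_le measure_ge0 andbT -L0 /m1/=/distribution /pushforward /mrestr.
  have mL0 : measurable (L @^-1` `]-oo, 0]).
    by rewrite -[X in measurable X]setTI; exact: measurable_funP.
  by apply: le_measure; rewrite ?inE//; exact: measurableI.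
- rewrite m2E; apply: null_set_integral => //.
  by apply: measurable_funTS; exact: measurable_kernel.
- move=> b b0; rewrite m2E -joint_ray// setIC; congr (P (_ `&` _)).
  by apply/seteqP; split => w; rewrite /= in_itv/= andbT.
Qed.

(** The interference factor is a function of the pair (L, tot), so [rcd_joint] transfers the
    conditional law of [tot]; multiplying [total] by [s] and subtracting 1 leaves exactly
    [interference]. *)
Lemma conditional_interference :
  regular_conditional_distribution P (fun w => (L w)%:E * tot w - 1)%E L
    (law_kernel P measurable_interference).
Proof.
move=> A B mA mB; pose D := [set z : R * \bar R | B z.1 /\ A (z.1%:E * z.2 - 1)%E].
have mD : measurable D.
  have mg : measurable_fun setT (fun z : R * \bar R => (z.1%:E * z.2 - 1)%E).
    apply: emeasurable_funB => //; apply: emeasurable_funM => //.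
    by apply/measurable_EFinP; exact: measurable_fst.
  rewrite (_ : D = (B `*` setT) `&` ((fun z : R * \bar R => (z.1%:E * z.2 - 1)%E) @^-1` A)).
    apply: measurableI; first exact: measurableX.
    by rewrite -[X in measurable X]setTI; exact: mg.
  by apply/seteqP; split => z; rewrite /D /=; tauto.
have := rcd_joint measurable_tot conditional_total mD.
rewrite (_ : [set w | _] = (fun w => (L w)%:E * tot w - 1)%E @^-1` A `&` L @^-1` B); last first.
  by apply/seteqP; split => w; rewrite /D /=; tauto.
move=> ->.
rewrite (_ : (fun s => _) = fun s => law_kernel P measurable_total s (xsection D s)); last first.
  by apply/funext => s; congr (law_kernel _ _ _ _); apply/seteqP; split => t; rewrite /xsection/= inE.
(* Both integrals are moved to ]0, +oo[, where [s * total - 1] is [interference]. *)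
rewrite integral_loss_inf//; last exact: measurable_kernel.
rewrite integral_loss_inf//; last first.
  by apply: measurable_fun_xsection_finite_kernel; rewrite inE.
rewrite setTI integral_mkcondl [LHS]integral_mkcond [RHS]integral_mkcond.
apply: eq_integral => s _; rewrite !patchE; case: ifPn => //.
rewrite inE/= in_itv/= andbT => s0; rewrite !law_kernelE.
have E w : (s%:E * total (s, w) - 1 = interference (s, w))%E.
  rewrite /total/= gtr0_norm// muleA -EFinM divff ?gt_eqF// mul1e addeC addeA.
  by rewrite -EFinD addNr add0e.
case: ifPn => sB; last first.
  rewrite (_ : [set w | _] = set0) ?measure0 ?mul0e// -subset0 => w.
  by rewrite /xsection/= inE/= => -[Bs _]; move/negP: sB; apply; rewrite inE.
have xE w : xsection D s (total (s, w)) = (B s /\ A (interference (s, w))).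
  by rewrite /xsection/= inE -E.
have Bs : B s by rewrite inE in sB.
by congr (P _ * _)%E; apply/seteqP; split => w /=; rewrite xE; [case|split].
Qed.

(** For [t > 0] the transform at [t] is a lower bound for the probability that the interference is
    finite; as [t] tends to 0 it tends to 1, because the jump exponent is at most [t / (p - 1)]. *)
Lemma interference_lty s : 0 < s -> {ae P, forall w, (interference (s, w) < +oo)%E}.
Proof.
move=> s0; pose c := a * s `^ delta.
have mI := measurable_interference_pair s.
have mi : measurable [set w | interference (s, w) = +oo%E].
  rewrite (_ : [set w | _] = (fun w => interference (s, w)) @^-1` [set +oo%E])//.
  by rewrite -[X in measurable X]setTI; exact: mI.
have c0 : 0 < c by rewrite mulr_gt0// powR_gt0.
exists [set w | interference (s, w) = +oo%E]; split => //; last first.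
  by move=> w /= /negP; rewrite -leNgt leye_eq => /eqP.
apply/eqP; rewrite eq_le measure_ge0 andbT; apply/lee_addgt0Pr => e e0.
(* Chosen so that [c * (t / (p - 1)) = e]. *)
pose t := e * (p - 1) / c.
have t0 : 0 < t by rewrite divr_gt0// mulr_gt0// subr_gt0.
rewrite add0e; have := laplace_interference (ltW t0) s0.
have ts0 : 0 <= t * s by rewrite mulr_ge0// ltW.
rewrite laplace_tailE// mulfK ?gt_eqF// -/c => E.
rewrite -[X in P X]setCK probability_setC; last exact: measurableC.
rewrite leeBlDr; last by apply: fin_num_measure; exact: measurableC.
rewrite addeC -leeBlDr//.
apply: (@le_trans _ _ (expR (- (c * jump_exponent p t)))%:E).
  rewrite -EFinB lee_fin (le_trans _ (expR_ge1Dx _))// lerD2l lerN2.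
  have /(ler_wpM2l (ltW c0))/le_trans := jump_exponent_le p1 (ltW t0); apply.
  have p10 : p - 1 != 0 by rewrite subr_eq0 gt_eqF.
  by rewrite le_eqVlt; apply/orP; left; apply/eqP; rewrite /t; field; rewrite p10 gt_eqF.
have -> : P (~` [set w | interference (s, w) = +oo%E]) =
    (\int[P]_w (\1_(~` [set w | interference (s, w) = +oo%E]) w)%:E)%E.
  by rewrite integral_indic ?setIT//; exact: measurableC.
rewrite -E; apply: ge0_le_integral => //.
- move=> w _; have /expNe_01/andP[] : (0 <= t%:E * interference (s, w))%E.
    by rewrite mule_ge0 ?lee_fin ?(ltW t0)// interference_ge0.
  by rewrite lee_fin.
- apply/measurable_EFinP; apply: (measurableT_comp measurable_expNe).
  exact: measurable_funeM.
- by apply/measurable_EFinP; apply: measurable_indic; exact: measurableC.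
- move=> w _; rewrite lee_fin indicE; case: (pselect (interference (s, w) = +oo%E)) => wI.
    by rewrite memNset/=; [rewrite wI gt0_muley ?lte_fin//|exact].
  rewrite mem_set//; have /expNe_01/andP[] // : (0 <= t%:E * interference (s, w))%E.
  by rewrite mule_ge0 ?lee_fin ?(ltW t0)// interference_ge0.
Qed.

Let mray (y : R) : measurable [set t : \bar R | (t < y%:E)%E].
Proof.
rewrite (_ : [set t | _] = `]-oo, y%:E[%classic); first exact: emeasurable_itv.
by apply/seteqP; split => t; rewrite /= in_itv/=.
Qed.

Lemma law_interference_le0 (s y : R) : y <= 0 ->
  law_kernel P measurable_interference s [set t | (t < y%:E)%E] = 0%E.
Proof.
move=> y0; rewrite law_kernelE (_ : [set w | _] = set0) ?measure0// -subset0 => w /=.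
by rewrite ltNge (le_trans _ (interference_ge0 _))// lee_fin.
Qed.

(** The real-valued inversion applies to [fine] of the interference, which coincides with it almost
    surely by [interference_lty]; neither the transform nor the probability of the ray changes. *)
Lemma law_interference_inversion (beta s g y : R) :
  2 < beta -> p = beta / 2 -> 0 < s -> 0 < y -> 0 < g ->
  exists2 I : R,
    improper_integral (fun u => complex.Re (Lbar a beta s (Complex g u)) * cos (u * y)) I &
    law_kernel P measurable_interference s [set t | (t < y%:E)%E] =
      (1 - 2 * expR (g * y) / pi * I)%:E.
Proof.
move=> beta2 pE s0 y0 g0; pose V w := fine (interference (s, w)).
have deltaE : 2 / beta = delta by rewrite /delta pE invf_div.
have mV : measurable_fun setT V.
  by apply: measurableT_comp => //; exact: measurable_interference_pair.
have V0 w : 0 <= V w by rewrite fine_ge0// interference_ge0.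
have VE w : (interference (s, w) < +oo)%E -> (V w)%:E = interference (s, w).
  by move=> ioo; rewrite fineK// ge0_fin_numE// interference_ge0.
have as0 : 0 <= a * s `^ (2 / beta) by rewrite mulr_ge0 ?powR_ge0// ltW.
have aeI := interference_lty s0.
have LV t : 0 < t -> \int[P]_w expR (- V w * t) =
    expR (- (a * s `^ (2 / beta) *
      \int[mu]_(x in `[1, +oo[) (1 - expR (- power_jump (beta / 2) x * t)))).
  move=> t0; have := laplace_interference (ltW t0) s0.
  have ts0 : 0 <= t * s by rewrite mulr_ge0// ltW.
  rewrite laplace_tailE// mulfK ?gt_eqF// deltaE -pE => E.
  rewrite /Rintegral; transitivity (fine (expR (- (a * s `^ delta * jump_exponent p t)))%:E) => //.
  rewrite -E; congr fine; apply: ge0_ae_eq_integral => //.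
  - by apply/measurable_EFinP; apply: (measurableT_comp (continuous_measurable_fun (@continuous_expR R))); apply: measurable_funM => //; exact: measurableT_comp.
  - apply/measurable_EFinP; apply: (measurableT_comp measurable_expNe).
    by apply: measurable_funeM; exact: measurable_interference_pair.
  - move=> w _; have /expNe_01/andP[] : (0 <= t%:E * interference (s, w))%E.
      by rewrite mule_ge0 ?lee_fin ?(ltW t0)// interference_ge0.
    by rewrite lee_fin.
  - apply: filterS aeI => w /VE <- _.
    by rewrite -EFinM expNe_EFin mulNr mulrC.
have [I HI PI] := interference_inversion beta2 as0 mV V0 LV y0 g0.
exists I => //; rewrite -PI law_kernelE.
have mVy : measurable [set w | V w < y].
  rewrite (_ : [set w | _] = V @^-1` `]-oo, y[).
    by rewrite -[X in measurable X]setTI; exact: mV.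
  by apply/seteqP; split => w; rewrite /= in_itv.
have mIy : measurable [set w | (interference (s, w) < y%:E)%E].
  rewrite (_ : [set w | _] = (fun w => interference (s, w)) @^-1` [set t | (t < y%:E)%E])//.
  by rewrite -[X in measurable X]setTI; exact: measurable_interference_pair.
have PE A : measurable A -> P A = (\int[P]_w (\1_A w)%:E)%E.
  by move=> mA; rewrite integral_indic// setIT.
rewrite !PE//; apply: ge0_ae_eq_integral => //.
- by apply/measurable_EFinP; exact: measurable_indic.
- by apply/measurable_EFinP; exact: measurable_indic.
- apply: filterS aeI => w /VE VI _; rewrite !indicE; congr (nat_of_bool _)%:R%:E.
  by apply/idP/idP; rewrite !inE/= -VI lte_fin.
Qed.

End poisson_losses.

(** Numerator and denominator are multiplied by [x]. For [t = +oo] both sides are 0. *)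
Lemma sinr_inv {R : realType} (N x : R) (t : \bar R) : 0 <= N -> 0 < x -> (0 <= t)%E ->
  ((x%:E)^-1 / (N%:E + t - (x%:E)^-1) = (N%:E * x%:E + (x%:E * t - 1))^-1)%E.
Proof.
move=> N0 x0; have xn0 : x != 0 by rewrite gt_eqF.
rewrite inver (negPf xn0); case: t => [t||]//; last first.
  by move=> _; rewrite gt0_muley ?lte_fin// -EFinM !(addye, addey)// invey mulr0.
rewrite lee_fin => t0; rewrite -!EFinM -!EFinD.
have -> : N * x + (x * t - 1) = x * (N + t - x^-1) by field.
(* No noise and no other power: both sides are +oo. *)
have [->|D0] := eqVneq (N + t - x^-1) 0.
  by rewrite mulr0 inve0 gt0_muley// lte_fin invr_gt0.
by rewrite !inver (negPf D0) mulf_eq0 (negPf xn0) (negPf D0)/= -EFinM invfM.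
Qed.

(** Verifies the hypothesis [laplace_losses] for the model: [laplace_marked] averages points and
    marks, and [integral_loss] reduces the result to one dimension. *)
Lemma laplace_propagation_loss {d} {T : measurableType d} {R : realType}
    (P : probability T R) (lambda K beta : R)
    (X : nat -> {mfun T >-> (R * R)%type}) (S_ : nat -> {mfun T >-> R})
    (S : {mfun T >-> R}) (h : R -> \bar R) :
  0 < lambda -> 0 < K -> 2 < beta ->
  homogeneous_PPP P lambda X -> (forall w, 0 < S w) ->
  (forall i, identically_distributed P (S_ i) S) ->
  mutually_independent P S_ -> independent_sequences P X S_ ->
  ('E_P[fun w => (S w `^ (2 / beta))%R] < +oo)%E ->
  (forall r, 0 <= h r)%E -> measurable_fun setT h ->
  (\int[P]_w (expNe (\sum_(0 <= i <oo) h (propagation_loss K beta X S_ i w)))%:E =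
   (expNe (\int[lebesgue_measure]_(v in `[0%R, +oo[)
     (1 - expNe (h (scale (loss_rate P lambda K beta S) (beta / 2) v)))%:E))%:E)%E.
Proof.
move=> lambda0 K0 beta2 Xp S0 Sl Si XS Sm h0 mh.
have beta0 : 0 < beta by rewrite (lt_trans _ beta2).
have mU : measurable_fun setT (h \o loss K beta).
  exact: (measurableT_comp mh (measurable_loss K beta)).
have := laplace_marked lambda0 Xp Sl Si XS (fun z => h0 (loss K beta z)) mU.
move=> /= ->; congr (expNe _)%:E.
rewrite (integral_loss lambda0 K0 beta0 S0 Sm (k := fun r => (1 - expNe (h r))%:E))//.
- by move=> r; have /expNe_01/andP[_] := h0 r; rewrite lee_fin subr_ge0.
- apply/measurable_EFinP; apply: measurable_funB => //.
  exact: (measurableT_comp measurable_expNe mh).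
Qed.

Theorem proposition10 (R : realType) (d : measure_display)
    (T : measurableType d) (P : probability T R) (lambda K beta N : R)
    (X : nat -> {mfun T >-> (R * R)%type})
    (S_ : nat -> {mfun T >-> R}) (S : {mfun T >-> R})
    (lambda_gt0 : 0 < lambda) (K_gt0 : 0 < K) (beta_gt2 : 2 < beta)
    (N_ge0 : 0 <= N)
    (X_poisson : homogeneous_PPP P lambda X)
    (S_gt0 : forall w, 0 < S w)
    (Si_gt0 : forall i w, 0 < S_ i w)
    (Si_law : forall i, identically_distributed P (S_ i) S)
    (Si_indep : mutually_independent P S_)
    (XS_indep : independent_sequences P X S_)
    (S_moment : ('E_P[fun w => (S w `^ (2 / beta))%R] < +oo)%E) :
  let a := lambda * pi * fine ('E_P[fun w => (S w `^ (2 / beta))%R])%E / K ^+ 2 in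
  let L := path_loss_factor K beta X S_ in
  let f := interference_factor K beta X S_ in
  let Y := fun w => (N%:E * (L w)%:E + f w)%E in
  [/\ {ae P, forall w, SINR K beta X S_ N w = ((Y w)^-1)%E},
      forall B : set R, measurable B ->
        distribution P L B =
        (\int[lebesgue_measure]_(s in B `&` `]0%R, +oo[)
           (path_loss_density a beta s)%:E)%E,
      exists kappa : R.-pker R ~> \bar R,
        regular_conditional_distribution P f L kappa
    & forall kappa : R.-pker R ~> \bar R,
        regular_conditional_distribution P f L kappa ->
        let F := fun s y : R => kappa s [set t | (t < y%:E)%E] in
        (forall x : R,
           P [set w | (Y w < x%:E)%E] =
           (\int[distribution P L]_(s in `]0%R, +oo[) F s (x - N * s)%R)%E) /\
        {ae distribution P L, forall s, 0 < s ->
           (forall y, y <= 0 -> F s y = 0%E) /\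
           (forall y gamma, 0 < y -> 0 < gamma ->
              exists2 I : R,
                improper_integral
                  (fun u => complex.Re (Lbar a beta s (Complex gamma u)) *
                            cos (u * y)) I &
                F s y = (1 - 2 * expR (gamma * y) / pi * I)%:E)}].
Proof.
move=> a L f Y.
pose l := propagation_loss K beta X S_.
have a0 : 0 < a := loss_rate_gt0 lambda_gt0 K_gt0 S_gt0 S_moment.
have p1 : 1 < beta / 2 by rewrite ltr_pdivlMr// mul1r.
have invp : (beta / 2)^-1 = 2 / beta by rewrite invf_div.
have ml i : measurable_fun setT (l i) := measurable_propagation_loss K beta X S_ i.
have l0 i w : 0 <= l i w by rewrite divr_ge0 ?powR_ge0// ltW.
have LE w : L w = inf (range (l ^~ w)) by [].
have lap (h : R -> \bar R) h0 mh := laplace_propagation_loss lambda_gt0 K_gt0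
  beta_gt2 X_poisson S_gt0 Si_law Si_indep XS_indep S_moment (h := h) h0 mh.
have law (h : R -> \bar R) A mA h0 mh :=
  @integral_loss_inf _ _ _ P a (beta / 2) a0 p1 l L l0 LE lap h A mA h0 mh.
have LN0 : P [set w | L w <= 0] = 0%E :=
  @prob_loss_inf_le0 _ _ _ P a (beta / 2) a0 p1 l L l0 LE lap.
have mle : measurable [set w | L w <= 0].
  rewrite (_ : [set w | _] = L @^-1` `]-oo, 0]).
    by rewrite -[X in measurable X]setTI; exact: measurable_funP.
  by apply/seteqP; split => w; rewrite /= in_itv.
pose k0 := law_kernel P (measurable_interference ml).
have rcd0 : regular_conditional_distribution P f L k0 :=
  @conditional_interference _ _ _ P a (beta / 2) a0 p1 l L ml l0 LE lap.
split.
(* The algebra of [sinr_inv] requires a positive path loss, which holds outside this null set. *)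
- exists [set w | L w <= 0]; split => // w /= nE.
  rewrite leNgt; apply/negP => L0; apply: nE; apply: sinr_inv => //.
  apply: nneseries_ge0 => i _ _; rewrite inver; case: ifPn => // _.
  by rewrite lee_fin invr_ge0 l0.
- move=> B mB; rewrite -[LHS]mul1e -integral_cst// law//.
  apply: eq_integral => s _; rewrite mul1e /path_loss_density /intensity invp mulNr.
  by congr (EFin (_ * _)); ring.
- by exists k0.
move=> kappa rcd F; split.
- move=> x; pose D := [set z : R * \bar R | (N%:E * z.1%:E + z.2 < x%:E)%E].
  have mD : measurable D.
    have mg : measurable_fun setT (fun z : R * \bar R => (N%:E * z.1%:E + z.2)%E).
      apply: emeasurable_funD => //; apply: measurable_funeM.
      by apply/measurable_EFinP; exact: measurable_fst.
    rewrite (_ : D = (fun z : R * \bar R => (N%:E * z.1%:E + z.2)%E) @^-1` `]-oo, x%:E[).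
      by rewrite -[X in measurable X]setTI; apply: mg => //; exact: emeasurable_itv.
    by apply/seteqP; split => z; rewrite /D/= in_itv.
  have mf : measurable_fun setT f.
    apply: emeasurable_funB => //; apply: emeasurable_funM.
      by apply/measurable_EFinP; exact: measurable_funP.
    apply: ge0_emeasurable_sum => [i w _ _|i _].
      by rewrite inver; case: ifPn => // _; rewrite lee_fin invr_ge0 l0.
    rewrite (_ : (fun w => _) = fun w => if l i w == 0 then +oo%E else (l i w)^-1%:E).
      apply: measurable_fun_ifT => //; first exact: measurable_fun_eqr.
      by apply/measurable_EFinP; apply: measurableT_comp => //; exact: measurable_invr.
    by apply/funext => w; rewrite inver.
  transitivity (\int[distribution P L]_s kappa s [set t | D (s, t)])%E.
    exact: (rcd_joint mf rcd mD).
  (* [N * s] is finite, so it moves across the inequality also when [t] is infinite. *)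
  have DE s : [set t | D (s, t)] = [set t | (t < (x - N * s)%:E)%E].
    by apply/seteqP; split => -[t||]//=;
      rewrite /D/= -EFinM -?EFinD ?lte_fin ?ltrBrDl ?addeNy ?ltNyr.
  have mF : measurable_fun setT (fun s => F s (x - N * s)).
    rewrite (_ : (fun s => _) = fun s => kappa s (xsection D s)).
      by apply: measurable_fun_xsection_finite_kernel; rewrite inE.
    apply/funext => s; rewrite /F -DE; congr (kappa s _).
    by apply/seteqP; split => t; rewrite /xsection/= inE.
  transitivity (\int[distribution P L]_s F s (x - N * s)%R)%E.
    by apply: eq_integral => s _; rewrite DE.
  (* The law of [L] lives on ]0, +oo[, so both integrals reduce to that domain. *)
  by rewrite !law// setTI setIid.
(* One null set, from the comparison with the explicit kernel [k0], serves all [y] and [gamma] at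
   once. *)
- have := rcd_ae_unique rcd rcd0; apply: filterS => s E s0; split.
    by move=> y y0; rewrite /F E law_interference_le0.
  move=> y gamma y0 gamma0; rewrite /F E.
  exact: (@law_interference_inversion _ _ _ P a (beta / 2) a0 p1 l ml lap).
Qed.
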